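(* The (covariant) functor $\circ_{\mathcal G}: GB\to GPCB$, defined as the composition of the contravariant functor $F\mapsto F^{\ast}_{\mathcal G}$ with the graded duality functor, i.e. sending a graded bundle $F$ to the graded dual $(F^{\ast}_{\mathcal G})^\ast$ of the bundle $F^{\ast}_{\mathcal G}$, establishes an equivalence between the category $GB$ of graded bundles and the category $GPCB$ of graded polynomial coalgebra bundles.
   Context: Algebras are real, commutative, associative, with unit; $\mathbb N=\{0,1,2,\dots\}$. **Graded bundles.** Let $\mathcal G=(\mathbb R,\cdot)$ be the multiplicative monoid of reals. A graded bundle is a smooth manifold $F$ with a smooth action $h:\mathbb R\times F\to F$ of $\mathcal G$ ($h_t\circ h_s=h_{ts}$, $h_1=\mathrm{id}$). Its base is $M=h_0(F)$, its projection is $h_0:F\to M$. It is locally trivial with one typical fibre: there is $\mathbf d=(d_1,\dots,d_r)$, $d_i\in\mathbb N$, such that locally over $M$ it is isomorphic to $U\times\mathbb R^{\mathbf d}$, $\mathbb R^{\mathbf d}=\mathbb R^{d_1}\times\dots\times\mathbb R^{d_r}$, with $h_t(x,y_1,\dots,y_r)=(x,ty_1,\dots,t^ry_r)$. Morphisms in $GB$ are smooth maps intertwining the actions; such a map $f:F\to E$ covers a smooth map $\underline f$ of the bases. **Algebras and coalgebras.** $\mathcal A(\mathbb R^{\mathbf d})=\mathbb R[y_i^a]$ ($1\le a\le d_i$) is the polynomial algebra graded by giving $y_i^a$ weight $i$; all its graded pieces are finite-dimensional. For a graded vector space $W=\bigoplus_{i\ge0}W^i$ with finite-dimensional pieces the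 graded dual is $W^\ast=\bigoplus_{i\ge0}(W^i)^\ast$, and $(V\otimes W)^\ast\simeq V^\ast\otimes W^\ast$ for graded duals, $V\otimes W=\bigoplus_k\bigoplus_{i+j=k}V^i\otimes W^j$. The graded polynomial coalgebra $\mathcal A(\mathbb R^{\mathbf d})^\ast$ is the graded dual of $\mathcal A(\mathbb R^{\mathbf d})$ with comultiplication and counit dual to the multiplication and unit. Let $\mathbb A=\mathbb R[\varepsilon]$, graded by $\deg\varepsilon^i=i$, with the $\mathcal G$-action $h_t(\varepsilon^i)=t^i\varepsilon^i$. A map into $\mathbb A$ is smooth if its compositions with all projections $\mathbb A\to\mathbb A/\langle\varepsilon^{k+1}\rangle\simeq\mathbb R^{k+1}$ are smooth. **Bundles.** A locally finite-rank graded vector bundle over $M$ is $E=\bigoplus_{i\ge0}E^i$ with each $E^i\to M$ a finite-rank vector bundle; its graded dual is $E^\ast=\bigoplus_i(E^i)^\ast$. A standard morphism $E\to F$ of such bundles is a family of smooth vector bundle morphisms $E^i\to F^i$, $i\in\mathbb N$, over one common smooth base map. A graded polynomial coalgebra bundle is a locally finite-rank graded vector bundle locally trivialized as $U\times C$ with $C=\mathcal A(\mathbb R^{\mathbf d})^\ast$ for some $\mathbf d$, with transition cocycles valued in graded coalgebra automorphisms of $C$ and smooth in each degree. The category $GPCB$ has these as objects; its morphisms are standard morphisms which are fibrewise graded coalgebra homomorphisms. **Functor.** For a graded bundle $F\to M$, $F^{\ast}_{\mathcal G}\to M$ has fibres $(F^{\ast}_{\mathcal G})_x=\mathrm{Hom}_{\mathcal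 G}(F_x,\mathbb A)$, the algebra (pointwise operations) of smooth maps $F_x\to\mathbb A$ intertwining the actions; its degree-$i$ part consists of maps valued in $\mathbb R\varepsilon^i$ and its smooth sections correspond to smooth functions $g$ on $F$ with $g\circ h_t=t^ig$. Its graded dual is a coalgebra bundle by dualizing the multiplication and the unit. For a morphism $f:F\to E$ of graded bundles over $\underline f:M\to N$, the morphism $(F^{\ast}_{\mathcal G})^\ast\to(E^{\ast}_{\mathcal G})^\ast$ over $\underline f$ is, fibrewise, the graded dual of $\alpha\mapsto\alpha\circ f_x$, $(E^{\ast}_{\mathcal G})_{\underline f(x)}\to(F^{\ast}_{\mathcal G})_x$, where $f_x:F_x\to E_{\underline f(x)}$. *)

(* Defs.v *)
From HB Require Import structures.
From mathcomp Require Import all_boot all_order all_algebra.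
From mathcomp Require Import boolp classical_sets functions reals topology.
From mathcomp Require Import normedtype landau derive.
From mathcomp Require Import -(notations) mpoly.
Set Implicit Arguments.
Unset Strict Implicit.
Unset Printing Implicit Defensive.
Import Order.TTheory GRing.Theory Num.Theory numFieldNormedType.Exports.
Local Open Scope classical_set_scope.
Local Open Scope ring_scope.

Section Calculus.
Context (R : realType).
Implicit Types (m n k : nat).

(* Class C^k on an open set [U]: [f] is differentiable on [U] with all
   directional derivatives of class C^(k-1). *)
Fixpoint Ck k n (U : set 'rV[R]_n) (f : 'rV[R]_n -> R) : Prop :=
  if k is k'.+1 then
    (forall x, U x -> differentiable f x) /\ forall v, Ck k' U ('D_v f)
  else forall x, U x -> {for x, continuous f}.

Definition Cinf n (U : set 'rV[R]_n) (f : 'rV[R]_n -> R) : Prop :=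
  forall k, Ck k U f.

Lemma near_eq_differentiable n (f g : 'rV[R]_n -> R) x :
  {near x, f =1 g} -> differentiable f x -> differentiable g x.
Proof.
move=> fg /diff_locallyP[cdf fE].
have fgx : f x = g x by exact: (nbhs_singleton fg).
have gE : g \o shift x = cst (g x) + 'd f x +o_ 0 id.
  move/eqaddoP : fE => fE; apply/eqaddoP => e e0.
  have fg0 : \forall y \near (0 : 'rV[R]_n), f (y + x) = g (y + x).
    by move: fg; rewrite (near_shift 0 x) /=; apply: filterS => y; rewrite /= subr0.
  near=> y.
  have fgy : f (y + x) = g (y + x) by near: y.
  have : `|(f \o shift x - (cst (f x) + 'd f x)) y| <= e * `|y|.
    by near: y; exact: fE.
  by rewrite !fctE /= fgx fgy.
apply/diff_locallyP; have -> : 'd g x = 'd f x :> (_ -> _) by exact: diff_unique gE.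
by split.
Unshelve. all: by end_near. Qed.


Lemma Ck_ext k n (U : set 'rV[R]_n) f g : open U ->
  (forall x, U x -> f x = g x) -> Ck k U f -> Ck k U g.
Proof.
move=> oU; elim: k f g => [|k IH] f g fg /=.
  move=> cf x Ux; have fgn : {near x, f =1 g}.
    by apply: filterS (open_nbhs_nbhs (conj oU Ux)) => y Uy; exact: fg.
  move=> A; rewrite -(fg _ Ux) => /(cf x Ux).
  by apply: filterS2 fgn => y /= <-.
have fgn x : U x -> {near x, f =1 g}.
  by move=> Ux; apply: filterS (open_nbhs_nbhs (conj oU Ux)) => y Uy; exact: fg.
move=> [df Df]; split=> [x Ux|v].
  exact: near_eq_differentiable (fgn _ Ux) (df _ Ux).
apply: IH (Df v) => x Ux; exact: near_eq_derive (fgn _ Ux).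
Qed.

Lemma Ck_sub k n (U V : set 'rV[R]_n) f : V `<=` U -> Ck k U f -> Ck k V f.
Proof.
move=> VU; elim: k f => [|k IH] f /=; first by move=> + x /VU; apply.
by move=> [df Df]; split=> [x /VU|v]; [exact: df|exact: IH].
Qed.

Lemma CkW k n (U : set 'rV[R]_n) f : Ck k.+1 U f -> Ck k U f.
Proof.
elim: k f => [|k IH] f [df Df]; first by move=> x /df/differentiable_continuous.
by split=> // v; exact: IH.
Qed.

Lemma Ck_cst k n (U : set 'rV[R]_n) c : Ck k U (fun=> c).
Proof.
elim: k c => [|k IH] c; first by move=> x _; exact: cst_continuous.
split=> [x _|v]; first exact: differentiable_cst.
by rewrite (_ : 'D_v _ = fun=> 0) //; apply/funext => x; exact: derive_cst.
Qed.

Lemma CkD k n (U : set 'rV[R]_n) f g : open U ->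
  Ck k U f -> Ck k U g -> Ck k U (fun x => f x + g x).
Proof.
move=> oU; elim: k f g => [|k IH] f g /=.
  by move=> cf cg x Ux; apply: continuousD; [exact: cf|exact: cg].
move=> [df Df] [dg Dg]; split=> [x Ux|v].
  by apply: differentiableD; [exact: df|exact: dg].
apply: Ck_ext (IH _ _ (Df v) (Dg v)) => // x Ux; rewrite -deriveD //.
  exact/diff_derivable/df.
exact/diff_derivable/dg.
Qed.

Lemma CkM k n (U : set 'rV[R]_n) f g : open U ->
  Ck k U f -> Ck k U g -> Ck k U (fun x => f x * g x).
Proof.
move=> oU; elim: k f g => [|k IH] f g.
  by move=> cf cg x Ux; apply: continuousM; [exact: cf|exact: cg].
move=> Cf Cg; have [[df Df] [dg Dg]] := (Cf, Cg); split=> [x Ux|v].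
  by apply: differentiableM; [exact: df|exact: dg].
apply: Ck_ext (CkD oU (IH _ _ (CkW Cf) (Dg v)) (IH _ _ (CkW Cg) (Df v))) => //.
move=> x Ux; rewrite -[LHS]/(f x *: 'D_v g x + g x *: 'D_v f x) -deriveM //.
  exact/diff_derivable/df.
exact/diff_derivable/dg.
Qed.

Lemma Ck_sum k n (U : set 'rV[R]_n) p (f : 'I_p -> 'rV[R]_n -> R) : open U ->
  (forall i, Ck k U (f i)) -> Ck k U (fun x => \sum_i f i x).
Proof.
move=> oU; elim: p f => [|p IH] f Cf.
  apply: Ck_ext (Ck_cst k U 0) => // x _; by rewrite big_ord0.
apply: Ck_ext (CkD oU (Cf ord0) (IH _ (fun i => Cf (lift ord0 i)))) => // x _.
by rewrite big_ord_recl.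
Qed.

Lemma rVE m n (h : 'rV[R]_m -> 'rV[R]_n) :
  h = \sum_(j < n) (fun x => h x 0 j *: delta_mx 0 j).
Proof. by apply/funext => x; rewrite fct_sumE [LHS]row_sum_delta. Qed.

Lemma differentiable_rV m n (h : 'rV[R]_m -> 'rV[R]_n) x :
  (forall j, differentiable (fun y => h y 0 j) x) -> differentiable h x.
Proof.
by move=> dh; rewrite (rVE h); apply: differentiable_sum => j; exact: differentiableZl.
Qed.

Lemma continuous_rV m n (h : 'rV[R]_m -> 'rV[R]_n) x :
  (forall j, {for x, continuous (fun y => h y 0 j)}) -> {for x, continuous h}.
Proof.
move=> ch; rewrite (rVE h); elim/big_ind: _ => [|f g cf cg|j _]; first exact: cst_continuous.
  exact: continuousD.
exact: continuousZr_tmp.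
Qed.

Lemma Ck_comp k m n (U : set 'rV[R]_m) (O : set 'rV[R]_n)
    (h : 'rV[R]_m -> 'rV[R]_n) g : open U ->
  (forall j, Ck k U (fun x => h x 0 j)) -> (forall x, U x -> O (h x)) ->
  Ck k O g -> Ck k U (fun x => g (h x)).
Proof.
move=> oU + UO; elim: k g => [|k IH] g Ch Cg.
  move=> x Ux; apply: (continuous_comp (f := h)); last exact/Cg/UO.
  by apply: continuous_rV => j; exact: Ch.
have dh x : U x -> differentiable h x.
  by move=> Ux; apply: differentiable_rV => j; have [+ _] := Ch j; apply.
have [dg Dg] := Cg.
split=> [x Ux|v]; first by apply: differentiable_comp; [exact: dh|exact/dg/UO].
have CS : Ck k U (fun x => \sum_j ('D_v (fun y => h y 0 j) x *
                                    'D_(delta_mx 0 j) g (h x))).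
  apply: Ck_sum => // j; apply: CkM => //; first by have [_] := Ch j; apply.
  exact: (IH ('D_(delta_mx 0 j) g) (fun i => CkW (Ch i)) (Dg _)).
apply: Ck_ext CS => // x Ux; have dgx := dg _ (UO _ Ux); have dhx := dh _ Ux.
rewrite -[RHS]/('D_v (g \o h) x) (deriveE _ (differentiable_comp dhx dgx)).
rewrite diff_comp //= -(deriveE v dhx) derive_mx; last exact: diff_derivable.
rewrite [in RHS](row_sum_delta (\matrix_(_, _) _)) linear_sum.
by apply: eq_bigr => j _; rewrite linearZ /= -deriveE // mxE.
Qed.

End Calculus.

Section Manifolds.
Context (R : realType).

Record chart (T : Type) := Chart {
  cdim : nat;
  cdom : set T;
  cmap : T -> 'rV[R]_cdim }.

(* A set with an atlas; its topology [mopen] is the one induced by the charts. *)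
Record mdata := MData { mpt :> Type; atlas : set (chart mpt) }.

Definition mopen (M : mdata) (W : set M) : Prop :=
  forall c, atlas c -> open (cmap c @` (cdom c `&` W)).

Definition smooth_fun (M : mdata) (U : set M) (g : M -> R) : Prop :=
  forall x c, U x -> atlas c -> cdom c x ->
  exists O G, [/\ open O, O (cmap c x), Cinf O G &
    forall y, cdom c y -> O (cmap c y) -> g y = G (cmap c y)].

Definition smooth_map (M N : mdata) (U : set M) (f : M -> N) : Prop :=
  forall x c, U x -> atlas c -> cdom c (f x) ->
  exists V, [/\ mopen V, V x, (forall y, V y -> cdom c (f y)) &
    forall j, smooth_fun V (fun y => cmap c (f y) 0 j)].

Record is_manifold (M : mdata) : Prop := IsManifold {
  mfd_dim : exists n, forall c x, @atlas M c -> cdom c x -> cdim c = n;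
  mfd_cover : forall x : M, exists2 c, atlas c & cdom c x;
  mfd_inj : forall c (x y : M), atlas c -> cdom c x -> cdom c y ->
    cmap c x = cmap c y -> x = y;
  (* for c = c' this includes that charts have open images *)
  mfd_trans : forall c c', @atlas M c -> atlas c' ->
    open (cmap c @` (cdom c `&` cdom c')) /\
    forall j, exists2 G, Cinf (cmap c @` (cdom c `&` cdom c')) G &
      forall x, cdom c x -> cdom c' x -> cmap c' x 0 j = G (cmap c x);
  mfd_hausdorff : forall x y : M, x <> y -> exists U V : set M,
    [/\ mopen U, mopen V, U x, V y & U `&` V = set0];
  mfd_countable : exists B : nat -> set M, (forall k, mopen (B k)) /\
    forall W x, mopen W -> W x -> exists k, B k x /\ B k `<=` W }.

Section Theory.
Implicit Types M N P : mdata.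

Lemma mopenT M : is_manifold M -> mopen [set: M].
Proof.
move=> mM c ac; have [+ _] := mfd_trans mM ac ac.
by rewrite setIid setIT.
Qed.

Lemma mopen_cdom M c : is_manifold M -> atlas c -> @mopen M (cdom c).
Proof. by move=> mM ac c' ac'; have [] := mfd_trans mM ac' ac. Qed.

Lemma mopenI M U V : is_manifold M -> @mopen M U -> mopen V -> mopen (U `&` V).
Proof.
move=> mM oU oV c ac.
rewrite (_ : _ @` _ = (cmap c @` (cdom c `&` U)) `&` (cmap c @` (cdom c `&` V))).
  by apply: openI; [exact: oU|exact: oV].
apply/seteqP; split=> [_ [x [cx [Ux Vx]] <-]|z]; first by split; exists x.
move=> -[[x [cx Ux] <-] [y [cy Vy] xy]].
have e := mfd_inj mM ac cy cx xy; by subst y; exists x.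
Qed.

Lemma smooth_fun_sub M (U V : set M) g :
  V `<=` U -> smooth_fun U g -> smooth_fun V g.
Proof. by move=> VU sg x c /VU; exact: sg. Qed.

Lemma smooth_fun_cst M (U : set M) k : smooth_fun U (fun=> k).
Proof.
move=> x c Ux ac cx; exists setT, (fun=> k); split=> //; first exact: openT.
by move=> i; exact: Ck_cst.
Qed.

Lemma smooth_funD M (U : set M) f g :
  smooth_fun U f -> smooth_fun U g -> smooth_fun U (fun x => f x + g x).
Proof.
move=> sf sg x c Ux ac cx.
have [ O1 [F [oO1 O1x CF FE]]] := sf _ _ Ux ac cx.
have [ O2 [G [oO2 O2x CG GE]]] := sg _ _ Ux ac cx.
have oO : open (O1 `&` O2) by exact: openI.
exists (O1 `&` O2), (fun z => F z + G z); split=> //.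
  by move=> k; apply: CkD => //; [apply: Ck_sub (CF k)|apply: Ck_sub (CG k)] => z [].
by move=> y cy [ O1y O2y]; rewrite FE // GE.
Qed.

Lemma smooth_funM M (U : set M) f g :
  smooth_fun U f -> smooth_fun U g -> smooth_fun U (fun x => f x * g x).
Proof.
move=> sf sg x c Ux ac cx.
have [ O1 [F [oO1 O1x CF FE]]] := sf _ _ Ux ac cx.
have [ O2 [G [oO2 O2x CG GE]]] := sg _ _ Ux ac cx.
have oO : open (O1 `&` O2) by exact: openI.
exists (O1 `&` O2), (fun z => F z * G z); split=> //.
  by move=> k; apply: CkM => //; [apply: Ck_sub (CF k)|apply: Ck_sub (CG k)] => z [].
by move=> y cy [ O1y O2y]; rewrite FE // GE.
Qed.

Lemma smooth_fun_sum M (U : set M) p (f : 'I_p -> M -> R) :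
  (forall i, smooth_fun U (f i)) -> smooth_fun U (fun x => \sum_i f i x).
Proof.
elim: p f => [|p IH] f sf.
  rewrite (_ : (fun _ => _) = fun=> 0); first exact: smooth_fun_cst.
  by apply/funext => x; rewrite big_ord0.
rewrite (_ : (fun _ => _) = fun x => f ord0 x + \sum_i f (lift ord0 i) x).
  by apply: smooth_funD => //; apply: IH.
by apply/funext => x; rewrite big_ord_recl.
Qed.

Lemma smooth_map_rep M N (U : set M) (f : M -> N) x c c' :
  is_manifold M -> smooth_map U f -> mopen U -> U x ->
  atlas c -> cdom c x -> atlas c' -> cdom c' (f x) ->
  exists O (H : 'rV_(cdim c) -> 'rV_(cdim c')), [/\ open O, O (cmap c x),
    (forall j, Cinf O (fun z => H z 0 j)),
    (forall z, O z -> exists2 y, cdom c y /\ U y & cmap c y = z) &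
    forall y, cdom c y -> O (cmap c y) ->
      [/\ U y, cdom c' (f y) & cmap c' (f y) = H (cmap c y)]].
Proof.
move=> mM sf oU Ux ac cx ac' cfx.
have [V [oV Vx Vc' sV]] := sf _ _ Ux ac' cfx.
have /choice[ OG OGP] j : exists OG : set 'rV_(cdim c) * ('rV_(cdim c) -> R),
    [/\ open OG.1, OG.1 (cmap c x), Cinf OG.1 OG.2 &
    forall y, cdom c y -> OG.1 (cmap c y) -> cmap c' (f y) 0 j = OG.2 (cmap c y)].
  by have [ O [G HG]] := sV j _ _ Vx ac cx; exists (O, G).
pose O0 : set 'rV[R]_(cdim c) := cmap c @` (cdom c `&` (V `&` U)).
pose O1 : set 'rV[R]_(cdim c) := [set z | forall j, (OG j).1 z].
have oO0 : open O0 by apply: (mopenI mM oV oU).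
have oO1 : open O1.
  rewrite openE => z O1z.
  apply: (@filter_forall _ _ (fun j => (OG j).1) (nbhs z)) => j.
  apply: open_nbhs_nbhs.
  by split; [have [] := OGP j|exact: O1z].
exists (O0 `&` O1), (fun z => \row_j (OG j).2 z); split.
- exact: openI.
- by split; [exists x|move=> j; have [] := OGP j].
- move=> j k; apply: (@Ck_ext _ _ _ _ (OG j).2); first exact: openI.
    by move=> z _; rewrite mxE.
  have [_ _ + _] := OGP j => /(_ k); apply: Ck_sub => z [_]; exact.
- by move=> z [[y [cy [_ Uy]] <-] _]; exists y.
- move=> y cy [[y' [cy' [Vy' Uy']]] e Oy].
  have ee := mfd_inj mM ac cy' cy e; subst y'.
  split=> //; first exact: Vc'.
  by apply/rowP => j; rewrite mxE; have [_ _ _] := OGP j; apply=> //; exact: Oy.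
Qed.

Lemma mopen_preimage M N (U : set M) (f : M -> N) W :
  is_manifold M -> is_manifold N -> smooth_map U f -> mopen U -> mopen W ->
  mopen (U `&` f @^-1` W).
Proof.
move=> mM mN sf oU oW c ac; rewrite openE => _ [x [cx [Ux Wx]] <-].
have [c' ac' c'x] := mfd_cover mN (f x).
have [ O [H [oO Ox CH Oim OE]]] := smooth_map_rep mM sf oU Ux ac cx ac' c'x.
pose O' : set 'rV[R]_(cdim c') := cmap c' @` (cdom c' `&` W).
have oO' : open O' by exact: oW.
have cH : {for cmap c x, continuous H}.
  by apply: continuous_rV => j; exact: (CH j 0).
have [_ _ Hx] := OE x cx Ox.
have nO' : nbhs (H (cmap c x)) O'.
  by apply: open_nbhs_nbhs; split=> //; rewrite -Hx; exists (f x).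
have nO : nbhs (cmap c x) O by apply: open_nbhs_nbhs; split.
rewrite /interior; near=> z.
have Oz : O z by near: z.
have [y [cy Uy] yz] := Oim z Oz.
exists y => //; split=> //; split=> //.
have Oy : O (cmap c y) by rewrite yz.
have [_ c'y e'] := OE y cy Oy.
have : O' (H z) by near: z; exact: cH.
rewrite -yz -e'.
by case=> w [c'w Ww] e; rewrite /preimage /= -(mfd_inj mN ac' c'w c'y e).
Unshelve. all: by end_near. Qed.

Lemma smooth_fun_comp M N (U : set M) (f : M -> N) W g :
  is_manifold M -> is_manifold N -> smooth_map U f -> mopen U ->
  smooth_fun W g -> smooth_fun (U `&` f @^-1` W) (g \o f).
Proof.
move=> mM mN sf oU sg x c [Ux Wx] ac cx.
have [c' ac' c'x] := mfd_cover mN (f x).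
have [ O [H [oO Ox CH Oim OE]]] := smooth_map_rep mM sf oU Ux ac cx ac' c'x.
have [ O' [G [oO' O'x CG GE]]] := sg _ _ Wx ac' c'x.
have oOH : open (O `&` H @^-1` O').
  rewrite openE => z [ Oz Hz]; rewrite /interior.
  have cH : {for z, continuous H} by apply: continuous_rV => j; exact: (CH j 0).
  apply: filterI; first exact: open_nbhs_nbhs.
  by apply: cH; exact: open_nbhs_nbhs.
exists (O `&` H @^-1` O'), (G \o H); split=> //.
- by split=> //=; have [_ _ <-] := OE x cx Ox.
- move=> k; apply: (@Ck_comp _ _ _ _ _ O') => //.
    by move=> j; apply: Ck_sub (CH j k) => z [].
  by move=> z [].
- by move=> y cy [ Oy O'y] /=; have [_ c'y e] := OE y cy Oy; rewrite -e; apply: GE; rewrite // e.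
Qed.

Lemma smooth_map_comp M N P (U : set M) (W : set N) (f : M -> N) (g : N -> P) :
  is_manifold M -> is_manifold N -> mopen U -> smooth_map U f ->
  smooth_map W g -> smooth_map (U `&` f @^-1` W) (g \o f).
Proof.
move=> mM mN oU sf sg x c [Ux Wx] ac cx.
have [V [oV Vx Vc sV]] := sg _ _ Wx ac cx.
exists (U `&` f @^-1` V); split=> //; first exact: mopen_preimage.
  by move=> y [_ /Vc].
by move=> j; exact: (smooth_fun_comp mM mN sf oU (sV j)).
Qed.

Lemma smooth_map_id M : is_manifold M -> smooth_map [set: M] id.
Proof.
move=> mM x c _ ac cx; exists (cdom c); split=> //; first exact: mopen_cdom.
move=> j y c' cy ac' c'y; have [oO /(_ j)[G CG GE]] := mfd_trans mM ac' ac.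
exists (cmap c' @` (cdom c' `&` cdom c)), G; split=> //; first by exists y.
move=> z c'z [w [c'w cw] e].
by have ww := mfd_inj mM ac' c'w c'z e; subst w; exact: GE.
Qed.

End Theory.
End Manifolds.

Section Submanifolds.
Context (R : realType).
Implicit Types M N : mdata R.

(* The standard notion of a smooth function on a subset [S] of a manifold:
   locally the restriction of a smooth function of the ambient manifold. *)
Definition smooth_subfun M (S : set M) (D : set {x | S x})
    (g : {x | S x} -> R) : Prop :=
  forall s, D s -> exists V (h : M -> R), [/\ mopen V, V (sval s),
    smooth_fun V h & forall s', V (sval s') -> g s' = h (sval s')].

(* [S] as an embedded submanifold of [M]: the charts are all the
   diffeomorphisms from relatively open subsets of [S] onto open subsets of
   some R^n. *)
Definition submfd M (S : set M) : mdata R := @MData R {x | S x} [set c |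
  [/\ exists2 V, mopen V & cdom c = [set s | V (sval s)],
      open (cmap c @` cdom c),
      forall s s', cdom c s -> cdom c s' -> cmap c s = cmap c s' -> s = s',
      forall j, smooth_subfun (cdom c) (fun s => cmap c s 0 j) &
      @smooth_map R (MData [set c]) M (cdom c) sval]].

Definition realm : mdata R := @MData R R
  [set @Chart R R 1 setT (fun x => const_mx x)].

Definition euclid n : mdata R := @MData R 'rV[R]_n
  [set @Chart R 'rV[R]_n n setT id].

Definition prodm M N : mdata R := @MData R (M * N)%type [set c |
  exists c1 c2, [/\ atlas c1, atlas c2 &
    c = Chart (cdom c1 `*` cdom c2)
          (fun p => row_mx (cmap c1 p.1) (cmap c2 p.2))]].

Lemma smooth_subfun_cst M (S : set M) D k :
  is_manifold M -> @smooth_subfun M S D (fun=> k).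
Proof.
move=> mM s _; exists setT, (fun=> k); split=> //; first exact: mopenT.
exact: smooth_fun_cst.
Qed.

Lemma smooth_subfunD M (S : set M) D f g : is_manifold M ->
  @smooth_subfun M S D f -> smooth_subfun D g ->
  smooth_subfun D (fun x => f x + g x).
Proof.
move=> mM sf sg s Ds; have [V [f' [oV Vs sf' fE]]] := sf _ Ds.
have [W [g' [oW Ws sg' gE]]] := sg _ Ds.
exists (V `&` W), (fun x => f' x + g' x); split=> //; first exact: mopenI.
  by apply: smooth_funD; [apply: smooth_fun_sub sf'|apply: smooth_fun_sub sg'] => x [].
by move=> s' [Vs' Ws']; rewrite fE // gE.
Qed.

Lemma smooth_subfunM M (S : set M) D f g : is_manifold M ->
  @smooth_subfun M S D f -> smooth_subfun D g ->
  smooth_subfun D (fun x => f x * g x).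
Proof.
move=> mM sf sg s Ds; have [V [f' [oV Vs sf' fE]]] := sf _ Ds.
have [W [g' [oW Ws sg' gE]]] := sg _ Ds.
exists (V `&` W), (fun x => f' x * g' x); split=> //; first exact: mopenI.
  by apply: smooth_funM; [apply: smooth_fun_sub sf'|apply: smooth_fun_sub sg'] => x [].
by move=> s' [Vs' Ws']; rewrite fE // gE.
Qed.

Lemma smooth_subfun_sum M (S : set M) D p (f : 'I_p -> {x | S x} -> R) :
  is_manifold M -> (forall i, smooth_subfun D (f i)) ->
  smooth_subfun D (fun x => \sum_i f i x).
Proof.
move=> mM; elim: p f => [|p IH] f sf.
  rewrite (_ : (fun _ => _) = fun=> 0); first exact: smooth_subfun_cst.
  by apply/funext => x; rewrite big_ord0.
rewrite (_ : (fun _ => _) = fun x => f ord0 x + \sum_i f (lift ord0 i) x).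
  by apply: smooth_subfunD => //; apply: IH.
by apply/funext => x; rewrite big_ord_recl.
Qed.

Lemma smooth_subfun_comp M N (S : set M) (S' : set N) (f : M -> N)
    (fS : {x | S x} -> {x | S' x}) g :
  is_manifold M -> is_manifold N -> smooth_map [set: M] f ->
  (forall s, sval (fS s) = f (sval s)) ->
  smooth_subfun [set: {x | S' x}] g ->
  smooth_subfun [set: {x | S x}] (g \o fS).
Proof.
move=> mM mN sf fSE sg s _; have [V [h [oV Vs sh gE]]] := sg (fS s) I.
exists ([set: M] `&` f @^-1` V), (h \o f); split.
- by apply: mopen_preimage => //; exact: mopenT.
- by split=> //; rewrite /preimage /= -fSE.
- by apply: smooth_fun_comp => //; exact: mopenT.
- by move=> s' [_]; rewrite /preimage /= -fSE => /gE ->.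
Qed.

End Submanifolds.

Section GradedBundles.
Context (R : realType).

(* R^d, d = [:: d_1; ..; d_r], is 'rV_(d_1 + .. + d_r); [wt d k] is the weight
   of the k-th coordinate, i.e. the i such that k lies in the i-th block. *)
Definition wt (d : seq nat) (k : 'I_(sumn d)) : nat := (reshape_index d k).+1.

Definition wscale (d : seq nat) (t : R) (y : 'rV[R]_(sumn d)) : 'rV[R]_(sumn d) :=
  \row_k (t ^+ wt k * y 0 k).

Record gbdata := GBData {
  gtot :> mdata R;
  gact : R -> gtot -> gtot }.

Definition gbase (F : gbdata) : mdata R := submfd (range (@gact F 0)).

Definition gproj (F : gbdata) (y : F) : gbase F :=
  exist _ (gact 0 y) (imageT (gact 0) y).

Definition gfib (F : gbdata) (x : gbase F) := {y : F | gact 0 y = sval x}.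

Definition trivgb (F : gbdata) (d : seq nat) : mdata R :=
  prodm (gbase F) (euclid R (sumn d)).

Record is_gb (F : gbdata) : Prop := IsGB {
  gb_mfd : is_manifold F;
  gb_smooth : smooth_map [set: prodm (realm R) F]
    ((fun p => gact p.1 p.2) : prodm (realm R) F -> F);
  gb_act : forall t s (y : F), gact t (gact s y) = gact (t * s) y;
  gb_act1 : forall y : F, gact 1 y = y;
  (* automatic for a smooth action, by a theorem of Grabowski and Rotkiewicz;
     here [gbase F] is h_0(F) as an embedded submanifold of F *)
  gb_base : is_manifold (gbase F);
  gb_triv : exists d : seq nat, forall x : gbase F,
    exists U (phi : F -> trivgb F d) (psi : trivgb F d -> F),
    [/\ mopen U, U x,
        smooth_map [set y | U (gproj y)] phi,
        smooth_map [set p : trivgb F d | U p.1] psi &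
        [/\ forall y, U (gproj y) -> psi (phi y) = y,
            forall p : trivgb F d, U p.1 -> phi (psi p) = p,
            forall y, U (gproj y) -> (phi y).1 = gproj y,
            forall p : trivgb F d, U p.1 -> gproj (psi p) = p.1 &
            forall t y, U (gproj y) ->
              (phi (gact t y)).2 = wscale t (phi y).2]] }.

Definition is_gbhom (F E : gbdata) (f : F -> E) : Prop :=
  smooth_map [set: F] f /\ forall t y, f (gact t y) = gact t (f y).

Lemma is_gbhom_id (F : gbdata) : is_gb F -> is_gbhom (@id F).
Proof. by move=> /gb_mfd ?; split=> //; exact: smooth_map_id. Qed.

Lemma is_gbhom_comp (F E D : gbdata) (f : F -> E) (g : E -> D) : is_gb F -> is_gb E ->
  is_gbhom f -> is_gbhom g -> is_gbhom (g \o f).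
Proof.
move=> gF gE [sf fh] [sg gh]; split=> [|t y /=]; last by rewrite fh gh.
have := smooth_map_comp (gb_mfd gF) (gb_mfd gE) (mopenT (gb_mfd gF)) sf sg.
by rewrite preimage_setT setIT.
Qed.

Lemma gbase_map_subproof (F E : gbdata) (f : F -> E) (x : gbase F) :
  is_gbhom f -> range (@gact E 0) (f (sval x)).
Proof. by move=> [_ fh]; case: (svalP x) => y _ <-; exists (f y). Qed.

Definition gbase_map (F E : gbdata) (f : F -> E) (fh : is_gbhom f) (x : gbase F) : gbase E :=
  exist _ (f (sval x)) (gbase_map_subproof x fh).

End GradedBundles.

Section Subspaces.
Context (R : realType).

Record subspace (V : lmodType R) := Subspace {
  sp_in : V -> Prop;
  sp_in0 : sp_in 0;
  sp_inP : forall a u v, sp_in u -> sp_in v -> sp_in (a *: u + v) }.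

Definition sp_pred V (P : subspace V) : {pred V} := fun v => `[< sp_in P v >].

Lemma sp_pred_closed V (P : subspace V) : submod_closed (sp_pred P).
Proof.
split=> [|a u v /asboolP Pu /asboolP Pv]; apply/asboolP; first exact: sp_in0.
exact: sp_inP.
Qed.

HB.instance Definition _ V (P : subspace V) :=
  GRing.isSubmodClosed.Build R V (sp_pred P) (sp_pred_closed P).

Record sub_lmod V (P : subspace V) :=
  SubLmod { sub_val :> V; _ : sub_val \in sp_pred P }.

HB.instance Definition _ V (P : subspace V) := [isSub for @sub_val V P].
HB.instance Definition _ V (P : subspace V) := [Choice of sub_lmod P by <:].
HB.instance Definition _ V (P : subspace V) :=
  [SubChoice_isSubLmodule of sub_lmod P by <:].

Lemma sub_valP V (P : subspace V) (u : sub_lmod P) : sp_in P (sub_val u).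
Proof. by case: u => u /= /asboolP. Qed.

Definition mksub V (P : subspace V) v (Pv : sp_in P v) : sub_lmod P :=
  SubLmod (introT (asboolP _) Pv).

Lemma dual_sp0 (V : lmodType R) : linear (0 : V -> R^o).
Proof. by move=> a u v; rewrite scaler0 addr0. Qed.

Lemma dual_spP (V : lmodType R) a (f g : V -> R^o) :
  linear f -> linear g -> linear (a *: f + g).
Proof.
move=> lf lg b u v; rewrite !fctE lf lg !scalerDr !scalerA (mulrC a) !addrA.
by congr (_ + _); rewrite -!addrA; congr (_ + _); rewrite addrC.
Qed.

Definition dual_sp (V : lmodType R) : subspace (V -> R^o) :=
  Subspace (@dual_sp0 V) (@dual_spP V).

Definition dual (V : lmodType R) : lmodType R := sub_lmod (dual_sp V).

Definition dapp V (xi : dual V) (v : V) : R := sub_val xi v.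

End Subspaces.

Section GradedAlgebra.
Context (R : realType).

Definition bilin (V W : lmodType R) (b : V -> W -> R) : Prop :=
  (forall v, linear (b v : W -> R^o)) /\ (forall w, linear (b^~ w : V -> R^o)).

Definition teval (V W : lmodType R) (s : seq (V * W)) (b : V -> W -> R) : R :=
  if `[< bilin b >] then \sum_(p <- s) b p.1 p.2 else 0.

(* The tensor product of V and W: formal sums of pairs (v, w), two such sums
   being identified when all bilinear forms agree on them; the element given
   by [s] is represented by the evaluation [teval s] of bilinear forms. *)
Record tens (V W : lmodType R) := Tens {
  tapp :> (V -> W -> R) -> R;
  tensP : exists s, tapp = teval s }.

HB.instance Definition _ V W := gen_eqMixin (tens V W).
HB.instance Definition _ V W := gen_choiceMixin (tens V W).

Definition tens0 V W : tens V W := Tens (ex_intro _ [::] erefl).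

Record galg (A : nat -> lmodType R) := GAlg {
  gmul : forall i j, A i -> A j -> A (i + j)%N;
  gone : A 0%N }.

(* [gcomul i j] is the component C^(i+j) -> C^i (x) C^j; the counit vanishes
   in positive degrees. *)
Record gcoalg (C : nat -> lmodType R) := GCoalg {
  gcomul : forall i j, C (i + j)%N -> tens (C i) (C j);
  gcounit : C 0%N -> R }.

(* The second clause is (f (x) f) (Delta x) = Delta (f x), tested on bilinear
   forms. *)
Definition is_gcoalg_hom (C D : nat -> lmodType R) (c : gcoalg C) (d : gcoalg D)
    (f : forall i, C i -> D i) : Prop :=
  [/\ forall i, linear (f i),
      forall i j x b, bilin b ->
        gcomul c x (fun u v => b (f i u) (f j v)) = gcomul d (f (i + j)%N x) b &
      forall x, gcounit d (f 0%N x) = gcounit c x].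

(* The comultiplication of the graded dual of A maps xi to xi \o mul, seen as
   an element of (A^i)^* (x) (A^j)^* = (A^i (x) A^j)^*, i.e. to the tensor
   whose pairing with (a, b) is xi (a b); it exists and is unique as soon as
   the A^i are finite-dimensional. *)
Definition dual_coalg (A : nat -> lmodType R) (a : galg A) :
    gcoalg (fun i => dual (A i)) :=
  GCoalg
    (fun i j xi => xget (tens0 _ _) [set T : tens (dual (A i)) (dual (A j)) |
       forall u v, T (fun p q => dapp p u * dapp q v) = dapp xi (gmul a u v)])
    (fun xi => dapp xi (gone a)).

End GradedAlgebra.

Section Polynomials.
Context (R : realType) (d : seq nat).

Definition wmdeg (m : multinom (sumn d)) : nat := (\sum_k m k * wt k)%N.

Lemma wmdeg0 : wmdeg mnm0 = 0%N.
Proof. by rewrite /wmdeg big1 // => k _; rewrite mnm0E. Qed.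

Lemma wmdegD : {morph wmdeg : m1 m2 / mnm_add m1 m2 >-> (m1 + m2)%N}.
Proof.
move=> m1 m2; rewrite /wmdeg -big_split /=.
by apply: eq_bigr => k _; rewrite mnmDE mulnDl.
Qed.

HB.instance Definition _ := isMeasure.Build (sumn d) wmdeg wmdeg0 wmdegD.

Definition is_whomog i (p : mpoly (sumn d) R) : Prop := p \is ishomog1 i wmdeg.

Lemma whomog0 i : is_whomog i 0.
Proof. exact: dhomog0. Qed.

Lemma whomogP i a p q :
  is_whomog i p -> is_whomog i q -> is_whomog i (a *: p + q).
Proof. by move=> hp hq; apply: dhomogD => //; exact: dhomogZ. Qed.

Definition poly_sp (i : nat) : subspace (mpoly (sumn d) R) :=
  Subspace (whomog0 i) (@whomogP i).

Definition poly_gr (i : nat) : lmodType R := sub_lmod (poly_sp i).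

Lemma whomogM i j (p : poly_gr i) (q : poly_gr j) :
  is_whomog (i + j) (sub_val p * sub_val q).
Proof. exact: dhomogM (sub_valP p) (sub_valP q). Qed.

Lemma whomog1 : is_whomog 0 1.
Proof. exact: dhomog1. Qed.

Definition poly_galg : galg poly_gr :=
  GAlg (fun i j p q => mksub (P := poly_sp (i + j)) (whomogM p q))
       (mksub (P := poly_sp 0) whomog1).

Definition poly_co (i : nat) : lmodType R := dual (poly_gr i).

Definition poly_coalg : gcoalg poly_co := dual_coalg poly_galg.

End Polynomials.

Section Bundles.
Context (R : realType).

(* A local trivialization of a family of vector spaces: [tmap x] is relevant
   for x in [tdom] only. *)
Record vtriv (M : Type) (V : M -> lmodType R) := VTriv {
  tdom : set M;
  trk : nat;
  tmap : forall x, 'rV[R]_trk -> V x }.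
Arguments tmap {M V} _ x _.

(* Smoothness of the maps [f x], x in D, covering [b], with respect to given
   local trivializations: the matrices representing [f] are smooth in [x]. *)
Definition smooth_vmor (M N : mdata R) (D : set M) (b : M -> N)
    (V : M -> lmodType R) (W : N -> lmodType R)
    (A : set (vtriv V)) (B : set (vtriv W))
    (f : forall x, V x -> W (b x)) : Prop :=
  forall phi psi x0, A phi -> B psi ->
    D x0 -> tdom phi x0 -> tdom psi (b x0) ->
  exists U (a : M -> 'M[R]_(trk phi, trk psi)),
    [/\ mopen U, U x0, forall k l, smooth_fun U (fun x => a x k l) &
      forall x, U x -> D x -> tdom phi x -> tdom psi (b x) ->
        forall v, f x (tmap phi x v) = tmap psi (b x) (v *m a x)].

Record gvbundle := GVBundle {
  vbase : mdata R;
  vfib : vbase -> nat -> lmodType R;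
  vtrivs : forall i, set (vtriv (fun x => vfib x i)) }.

Record is_gvb (E : gvbundle) : Prop := IsGVB {
  gvb_base : is_manifold (vbase E);
  gvb_open : forall i phi, @vtrivs E i phi -> mopen (tdom phi);
  gvb_lin : forall i phi x, @vtrivs E i phi -> tdom phi x ->
    linear (tmap phi x) /\ bijective (tmap phi x);
  gvb_cover : forall i (x : vbase E), exists2 phi, @vtrivs E i phi & tdom phi x;
  gvb_trans : forall i, smooth_vmor [set: vbase E] (b := id)
    (@vtrivs E i) (@vtrivs E i) (fun x v => v) }.

(* The local trivializations of the dual bundle are the contragredients
   x |-> (tmap phi x)^-T of those of E. *)
Definition dual_bundle (E : gvbundle) : gvbundle :=
  @GVBundle (vbase E) (fun x i => dual (vfib x i)) (fun i => [set chi |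
    exists2 phi, @vtrivs E i phi &
    exists2 g : forall x, 'rV[R]_(trk phi) -> dual (vfib x i),
      chi = VTriv (tdom phi) g &
      forall x v w, tdom phi x -> dapp (g x v) (tmap phi x w) = \sum_k v 0 k * w 0 k]).

Definition triv_bundle (M : mdata R) (C : nat -> lmodType R) : gvbundle :=
  @GVBundle M (fun=> C) (fun i => [set phi |
    exists n (e : 'rV[R]_n -> C i),
      [/\ linear e, bijective e & phi = VTriv setT (fun=> e)]]).

Record gcbundle := GCBundle {
  gcb_vb :> gvbundle;
  gcb_coalg : forall x, gcoalg (@vfib gcb_vb x) }.

Definition is_gpcb (E : gcbundle) : Prop := is_gvb E /\
  exists d : seq nat, forall x0 : vbase E,
  exists (U : set (vbase E)) (tau : forall x i, poly_co R d i -> vfib x i)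
         (sigma : forall x i, vfib x i -> poly_co R d i),
  [/\ mopen U, U x0,
      forall x, U x ->
        [/\ is_gcoalg_hom (poly_coalg R d) (gcb_coalg x) (tau x),
            is_gcoalg_hom (gcb_coalg x) (poly_coalg R d) (sigma x),
            forall i, cancel (tau x i) (sigma x i) &
            forall i, cancel (sigma x i) (tau x i)],
      forall i, smooth_vmor U (b := id)
        (@vtrivs (triv_bundle (vbase E) (poly_co R d)) i) (@vtrivs E i)
        (fun x => tau x i) &
      forall i, smooth_vmor U (b := id)
        (@vtrivs E i) (@vtrivs (triv_bundle (vbase E) (poly_co R d)) i)
        (fun x => sigma x i)].

Record gcmor (E E' : gcbundle) := GCMor {
  mbase : vbase E -> vbase E';
  mfib : forall x i, vfib x i -> vfib (mbase x) i }.

Definition is_gpcb_mor (E E' : gcbundle) (f : gcmor E E') : Prop :=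
  [/\ smooth_map [set: vbase E] (mbase f),
      forall x, is_gcoalg_hom (gcb_coalg x) (gcb_coalg (mbase f x)) (@mfib _ _ f x) &
      forall i, smooth_vmor [set: vbase E] (@vtrivs E i) (@vtrivs E' i)
        (fun x => @mfib _ _ f x i)].

Definition gcmor_id E : gcmor E E := @GCMor E E id (fun x i v => v).

Definition gcmor_comp E E' E'' (g : gcmor E' E'') (f : gcmor E E') : gcmor E E'' :=
  @GCMor E E'' (mbase g \o mbase f) (fun x i v => mfib g (mfib f v)).

Lemma is_gpcb_mor_id E : is_gpcb E -> is_gpcb_mor (gcmor_id E).
Proof.
move=> [[bE _ _ _ tE] _]; split=> //; exact: smooth_map_id.
Qed.

Lemma is_gpcb_mor_comp E E' E'' (g : gcmor E' E'') (f : gcmor E E') :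
  is_gpcb E -> is_gpcb E' -> is_gpcb_mor f -> is_gpcb_mor g ->
  is_gpcb_mor (gcmor_comp g f).
Proof.
move=> [[bE _ _ _ _] _] [[bE' oE' lE' cE' _] _] [sf hf vf] [sg hg vg].
have oT := mopenT bE.
split=> /=.
- have := smooth_map_comp bE bE' oT sf sg.
  by rewrite preimage_setT setIT.
- move=> x; have [lf cf ef] := hf x; have [lg cg eg] := hg (mbase f x); split.
  + by move=> i a u v; rewrite lf lg.
  + move=> i j y b bb; rewrite -cg // -cf //.
    have [b1 b2] := bb.
    split=> [v|w] a u u' /=; first by rewrite lg b1.
    by rewrite lg; exact: (b2 _ a).
  + by move=> y; rewrite eg ef.
- move=> i phi chi x0 Aphi Achi _ phix0 chix0.
  have [psi Apsi psix0] := cE' i (mbase f x0).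
  have [U1 [a1 [oU1 U1x sa1 E1]]] := vf i phi psi x0 Aphi Apsi I phix0 psix0.
  have [U2 [a2 [oU2 U2x sa2 E2]]] := vg i psi chi _ Apsi Achi I psix0 chix0.
  have oV : mopen (tdom psi `&` U2).
    by apply: mopenI => //; exact: oE' Apsi.
  exists (U1 `&` ([set: vbase E] `&` mbase f @^-1` (tdom psi `&` U2))),
    (fun x => a1 x *m a2 (mbase f x)); split.
  + by apply: mopenI => //; exact: mopen_preimage.
  + by split.
  + move=> k l; have -> : (fun x => (a1 x *m a2 (mbase f x)) k l) =
        (fun x => \sum_j (a1 x k j * a2 (mbase f x) j l)).
      by apply/funext => x; rewrite mxE.
    apply: smooth_fun_sum => j; apply: smooth_funM.
      by apply: smooth_fun_sub (sa1 k j) => x [].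
    have := smooth_fun_comp bE bE' sf oT (sa2 j l).
    by apply: smooth_fun_sub => x [_ [_ [_ ?]]]; split.
  + move=> x [U1x' [_ [psix U2x']]] _ phix chix v.
    by rewrite E1 // E2 // mulmxA.
Qed.

End Bundles.

Arguments tmap {R M V} _ x _.

Section Functor.
Context (R : realType).

Record gb := GB { gb_data :> gbdata R; gbP : is_gb gb_data }.

Record gpcb := GPCB { gpcb_data :> gcbundle R; gpcbP : is_gpcb gpcb_data }.

Definition gbhom (F E : gb) := {f : F -> E | is_gbhom f}.

Definition gpcbhom (E E' : gpcb) := {f : gcmor E E' | is_gpcb_mor f}.

Section Hom.
Context (F : gb) (x : gbase F).

(* Degree-i part of Hom_G(F_x, A), with A = R['X] and h_t(p) = p(t 'X) *)
Definition is_ghom (i : nat) (alpha : gfib x -> {poly R}) : Prop :=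
  [/\ forall k, smooth_subfun [set: gfib x] (fun y => (alpha y)`_k),
      forall t (y y' : gfib x), sval y' = gact t (sval y) ->
        alpha y' = alpha y \Po (t *: 'X) &
      forall y, exists c, alpha y = c *: 'X^i].

Lemma ghom0 i : is_ghom i 0.
Proof.
split=> [k|t y y' _|y]; last by exists 0; rewrite scale0r.
  rewrite (_ : (fun _ => _) = fun=> 0); last by apply/funext => y; rewrite coef0.
  exact: smooth_subfun_cst (gb_mfd (gbP F)).
by rewrite comp_poly0.
Qed.

Lemma ghomP i a alpha beta :
  is_ghom i alpha -> is_ghom i beta -> is_ghom i (a *: alpha + beta).
Proof.
have mF := gb_mfd (gbP F).
move=> [sa ea da] [sb eb db]; split=> [k|t y y' yy'|y].
- rewrite (_ : (fun _ => _) = fun y => a * (alpha y)`_k + (beta y)`_k).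
    apply: smooth_subfunD => //; apply: smooth_subfunM => //.
    exact: smooth_subfun_cst.
  by apply/funext => y; rewrite coefD coefZ.
- by rewrite !fctE (ea _ _ _ yy') (eb _ _ _ yy') comp_polyD comp_polyZ.
- have [c ac] := da y; have [e be] := db y; exists (a * c + e).
  by rewrite !fctE ac be scalerA scalerDl.
Qed.

Definition ghom_sp i : subspace (gfib x -> {poly R}) :=
  Subspace (ghom0 i) (@ghomP i).

Definition ghom i : lmodType R := sub_lmod (ghom_sp i).

Definition ghom_val i (alpha : ghom i) (y : gfib x) : {poly R} := sub_val alpha y.

Lemma ghomM i j (alpha : ghom i) (beta : ghom j) :
  is_ghom (i + j) (fun y => ghom_val alpha y * ghom_val beta y).
Proof.
have mF := gb_mfd (gbP F).
have [sa ea da] := sub_valP alpha; have [sb eb db] := sub_valP beta.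
split=> [k|t y y' yy'|y].
- rewrite (_ : (fun _ => _) = fun y => \sum_(l < k.+1)
      ((ghom_val alpha y)`_l * (ghom_val beta y)`_(k - l))).
    by apply: smooth_subfun_sum => // l; exact: smooth_subfunM.
  by apply/funext => y; rewrite coefM.
- by rewrite /ghom_val (ea _ _ _ yy') (eb _ _ _ yy') comp_polyM.
- rewrite /ghom_val; have [c ->] := da y; have [e ->] := db y; exists (c * e).
  by rewrite -scalerAl -scalerAr scalerA exprD.
Qed.

Lemma ghom1 : is_ghom 0 (fun=> 1).
Proof.
split=> [k|t y y' _|y]; last by exists 1; rewrite expr0 scale1r.
  exact: smooth_subfun_cst (gb_mfd (gbP F)).
by rewrite comp_polyC.
Qed.

Definition ghom_alg : galg ghom :=
  GAlg (fun i j alpha beta => mksub (P := ghom_sp (i + j)) (ghomM alpha beta))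
       (mksub (P := ghom_sp 0) ghom1).

End Hom.

(* F^*_G: a local trivialization is smooth when it takes constant sections to
   sections given by smooth functions on F. *)
Definition ghom_bundle (F : gb) : gvbundle R :=
  @GVBundle R (gbase F) (@ghom F) (fun i => [set phi : vtriv (@ghom F ^~ i) |
    [/\ mopen (tdom phi),
        forall x, tdom phi x -> linear (tmap phi x) /\ bijective (tmap phi x) &
        forall v, smooth_fun [set y : F | tdom phi (gproj y)] (fun y : F =>
          (ghom_val (tmap phi (gproj y) v) (exist _ y erefl))`_i)]]).

Definition circ_obj (F : gb) : gcbundle R :=
  @GCBundle R (dual_bundle (ghom_bundle F)) (fun x => dual_coalg (ghom_alg x)).

Section Mor.
Context (F E : gb) (f : F -> E) (fh : is_gbhom f).
(* [b] is the base map of [f], see [circ_mor] *)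
Context (b : gbase F -> gbase E) (bE : forall x, sval (b x) = f (sval x)).

Lemma gfib_map_subproof x (y : gfib x) : gact 0 (f (sval y)) = sval (b x).
Proof. by rewrite bE; case: y => y /= <-; rewrite fh.2. Qed.

Definition gfib_map x (y : gfib x) : gfib (b x) :=
  exist _ (f (sval y)) (gfib_map_subproof y).

Lemma ghom_pull_subproof x i (alpha : ghom (b x) i) :
  is_ghom i (fun y => ghom_val alpha (@gfib_map x y)).
Proof.
have [sa ea da] := sub_valP alpha; split=> [k|t y y' yy'|y]; last exact: da.
- exact: (smooth_subfun_comp (f := f) (fS := @gfib_map x)
    (gb_mfd (gbP F)) (gb_mfd (gbP E)) fh.1 _ (sa k)).
- by apply: ea; rewrite /= yy' fh.2.
Qed.

Definition ghom_pull x i (alpha : ghom (b x) i) : ghom x i :=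
  mksub (P := ghom_sp x i) (ghom_pull_subproof alpha).

Lemma ghom_push_subproof x i (xi : dual (ghom x i)) :
  linear ((fun alpha => dapp xi (ghom_pull alpha)) : ghom (b x) i -> R^o).
Proof.
move=> a u v; rewrite -(sub_valP xi a); congr (dapp xi _).
exact/val_inj/funext.
Qed.

Definition ghom_push x i (xi : dual (ghom x i)) : dual (ghom (b x) i) :=
  mksub (P := dual_sp _) (ghom_push_subproof xi).

Definition circ_mor_gen : gcmor (circ_obj F) (circ_obj E) :=
  @GCMor R (circ_obj F) (circ_obj E) b ghom_push.

End Mor.

Definition circ_mor (F E : gb) (f : gbhom F E) : gcmor (circ_obj F) (circ_obj E) :=
  circ_mor_gen (svalP f) (b := gbase_map (svalP f)) (fun=> erefl).

Lemma sval_inj T (P : T -> Prop) : injective (@proj1_sig T P).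
Proof. by move=> [u Pu] [v Pv] /= e; subst v; congr exist; exact: Prop_irrelevance. Qed.

Lemma circ_mor_gen_id (F : gb) (fh : is_gbhom (@id F)) b bE :
  b = id -> @circ_mor_gen F F id fh b bE = gcmor_id _.
Proof.
move=> e; subst b; rewrite /circ_mor_gen /gcmor_id; congr GCMor.
apply/functional_extensionality_dep => x.
apply/functional_extensionality_dep => i; apply/funext => xi.
apply/val_inj/funext => alpha; congr (dapp xi _).
by apply/val_inj/funext => y; congr (ghom_val alpha _); exact: sval_inj.
Qed.

Lemma circ_mor_gen_comp (F E D : gb) (f : F -> E) (g : E -> D) fh gh gfh
    b b' b'' bE bE' bE'' :
  b'' = b' \o b ->
  @circ_mor_gen F D (g \o f) gfh b'' bE'' =
  gcmor_comp (@circ_mor_gen E D g gh b' bE') (@circ_mor_gen F E f fh b bE).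
Proof.
move=> e; subst b''; rewrite /circ_mor_gen /gcmor_comp; congr GCMor.
apply/functional_extensionality_dep => x.
apply/functional_extensionality_dep => i; apply/funext => xi.
apply/val_inj/funext => alpha; congr (dapp xi _).
by apply/val_inj/funext => y; congr (ghom_val alpha _); exact: sval_inj.
Qed.

End Functor.

Section Categories.

Record category := Category {
  cob :> Type;
  chom : cob -> cob -> Type;
  cid : forall a, chom a a;
  ccomp : forall a b c, chom b c -> chom a b -> chom a c;
  ccompA : forall a b c d (h : chom c d) (g : chom b c) (f : chom a b),
    ccomp h (ccomp g f) = ccomp (ccomp h g) f;
  ccomp1m : forall a b (f : chom a b), ccomp (cid b) f = f;
  ccompm1 : forall a b (f : chom a b), ccomp f (cid a) = f }.

Record functor (C D : category) := Functor {
  fob :> C -> D;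
  fhom : forall a b, chom a b -> chom (fob a) (fob b);
  fhom_id : forall a, fhom (cid a) = cid (fob a);
  fhom_comp : forall a b c (g : chom b c) (f : chom a b),
    fhom (ccomp g f) = ccomp (fhom g) (fhom f) }.

Definition functor_id (C : category) : functor C C :=
  @Functor C C id (fun a b f => f) (fun=> erefl) (fun _ _ _ _ _ => erefl).

Lemma functor_comp_id C D E (G : functor D E) (F : functor C D) (a : C) :
  fhom G (fhom F (cid a)) = cid (G (F a)).
Proof. by rewrite !fhom_id. Qed.

Lemma functor_comp_comp C D E (G : functor D E) (F : functor C D) (a b c : C)
    (g : chom b c) (f : chom a b) :
  fhom G (fhom F (ccomp g f)) = ccomp (fhom G (fhom F g)) (fhom G (fhom F f)).
Proof. by rewrite !fhom_comp. Qed.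

Definition functor_comp C D E (G : functor D E) (F : functor C D) : functor C E :=
  @Functor C E (fun a => G (F a)) (fun a b f => fhom G (fhom F f))
    (functor_comp_id G F) (@functor_comp_comp _ _ _ G F).

Definition nat_iso C D (F G : functor C D) : Prop :=
  exists (eta : forall a, chom (F a) (G a)) (theta : forall a, chom (G a) (F a)),
  [/\ forall a b (f : chom a b), ccomp (eta b) (fhom F f) = ccomp (fhom G f) (eta a),
      forall a, ccomp (theta a) (eta a) = cid (F a) &
      forall a, ccomp (eta a) (theta a) = cid (G a)].

Definition is_equivalence C D (F : functor C D) : Prop :=
  exists G : functor D C, nat_iso (functor_comp G F) (functor_id C) /\
                          nat_iso (functor_comp F G) (functor_id D).

Context (R : realType).

Definition gb_id (F : gb R) : gbhom F F := exist _ id (is_gbhom_id (gbP F)).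

Definition gb_comp (F E D : gb R) (g : gbhom E D) (f : gbhom F E) : gbhom F D :=
  exist _ (sval g \o sval f)
    (is_gbhom_comp (gbP F) (gbP E) (svalP f) (svalP g)).

Definition gpcb_id (E : gpcb R) : gpcbhom E E :=
  exist _ (gcmor_id E) (is_gpcb_mor_id (gpcbP E)).

Definition gpcb_comp (E E' E'' : gpcb R) (g : gpcbhom E' E'') (f : gpcbhom E E') :
    gpcbhom E E'' :=
  exist _ (gcmor_comp (sval g) (sval f))
    (is_gpcb_mor_comp (gpcbP E) (gpcbP E') (svalP f) (svalP g)).

Lemma gb_compA (F E D C : gb R) (h : gbhom D C) (g : gbhom E D) (f : gbhom F E) :
  gb_comp h (gb_comp g f) = gb_comp (gb_comp h g) f.
Proof. exact: sval_inj. Qed.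

Lemma gb_comp1m (F E : gb R) (f : gbhom F E) : gb_comp (gb_id E) f = f.
Proof. exact: sval_inj. Qed.

Lemma gb_compm1 (F E : gb R) (f : gbhom F E) : gb_comp f (gb_id F) = f.
Proof. exact: sval_inj. Qed.

Definition GB_cat : category := Category gb_compA gb_comp1m gb_compm1.

Lemma gpcb_compA (E0 E1 E2 E3 : gpcb R)
    (h : gpcbhom E2 E3) (g : gpcbhom E1 E2) (f : gpcbhom E0 E1) :
  gpcb_comp h (gpcb_comp g f) = gpcb_comp (gpcb_comp h g) f.
Proof. exact: sval_inj. Qed.

Lemma gpcb_comp1m (E E' : gpcb R) (f : gpcbhom E E') : gpcb_comp (gpcb_id E') f = f.
Proof. by apply: sval_inj; case: f => [[b m] p]. Qed.

Lemma gpcb_compm1 (E E' : gpcb R) (f : gpcbhom E E') : gpcb_comp f (gpcb_id E) = f.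
Proof. by apply: sval_inj; case: f => [[b m] p]. Qed.

Definition GPCB_cat : category := Category gpcb_compA gpcb_comp1m gpcb_compm1.

Section CircFunctor.
(* [circ_obj] and [circ_mor] are defined outright; that they land in GPCB is
   part of the content of any statement about [circ_functor]. *)
Context (circ_ob : forall F : gb R, is_gpcb (circ_obj F)).
Context (circ_hom : forall (F E : gb R) (f : gbhom F E), is_gpcb_mor (circ_mor f)).

Definition circ_fob (F : GB_cat) : GPCB_cat := GPCB (circ_ob F).

Definition circ_fhom (F E : GB_cat) (f : chom F E) :
    chom (circ_fob F) (circ_fob E) := exist _ (circ_mor f) (circ_hom f).

Lemma circ_fhom_id (F : GB_cat) : circ_fhom (cid F) = cid (circ_fob F).
Proof.
by apply: sval_inj; apply: circ_mor_gen_id; apply/funext => x; exact: sval_inj.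
Qed.

Lemma circ_fhom_comp (F E D : GB_cat) (g : chom E D) (f : chom F E) :
  circ_fhom (ccomp g f) = ccomp (circ_fhom g) (circ_fhom f).
Proof.
by apply: sval_inj; apply: circ_mor_gen_comp; apply/funext => x; exact: sval_inj.
Qed.

Definition circ_functor : functor GB_cat GPCB_cat :=
  Functor circ_fhom_id circ_fhom_comp.

End CircFunctor.

End Categories.

(* Main.v *)
(** The functor is shown to be full, faithful and essentially surjective.

    A smooth function on R^d that is homogeneous of weight i is a polynomial: its
    partial derivatives are homogeneous of smaller weight (and vanish when this
    weight is negative), and Euler's identity recovers the function from them.  So
    in a local trivialization Hom_G(F_x, A) is the graded polynomial algebra, and
    circ F is locally trivial.  Finitely many evaluations at points of the fibre
    form a basis of the dual of each graded piece, which reduces the smoothness of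
    bundle maps to that of their values on point evaluations.

    The group-like families of a polynomial coalgebra are exactly the evaluations
    at points of R^d.  Coalgebra morphisms preserve group-likes, so a morphism
    circ F -> circ E determines a point map F -> E, and in coordinates this map is
    the polynomial map [Theta] read off from the generators.  Conversely, a
    coalgebra bundle E over M comes from M x R^d, glued along the polynomial maps
    induced by the transition functions of E. *)
From HB Require Import structures.
From mathcomp Require Import all_boot all_order all_algebra.
From mathcomp Require Import boolp classical_sets functions reals topology.
From mathcomp Require Import normedtype derive.
From mathcomp Require Import -(notations) mpoly.
Require Import Defs.
Set Implicit Arguments.
Unset Strict Implicit.
Unset Printing Implicit Defensive.
Import Order.TTheory GRing.Theory Num.Theory numFieldNormedType.Exports.
Local Open Scope classical_set_scope.
Local Open Scope ring_scope.

(** * Calculus *)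

Section CalculusTheory.
Context (R : realType).
Implicit Types (k n : nat).

(** Evaluation at a point of R^d may have nonzero components in infinitely many degrees, so it is
    not an element of the graded dual. Group-likes are therefore treated as families with one member
    per degree, on which degree-preserving maps still act. In degree i the evaluation at the
    rescaled point is t^i times the original evaluation, and linear maps commute with this factor.
    So the map of points induced by a coalgebra morphism is equivariant at once; what has to be
    worked for is its smoothness.

    Positivity of the weights carries the algebra. The action at t = 0 contracts R^d to the origin,
    which makes functions of weight 0 constant, and a polynomial of weight i has degree at most i,
    which makes the graded pieces finite-dimensional. Finite dimension in turn allows tensors over
    dual spaces to be tested on pairs of vectors, the only access to a comultiplication that is
    chosen by its pairings.

    On the geometric side, the fibres over two equal base points need not be convertible types, so
    fibre maps are often compared together with their base points. *)

Lemma Ck_local k n (U : set 'rV[R]_n) f :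
  (forall x, U x -> exists2 O, O x & Ck k O f) -> Ck k U f.
Proof.
elim: k f => [|k IH] f Uf /=; first by move=> x /Uf[ O Ox Cf]; exact: Cf.
split=> [x /Uf[ O Ox [df _]]|v]; first exact: (df _ Ox).
by apply: IH => x /Uf[ O Ox [_ Df]]; exists O => //; exact: Df.
Qed.

Lemma CkV k n (U : set 'rV[R]_n) (f : 'rV[R]_n -> R) : open U ->
  (forall x, U x -> f x != 0) -> Ck k U f -> Ck k U (fun x => (f x)^-1).
Proof.
move=> oU f0; elim: k => [|k IH] Cf /=.
  by move=> x Ux; apply: continuousV; [exact: f0|exact: Cf].
have [df Df] := Cf; split=> [x Ux|v]; first by apply: differentiableV; [exact: df|exact: f0].
have CI := IH (CkW Cf).
apply: Ck_ext (CkM oU (Ck_cst k U (-1)) (CkM oU (CkM oU CI CI) (Df v))) => // x Ux.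
rewrite deriveV; [|exact: f0|exact/diff_derivable/df].
by rewrite expr2 invfM mulN1r scaleNr.
Qed.

Lemma Cinf_sub n (U V : set 'rV[R]_n) f : V `<=` U -> Cinf U f -> Cinf V f.
Proof. by move=> VU Cf k; exact: Ck_sub (Cf k). Qed.

Lemma Cinf_comp m n (U : set 'rV[R]_m) (O : set 'rV[R]_n)
    (h : 'rV[R]_m -> 'rV[R]_n) g : open U ->
  (forall j, Cinf U (fun x => h x 0 j)) -> (forall x, U x -> O (h x)) ->
  Cinf O g -> Cinf U (fun x => g (h x)).
Proof.
by move=> oU Ch UO Cg k; apply: Ck_comp UO (Cg k) => // j; exact: Ch.
Qed.

Lemma derive_coord n (j : 'I_n) (x v : 'rV[R]_n) :
  'D_v (fun y : 'rV[R]_n => y 0 j) x = v 0 j.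
Proof. 
have d : derivable (@id 'rV[R]_n) x v by exact: derivable_id.
by have := derive_mx d; rewrite derive_id => /rowP/(_ j); rewrite mxE => <-.
Qed.

Lemma Cinf_coord n (U : set 'rV[R]_n) j : Cinf U (fun x => x 0 j).
Proof.
case=> [x Ux|k]; first exact: coord_continuous.
split=> [x _|v]; first exact: differentiable_coord.
have -> : 'D_v (fun y : 'rV[R]_n => y 0 j) = fun=> v 0 j.
  by apply/funext => x; exact: derive_coord.
exact: Ck_cst.
Qed.

Lemma Cinf_continuous n (U : set 'rV[R]_n) f x : Cinf U f -> U x ->
  {for x, continuous f}.
Proof. by move=> Cf; exact: (Cf 0). Qed.

Lemma Cinf_differentiable n (U : set 'rV[R]_n) f x : Cinf U f -> U x ->
  differentiable f x.
Proof. by move=> Cf; exact: (Cf 1).1. Qed.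

Lemma Cinf_derive n (U : set 'rV[R]_n) f v : Cinf U f -> Cinf U ('D_v f).
Proof. by move=> Cf k; exact: (Cf k.+1).2. Qed.

(** The chain rule in coordinates. The source is a general normed module because the rule serves
    both for curves [s |-> wscale s y] on R and for maps between row spaces. *)
Lemma derive_comp_rV (V : normedModType R) n (h : V -> 'rV[R]_n)
    (g : 'rV[R]_n -> R) x v :
  (forall j, differentiable (fun y => h y 0 j) x) -> differentiable g (h x) ->
  'D_v (g \o h) x = \sum_j ('D_v (fun y => h y 0 j) x * 'D_(delta_mx 0 j) g (h x)).
Proof.
move=> dhj dg; have dh : differentiable h x.
  have -> : h = \sum_(j < n) (fun x => h x 0 j *: delta_mx 0 j).
    by apply/funext => y; rewrite fct_sumE [LHS]row_sum_delta.
  by apply: differentiable_sum => j; exact: differentiableZl.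
rewrite (deriveE _ (differentiable_comp dh dg)) diff_comp //= -(deriveE v dh).
rewrite derive_mx; last exact: diff_derivable.
rewrite (row_sum_delta (\matrix_(_, _) _)) linear_sum.
by apply: eq_bigr => j _; rewrite linearZ /= -deriveE // mxE.
Qed.

Lemma Cinf_open_preimage m n (U : set 'rV[R]_m) (h : 'rV[R]_m -> 'rV[R]_n) O :
  open U -> (forall j, Cinf U (fun x => h x 0 j)) -> open O ->
  open (U `&` h @^-1` O).
Proof.
move=> oU Ch oO; rewrite openE => z [Uz Oz]; rewrite /interior.
have ch : {for z, continuous h}.
  by apply: continuous_rV => j; exact: Cinf_continuous (Ch j) Uz.
by apply: filterI; [exact: open_nbhs_nbhs|apply: ch; exact: open_nbhs_nbhs].
Qed.

End CalculusTheory.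

(** * Polynomials as functions on R^n *)

Section Polynomials.
Context (R : realType) (n : nat).
Implicit Types (p : mpoly n R) (y : 'rV[R]_n).

Definition mev p y : R := meval (fun k => y 0 k) p.

Lemma mpoly_ring_ind (P : mpoly n R -> Prop) :
  (forall c, P (mpolyC n c)) -> (forall i, P (mpolyX R (mnm1 i))) ->
  (forall p q, P p -> P q -> P (p + q)) -> (forall p q, P p -> P q -> P (p * q)) ->
  forall p, P p.
Proof.
move=> PC PX PD PM p; elim/mpolyind: p => [|c m p _ _ IH]; first by have := PC 0; rewrite mpolyC0.
apply: (PD) => //; rewrite -mul_mpolyC; apply: (PM) => //.
rewrite mpolyXE_id; apply: (big_ind P) => [||i _]; [exact: PC 1|exact: PM|].
by elim: (m i) => [|k IHk]; [exact: PC 1|rewrite exprS; exact: PM].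
Qed.

Lemma mevE0 p : mev p 0 = mcoeff mnm0 p.
Proof.
elim/mpoly_ring_ind: p => [c|i|p q|p q]; rewrite /mev.
- by rewrite mevalC mcoeffC eqxx mulr1.
- by rewrite mevalXU mcoeffX mnm1_eq0 mxE.
- by rewrite mevalD mcoeffD => -> ->.
- by rewrite mevalM rmorphM /= => -> ->.
Qed.

Lemma Cinf_mev (U : set 'rV[R]_n) p : open U -> Cinf U (mev p).
Proof.
move=> oU k; elim/mpoly_ring_ind: p => [c|i|p q Cp Cq|p q Cp Cq].
- by apply: Ck_ext (Ck_cst k U c) => // x _; rewrite /mev mevalC.
- by apply: Ck_ext (Cinf_coord U i k) => // x _; rewrite /mev mevalXU.
- by apply: Ck_ext (CkD oU Cp Cq) => // x _; rewrite /mev mevalD.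
- by apply: Ck_ext (CkM oU Cp Cq) => // x _; rewrite /mev mevalM.
Qed.

Lemma derive_mev p i y : 'D_(delta_mx 0 i) (mev p) y = mev (mderiv i p) y.
Proof.
have dp q : derivable (mev q) y (delta_mx 0 i).
  by apply: diff_derivable; exact: (Cinf_differentiable (Cinf_mev q openT) I).
elim/mpoly_ring_ind: p => [c|j|p q Cp Cq|p q Cp Cq].
- rewrite mderivC /mev meval0 -[RHS](derive_cst c y (delta_mx 0 i)).
  by congr ('D_ _ _ _); apply/funext => z; rewrite mevalC.
- have -> : mev (mpolyX R (mnm1 j)) = fun z => z 0 j.
    by apply/funext => z; rewrite /mev mevalXU.
  rewrite derive_coord mderivX /mev mevalZ mnm1E mxE eqxx /=.
  have [->|ij] := eqVneq j i; last by rewrite mul0r.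
  have -> : mnm_sub (mnm1 i) (mnm1 i) = mnm0 by apply/mnmP => l; rewrite mnmBE mnm0E subnn.
  by rewrite mpolyX0 meval1 mulr1.
- rewrite mderivD /mev mevalD -!/(mev _ _) -Cp -Cq -deriveD //.
  by congr ('D_ _ _ _); apply/funext => z; rewrite /mev mevalD.
- have -> : mev (p * q) = mev p * mev q by apply/funext => z; rewrite /mev mevalM.
  rewrite mderivM {3}/mev mevalD !mevalM -!/(mev _ _) -Cp -Cq.
  by rewrite deriveM // addrC; congr (_ + _); exact: mulrC.
Qed.

(** Induction on the degree of a monomial [m] shows that its coefficient in a vanishing polynomial
    is 0. The constant coefficient is the value at 0. Otherwise some [m i] is nonzero, and the
    coefficient of [m] is, up to a nonzero integer factor, a coefficient of lower degree in the i-th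
    partial derivative, which vanishes as a function too. *)
Lemma mev_inj p q : (forall y, mev p y = mev q y) -> p = q.
Proof.
move=> pq; apply/eqP; rewrite -subr_eq0; apply/eqP.
have : forall y, mev (p - q) y = 0 by move=> y; rewrite /mev mevalB -!/(mev _ _) pq subrr.
move: (p - q) => {p q pq} r r0; apply/mpolyP => m; rewrite mcoeff0.
elim: {m}(mdeg m) {-2}m (erefl (mdeg m)) r r0 => [|d IH] m md r r0.
  by move/eqP: md; rewrite mdeg_eq0 => /eqP ->; rewrite -mevE0 r0.
have [i mi] : exists i, m i != 0%N.
  apply: contrapT => /forallNP m0; move: md; rewrite mdegE big1 // => i _.
  by apply/eqP; apply: contrapT => /negP; exact: m0.
have mE : m = mnm_add (mnm_sub m (mnm1 i)) (mnm1 i).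
  by rewrite submK //; apply/mnm_lepP => j; rewrite mnm1E; case: eqP => // <-; rewrite lt0n.
have dr0 y : mev (mderiv i r) y = 0.
  rewrite -derive_mev (_ : mev r = fun=> 0); first exact: derive_cst.
  exact/funext.
have dm : mdeg (mnm_sub m (mnm1 i)) = d.
  by move: md; rewrite {1}mE mdegD mdeg1 addn1 => -[].
have /eqP := IH _ dm _ dr0; rewrite mcoeff_deriv -mE.
by rewrite mulrn_eq0 /= => /eqP.
Qed.

End Polynomials.

(** * Homogeneous functions are polynomials *)

Section Homogeneous.
Context (R : realType) (d : seq nat).
Let D := sumn d.
Implicit Types (y : 'rV[R]_D) (k : 'I_D).

Lemma wscale0 y : wscale 0 y = 0.
Proof. by apply/rowP => k; rewrite !mxE /wt exprS !mul0r. Qed.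

Lemma wscale1 y : wscale 1 y = y.
Proof. by apply/rowP => k; rewrite !mxE expr1n mul1r. Qed.

Lemma wscaleA s t y : wscale s (wscale t y) = wscale (s * t) y.
Proof. by apply/rowP => k; rewrite !mxE exprMn mulrA. Qed.

Lemma mev_wscale i (p : mpoly D R) t y : is_whomog i p ->
  mev p (wscale t y) = t ^+ i * mev p y.
Proof.
move=> /dhomogP hp; rewrite /mev !mevalE mulr_sumr; apply: eq_big_seq => m mp.
rewrite mulrCA; congr (_ * _).
under eq_bigr do rewrite mxE exprMn -exprM.
rewrite big_split /= -expr_sum; congr (_ ^+ _ * _).
by rewrite -(hp _ mp); apply: eq_bigr => k _; rewrite mulnC.
Qed.

(** Identities obtained by cancelling a power of t hold only for t != 0; this extends them to t =
    0. *)
Lemma eq_at0 (f g : R -> R) : {for 0, continuous f} -> {for 0, continuous g} ->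
  (forall t : R, t != 0 -> f t = g t) -> f 0 = g 0.
Proof.
move=> /continuous_withinNx cf /continuous_withinNx cg fg.
apply: (@norm_cvg_unique _ _ _ _ _ _ cf); apply: cvg_trans cg; apply: near_eq_cvg.
by near=> t; apply/esym/fg; near: t; exact: nbhs_dnbhs_neq.
Unshelve. all: by end_near. Qed.

Lemma differentiable_wscale y t k : differentiable (fun s : R => wscale s y 0 k) t.
Proof.
have -> : (fun s : R => wscale s y 0 k) = fun s => s ^+ wt k * y 0 k.
  by apply/funext => s; rewrite mxE.
by apply: differentiableM => //; apply/derivable1_diffP; exact: exprn_derivable.
Qed.

Lemma continuous_wscale y t : {for t, continuous (fun s : R => wscale s y)}.
Proof. 
apply: differentiable_continuous; rewrite (_ : (fun s : R => _) =
  \sum_(j < D) (fun s : R => wscale s y 0 j *: delta_mx 0 j)); last first.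
  by apply/funext => s; rewrite fct_sumE [LHS]row_sum_delta.
by apply: differentiable_sum => j; apply: differentiableZl; exact: differentiable_wscale.
Qed.

(** Both sides are the derivative at s = 1 of [g (wscale s y)], which equals s^i g(y). *)
Lemma euler i (g : 'rV[R]_D -> R) y : (forall z, differentiable g z) ->
  (forall t z, g (wscale t z) = t ^+ i * g z) ->
  i%:R * g y = \sum_k ((wt k)%:R * y 0 k * 'D_(delta_mx 0 k) g y).
Proof.
move=> dg hg; have := derive_comp_rV (h := fun s => wscale s y) (g := g) 1.
move=> /(_ 1 (differentiable_wscale y 1) (dg _)); rewrite wscale1.
have -> : (g \o fun s => wscale s y) = g y \o* (@GRing.exp R ^~ i).
  by apply/funext => s /=; rewrite hg.
rewrite deriveMr; last exact: exprn_derivable.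
rewrite exp_derive expr1n mulrC [_ *: 1]mulr1 [_ *: 1]mulr1 => ->.
apply: eq_bigr => k _; congr (_ * _).
have -> : (fun s : R => wscale s y 0 k) = y 0 k \o* (@GRing.exp R ^~ (wt k)).
  by apply/funext => s; rewrite mxE.
rewrite deriveMr; last exact: exprn_derivable.
by rewrite exp_derive expr1n mulrC [_ *: 1]mulr1 [_ *: 1]mulr1.
Qed.

(** Differentiate the homogeneity relation in the k-th coordinate of z. Since [wscale t] is
    diagonal, only the k-th term of the chain rule survives. *)
Lemma derive_wscale i (g : 'rV[R]_D -> R) t y k : (forall z, differentiable g z) ->
  (forall t z, g (wscale t z) = t ^+ i * g z) ->
  t ^+ wt k * 'D_(delta_mx 0 k) g (wscale t y) = t ^+ i * 'D_(delta_mx 0 k) g y.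
Proof.
move=> dg hg.
have wE (j : 'I_D) : (fun z : 'rV[R]_D => wscale t z 0 j) =
    t ^+ wt j \*o (fun z : 'rV[R]_D => z 0 j).
  by apply/funext => z; rewrite mxE.
have dw (j : 'I_D) : differentiable (fun z : 'rV[R]_D => wscale t z 0 j) y.
  by rewrite wE; apply: differentiableM => //; exact: differentiable_coord.
have := derive_comp_rV (delta_mx 0 k) dw (dg (wscale t y)).
have -> : g \o wscale t = t ^+ i \*o g by apply/funext => z /=; rewrite hg.
rewrite deriveMl; last exact/diff_derivable.
move=> ->; rewrite (bigD1 k) //= big1 ?addr0 => [|j jk]; rewrite wE.
  rewrite deriveMl ?derive_coord ?mxE ?eqxx ?mulr1 //.
  exact/diff_derivable/differentiable_coord.
rewrite deriveMl ?derive_coord ?mxE ?(negbTE jk) ?andbF ?mulr0 ?mul0r //.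
exact/diff_derivable/differentiable_coord.
Qed.

Lemma wmdeg1 k : wmdeg (mnm1 k) = wt k.
Proof.
rewrite /wmdeg (bigD1 k) //= big1 ?addn0 => [|l lk]; last first.
  by rewrite mnm1E eq_sym (negbTE lk).
by rewrite mnm1E eqxx mul1n.
Qed.

Lemma whomog_mulX i j k (p : mpoly D R) : is_whomog j p -> (i = wt k + j)%N ->
  is_whomog i (mpolyX R (mnm1 k) * p).
Proof.
by move=> hp ->; apply: dhomogM => //; rewrite /ishomog1 dhomogX; exact/eqP/wmdeg1.
Qed.

(* Every partial derivative is homogeneous of lower weight, and vanishes when
   its weight would be negative; Euler's identity then recovers [g]. *)
Lemma homogeneous_poly i (g : 'rV[R]_D -> R) : Cinf setT g ->
  (forall t z, g (wscale t z) = t ^+ i * g z) ->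
  exists2 p, is_whomog i p & forall y, g y = mev p y.
Proof.
elim/ltn_ind: i g => i IH g Cg hg.
have dg z : differentiable g z by exact: Cinf_differentiable Cg I.
have [i0|i_gt0] := posnP i.
  (* As 0^0 = 1, homogeneity at t = 0 says that g is constant. *)
  exists (g 0 *: 1) => [|y]; first by rewrite i0; apply: dhomogZ; exact: dhomog1.
  by rewrite /mev mevalZ meval1 mulr1 -(wscale0 y) hg i0 mul1r.
have cD k z : {for z, continuous ('D_(delta_mx 0 k) g)}.
  exact: Cinf_continuous (Cinf_derive _ Cg) I.
have cDw k z : {for 0, continuous (fun t : R => 'D_(delta_mx 0 k) g (wscale t z))}.
  apply: (continuous_comp (f := fun t : R => wscale t z) (g := 'D_(delta_mx 0 k) g)).
    exact: continuous_wscale.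
  exact: cD.
have cX n : {for (0 : R), continuous (fun t : R => t ^+ n)}.
  by apply/differentiable_continuous/derivable1_diffP; exact: exprn_derivable.
(* The weight condition is put on X_k q rather than on q, so that it also covers q = 0 when [wt k]
   exceeds i and the difference i - [wt k] would be truncated. *)
have Dg k : exists2 q, is_whomog i (mpolyX R (mnm1 k) * q) &
    forall y, 'D_(delta_mx 0 k) g y = mev q y.
  have [wi|iw] := leqP (wt k) i.
    have [|||q hq gq] := IH (i - wt k)%N _ ('D_(delta_mx 0 k) g).
    - by rewrite ltn_subrL i_gt0 andbT.
    - exact: Cinf_derive.
    - have tn0 (t : R) z : t != 0 -> 'D_(delta_mx 0 k) g (wscale t z) =
          t ^+ (i - wt k) * 'D_(delta_mx 0 k) g z.
        move=> t0; apply: (mulfI (expf_neq0 (wt k) t0)).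
        by rewrite (derive_wscale _ _ _ dg hg) mulrA -exprD subnKC.
      move=> t z; have [->|] := eqVneq t 0; last exact: tn0.
      apply: (eq_at0 (f := fun t : R => 'D_(delta_mx 0 k) g (wscale t z))
        (g := fun t : R => t ^+ (i - wt k) * 'D_(delta_mx 0 k) g z)).
      - exact: cDw.
      - by apply: continuousM; [exact: cX|exact: cst_continuous].
      - by move=> s; exact: tn0.
    by exists q => //; apply: whomog_mulX hq _; rewrite subnKC.
  exists 0 => [|y]; first by rewrite mulr0; exact: dhomog0.
  (* For t != 0 the derivative at y is t^(wt k - i) times the derivative at [wscale t y]. The
     exponent is positive, so letting t tend to 0 gives 0. *)
  rewrite /mev meval0; have := @eq_at0 (fun=> 'D_(delta_mx 0 k) g y)
    (fun t : R => t ^+ (wt k - i) * 'D_(delta_mx 0 k) g (wscale t y)).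
  rewrite expr0n subn_eq0 leqNgt iw mul0r; apply.
  - exact: cst_continuous.
  - by apply: continuousM; [exact: cX|exact: cDw].
  - move=> t t0; apply: (mulfI (expf_neq0 i t0)).
    by rewrite mulrA -exprD subnKC ?(ltnW iw) // (derive_wscale _ _ _ dg hg).
have /choice[q qP] : forall k, exists q, is_whomog i (mpolyX R (mnm1 k) * q) /\
    forall y, 'D_(delta_mx 0 k) g y = mev q y.
  by move=> k; have [q] := Dg k; exists q.
exists (i%:R^-1 *: \sum_k (wt k)%:R *: (mpolyX R (mnm1 k) * q k)) => [|y].
  apply: dhomogZ; apply: rpred_sum => k _; apply: dhomogZ; exact: (qP k).1.
apply: (mulfI (_ : i%:R != 0 :> R)); first by rewrite pnatr_eq0 -lt0n.
rewrite euler // /mev mevalZ mulrA divff ?mul1r; last by rewrite pnatr_eq0 -lt0n.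
rewrite raddf_sum /=; apply: eq_bigr => k _.
by rewrite mevalZ mevalM mevalXU (qP k).2 mulrA.
Qed.

End Homogeneous.

(** * Duality, coalgebras and group-like elements *)

Arguments dapp {R V} xi v : simpl never.

Section LinearAlgebra.
Context (R : realType).
Implicit Types (V W : lmodType R).

HB.instance Definition _ V (xi : dual V) :=
  GRing.isLinear.Build R V R^o _ (dapp xi) (sub_valP xi).

Lemma linear_sumE V W (f : V -> W) : linear f ->
  forall I (r : seq I) (P : pred I) (v : I -> V),
  f (\sum_(i <- r | P i) v i) = \sum_(i <- r | P i) f (v i).
Proof.
by move=> lf; exact: (linear_sum (HB.pack f (GRing.isLinear.Build _ _ _ _ f lf) : {linear V -> W})).
Qed.

Lemma linear_ZE V W (f : V -> W) : linear f -> forall a v, f (a *: v) = a *: f v.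
Proof.
move=> lf; pose g : {linear V -> W} := HB.pack f (GRing.isLinear.Build _ _ _ _ f lf).
exact: (linearZ_LR g).
Qed.

Lemma dual_ext V (xi eta : dual V) : dapp xi =1 dapp eta -> xi = eta.
Proof. by move=> e; apply/val_inj/funext. Qed.

Lemma dappD V (xi : dual V) u v : dapp xi (u + v) = dapp xi u + dapp xi v.
Proof. exact: linearD. Qed.

Lemma dappZ V (xi : dual V) a v : dapp xi (a *: v) = a * dapp xi v.
Proof. exact: linearZ. Qed.

Lemma dapp_sum V (xi : dual V) I (r : seq I) (P : pred I) (v : I -> V) :
  dapp xi (\sum_(i <- r | P i) v i) = \sum_(i <- r | P i) dapp xi (v i).
Proof. exact: linear_sum. Qed.

Lemma dappl_linear V (v : V) : linear ((fun xi => dapp xi v) : dual V -> R^o).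
Proof. by []. Qed.

Lemma dapplZ V (xi : dual V) a v : dapp (a *: xi) v = a * dapp xi v.
Proof. by []. Qed.

Lemma dapplD V (xi eta : dual V) v : dapp (xi + eta) v = dapp xi v + dapp eta v.
Proof. by []. Qed.

Lemma dappl_sum V I (r : seq I) (P : pred I) (xi : I -> dual V) v :
  dapp (\sum_(i <- r | P i) xi i) v = \sum_(i <- r | P i) dapp (xi i) v.
Proof. exact: (linear_sumE (dappl_linear v)). Qed.

Definition mkdual V (f : V -> R^o) (lf : linear f) : dual V := mksub (P := dual_sp V) lf.

Lemma dualmap_subproof V W (L : V -> W) (xi : dual W) :
  linear L -> linear (dapp xi \o L : V -> R^o).
Proof. by move=> lL a u v /=; rewrite lL dappD dappZ. Qed.

(* Junk (zero) when [L] is not linear *)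
Definition dualmap V W (L : V -> W) (xi : dual W) : dual V :=
  if pselect (linear L) is left lL then mkdual (dualmap_subproof xi lL) else 0.

Lemma dualmapE V W (L : V -> W) xi v : linear L -> dapp (dualmap L xi) v = dapp xi (L v).
Proof. by rewrite /dualmap; case: pselect. Qed.

Lemma dualmap_linear V W (L : V -> W) : linear (dualmap L).
Proof.
move=> a u v; apply: dual_ext => w; rewrite dapplD dapplZ /dualmap.
by case: pselect => [lL|_] //=; rewrite mulr0 addr0.
Qed.

(** Finite dimension is recorded as a pair of dual bases, the form in which tensors over dual spaces
    are expanded below. *)
Definition fd V := exists N (t : 'I_N -> dual V) (l : 'I_N -> V),
  (forall j k, dapp (t j) (l k) = (j == k)%:R) /\
  forall v, v = \sum_j dapp (t j) v *: l j.

Lemma fd_iso V W (f : V -> W) (g : W -> V) : linear f -> linear g ->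
  cancel f g -> cancel g f -> fd V -> fd W.
Proof.
move=> lf lg fK gK [N [t [l [tl vE]]]].
exists N, (fun j => dualmap g (t j)), (fun j => f (l j)).
split=> [j k|w]; first by rewrite dualmapE // fK.
rewrite -{1}(gK w) {1}(vE (g w)) (linear_sumE lf); apply: eq_bigr => j _.
by rewrite dualmapE // (linear_ZE lf).
Qed.

(* A biorthogonal system of maximal length is a dual basis. *)
Lemma interpolation T V (ev : T -> dual V) B (phi : V -> 'rV[R]_B) : linear phi ->
  (forall v, phi v = 0 -> v = 0) ->
  (forall v, (forall t, dapp (ev t) v = 0) -> v = 0) ->
  exists N (t : 'I_N -> T) (l : 'I_N -> V),
    (forall j k, dapp (ev (t j)) (l k) = (j == k)%:R) /\
    forall v, v = \sum_j dapp (ev (t j)) v *: l j.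
Proof.
move=> lphi phi0 ev0.
pose P N := `[< exists (t : 'I_N -> T) (l : 'I_N -> V),
    forall j k, dapp (ev (t j)) (l k) = (j == k)%:R >].
have P0 : exists N, P N.
  exists 0%N; apply/asboolP; have t (i : 'I_0) : T by case: i.
  by exists t, (fun=> 0) => -[].
have PB N : P N -> (N <= B)%N.
  move=> /asboolP[t [l tl]].
  (* Biorthogonality makes the [l j] independent and [phi] is injective, so the rows of [A] are
     independent and N is at most B. *)
  pose A : 'M[R]_(N, B) := \matrix_j phi (l j).
  suff : row_free A by move/eqP <-; exact: rank_leq_col.
  apply: inj_row_free => u uA.
  have : phi (\sum_j u 0 j *: l j) = 0.
    rewrite (linear_sumE lphi) -[RHS]uA mulmx_sum_row; apply: eq_bigr => j _.
    by rewrite (linear_ZE lphi) rowK.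
  move=> /phi0 e; apply/rowP => k.
  have := congr1 (dapp (ev (t k))) e; rewrite dapp_sum linear0 mxE => <-.
  rewrite (bigD1 k) //= big1 => [|j jk]; rewrite dappZ tl ?eqxx ?mulr1 ?addr0 //.
  by rewrite eq_sym (negbTE jk) mulr0.
case: (ex_maxnP P0 PB) => N /asboolP[t [l tl]] maxN; exists N, t, l; split=> // v.
apply/eqP; rewrite -subr_eq0; apply/eqP; set w := _ - _.
have w0 j : dapp (ev (t j)) w = 0.
  rewrite linearB /= dapp_sum (bigD1 j) //= big1 => [|k kj]; rewrite dappZ tl.
    by rewrite eqxx mulr1 addr0 subrr.
  by rewrite eq_sym (negbTE kj) mulr0.
apply: ev0 => s; apply: contrapT => /eqP ws.
have := maxN N.+1; rewrite ltnn => /(_ _)/notF; apply; apply/asboolP.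
(* [wn] is killed by all the [t j] and takes the value 1 at [s]. Adjoining the pair [s], [wn], and
   correcting each [l j] so that it vanishes at [s], gives a longer biorthogonal system. *)
pose wn := (dapp (ev s) w)^-1 *: w.
exists (fun j => if unlift ord0 j is Some j' then t j' else s),
  (fun j => if unlift ord0 j is Some j' then l j' - dapp (ev s) (l j') *: wn else wn).
move=> j k; case: (unliftP ord0 j) => [j'|] ->; case: (unliftP ord0 k) => [k'|] -> /=.
- by rewrite linearB /= !dappZ w0 !mulr0 subr0 tl (inj_eq lift_inj).
- by rewrite dappZ w0 mulr0.
- by rewrite linearB /= !dappZ mulVf // mulr1 subrr.
- by rewrite dappZ mulVf.
Qed.

End LinearAlgebra.

(** * Tensors over dual spaces, dual coalgebras and group-like families *)

Section Tensors.
Context (R : realType).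
Implicit Types (V W : lmodType R) (A B C : nat -> lmodType R).

Lemma tevalE V W (s : seq (V * W)) b : bilin b -> teval s b = \sum_(p <- s) b p.1 p.2.
Proof. by move=> bb; rewrite /teval asboolT. Qed.

Lemma bilin_eval V W (v : V) (w : W) :
  bilin (fun (xi : dual V) (eta : dual W) => dapp xi v * dapp eta w).
Proof.
split=> [xi|eta] a u u'; rewrite dapplD dapplZ.
  by rewrite mulrDr mulrCA.
by rewrite mulrDl -mulrA.
Qed.

Lemma bilin_comp V W V' W' (f : V -> V') (g : W -> W') (b : V' -> W' -> R) :
  linear f -> linear g -> bilin b -> bilin (fun v w => b (f v) (g w)).
Proof.
move=> lf lg [b1 b2]; split=> [v|w] a u u'.
  by rewrite lg b1.
by rewrite lf; exact: (b2 _ a).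
Qed.

(** In dual bases every bilinear form on the two dual spaces is a combination of the forms that
    evaluate at a pair of basis vectors. *)
Lemma tens_ext V W (T T' : tens (dual V) (dual W)) : fd V -> fd W ->
  (forall v w, T (fun xi eta => dapp xi v * dapp eta w) =
               T' (fun xi eta => dapp xi v * dapp eta w)) ->
  forall b, bilin b -> T b = T' b.
Proof.
move=> [N [t [l [tl vE]]]] [N' [t' [l' [tl' wE]]]].
have [[s ->] [s' ->]] := (tensP T, tensP T') => TT b bb.
have bE xi eta : b xi eta =
    \sum_j \sum_k b (t j) (t' k) * (dapp xi (l j) * dapp eta (l' k)).
  have xiE : xi = \sum_j dapp xi (l j) *: t j.
    apply: dual_ext => v; rewrite {1}(vE v) dapp_sum dappl_sum.
    by apply: eq_bigr => j _; rewrite dappZ dapplZ mulrC.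
  have etaE : eta = \sum_k dapp eta (l' k) *: t' k.
    apply: dual_ext => v; rewrite {1}(wE v) dapp_sum dappl_sum.
    by apply: eq_bigr => j _; rewrite dappZ dapplZ mulrC.
  have [b1 b2] := bb.
  rewrite {1}xiE {1}etaE.
  rewrite (linear_sumE (f := b^~ _ : _ -> R^o) (b2 _)); apply: eq_bigr => j _.
  rewrite (linear_ZE (f := b^~ _ : _ -> R^o) (b2 _)).
  rewrite (linear_sumE (f := b _ : _ -> R^o) (b1 _)) scaler_sumr; apply: eq_bigr => k _.
  by rewrite (linear_ZE (f := b _ : _ -> R^o) (b1 _)) scalerA [LHS]mulrC.
have sE (r : seq (dual V * dual W)) : teval r b =
    \sum_j \sum_k b (t j) (t' k) * teval r (fun xi eta => dapp xi (l j) * dapp eta (l' k)).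
  rewrite tevalE //; under eq_bigr do rewrite bE.
  rewrite exchange_big; apply: eq_bigr => j _.
  rewrite exchange_big; apply: eq_bigr => k _.
  by rewrite tevalE ?mulr_sumr //; exact: bilin_eval.
by rewrite !sE; apply: eq_bigr => j _; apply: eq_bigr => k _; rewrite TT.
Qed.

Definition galg_bilin A (a : galg A) : Prop :=
  forall i j, (forall v : A i, linear (@gmul R A a i j v)) /\
              (forall w : A j, linear (fun v : A i => gmul a v w)).

(** The comultiplication of [dual_coalg] is picked by [xget], so the set it picks from must be
    inhabited. The witness is the tensor whose coefficients in the dual bases are the values of [xi]
    on products of basis vectors. *)
Lemma dual_comulE A (a : galg A) i j (xi : dual (A (i + j)%N)) v w :
  galg_bilin a -> fd (A i) -> fd (A j) ->
  gcomul (dual_coalg a) xi (fun p q => dapp p v * dapp q w) = dapp xi (gmul a v w).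
Proof.
move=> ba [N [t [l [tl vE]]]] [N' [t' [l' [tl' wE]]]] /=.
pose s := [seq (dapp xi (gmul a (l p.1) (l' p.2)) *: t p.1, t' p.2) |
            p <- enum [the finType of ('I_N * 'I_N')%type]].
have sP v' w' : teval s (fun p q => dapp p v' * dapp q w') = dapp xi (gmul a v' w').
  rewrite tevalE; last exact: bilin_eval.
  rewrite /s big_map big_enum /= -(pair_bigA _ (fun j k =>
    dapp (dapp xi (gmul a (l j) (l' k)) *: t j) v' * dapp (t' k) w')) /=.
  have [b1 b2] := ba i j.
  rewrite [in RHS](vE v') (linear_sumE (b2 w')) dapp_sum; apply: eq_bigr => m _.
  rewrite (linear_ZE (b2 w')) dappZ [in RHS](wE w') (linear_sumE (b1 _)) dapp_sum mulr_sumr.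
  apply: eq_bigr => k _; rewrite (linear_ZE (b1 _)) dappZ dapplZ mulrA mulrC.
  by rewrite [LHS]mulrCA [RHS]mulrC; congr (_ * _); exact: mulrC.
pose T := Tens (ex_intro (fun s' => teval s = teval s') s erefl).
exact: (@xgetPex _ (tens0 _ _) [set T : tens (dual (A i)) (dual (A j)) | forall u v,
  T (fun p q => dapp p u * dapp q v) = dapp xi (gmul a u v)] (ex_intro _ T sP)).
Qed.

(** By [tens_ext] the two tensors need only be compared on pairs of evaluations, where the claim is
    that [g], of which [f] is the transpose, is multiplicative. *)
Lemma dual_coalg_hom A A' (a : galg A) (a' : galg A') (g : forall i, A' i -> A i)
    (f : forall i, dual (A i) -> dual (A' i)) :
  galg_bilin a -> galg_bilin a' -> (forall i, fd (A i)) -> (forall i, fd (A' i)) ->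
  (forall i, linear (g i)) ->
  (forall i j u v, g (i + j)%N (gmul a' u v) = gmul a (g i u) (g j v)) ->
  g 0%N (gone a') = gone a ->
  (forall i xi v, dapp (f i xi) v = dapp xi (g i v)) ->
  is_gcoalg_hom (dual_coalg a) (dual_coalg a') f.
Proof.
move=> ba ba' fA fA' lg gM g1 fE.
have lf i : linear (f i).
  by move=> c u v; apply: dual_ext => w; rewrite dapplD dapplZ !fE dapplD dapplZ.
split=> // [i j x b bb|x]; last by rewrite /= fE g1.
have [s sE] := tensP (gcomul (dual_coalg a) x).
(* [tens_ext] compares tensors, so the image of the comultiplication under f in both factors is
   first realised as one, by mapping [f] over a representing list. *)
pose s' := [seq (f i p.1, f j p.2) | p <- s].
have ss b' : bilin b' -> teval s' b' = gcomul (dual_coalg a) x (fun u v => b' (f i u) (f j v)).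
  by move=> bb'; rewrite sE !tevalE ?big_map //; exact: bilin_comp.
pose T := Tens (ex_intro (fun s => teval s' = teval s) s' erefl).
rewrite -(ss b bb) -[LHS]/(T b); apply: tens_ext => // v w.
rewrite dual_comulE //= ss; last exact: bilin_eval.
rewrite fE gM -dual_comulE //; congr (tapp _ _).
by apply/funext => u; apply/funext => u'; rewrite !fE.
Qed.

Definition glike C (c : gcoalg C) (u : forall i, C i) : Prop :=
  (forall i j b, bilin b -> gcomul c (u (i + j)%N) b = b (u i) (u j)) /\
  gcounit c (u 0%N) = 1.

Lemma glike_hom C C' (c : gcoalg C) (c' : gcoalg C') f u :
  is_gcoalg_hom c c' f -> glike c u -> glike c' (fun i => f i (u i)).
Proof.
move=> [lf cf ef] [cu eu]; split=> [i j b bb|]; last by rewrite ef.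
by rewrite -cf // cu //; exact: bilin_comp.
Qed.

(** Group-like families of a dual coalgebra are the characters of the algebra, given degree by
    degree. *)
Lemma glike_dualP A (a : galg A) u : galg_bilin a -> (forall i, fd (A i)) ->
  glike (dual_coalg a) u <->
  (forall i j (v : A i) (w : A j), dapp (u (i + j)%N) (gmul a v w) = dapp (u i) v * dapp (u j) w)
    /\ dapp (u 0%N) (gone a) = 1.
Proof.
move=> ba fA; split=> -[cu eu]; split=> // i j; last move=> b bb.
  by move=> v w; rewrite -dual_comulE // cu //; exact: bilin_eval.
have t1 : b (u i) (u j) = teval [:: (u i, u j)] b by rewrite tevalE // big_seq1.
pose T := Tens (ex_intro (fun s => teval [:: (u i, u j)] = teval s) _ erefl).
rewrite t1 -[RHS]/(T b); apply: tens_ext => // v w.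
rewrite dual_comulE //= tevalE; last exact: bilin_eval.
by rewrite big_seq1 cu.
Qed.

Lemma gcoalg_hom_inv C C' (c : gcoalg C) (c' : gcoalg C') f g :
  (forall i, cancel (f i) (g i)) -> (forall i, cancel (g i) (f i)) ->
  is_gcoalg_hom c c' f -> is_gcoalg_hom c' c g.
Proof.
move=> fK gK [lf cf ef].
have lg i : linear (g i) by move=> a u v; apply: (can_inj (fK i)); rewrite lf !gK.
split=> // [i j x b bb|x]; last by rewrite -ef gK.
rewrite -{1}(gK _ x) -cf; last exact: bilin_comp.
by congr (tapp _ _); apply/funext => u; apply/funext => v; rewrite !fK.
Qed.

Lemma gcoalg_hom_comp C C' C'' (c : gcoalg C) (c' : gcoalg C') (c'' : gcoalg C'') f g :
  is_gcoalg_hom c c' f -> is_gcoalg_hom c' c'' g ->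
  is_gcoalg_hom c c'' (fun i => g i \o f i).
Proof.
move=> [lf cf ef] [lg cg eg]; split=> [i a u v|i j x b bb|x] /=.
- by rewrite lf lg.
- by rewrite -cg // -cf //; exact: bilin_comp.
- by rewrite eg ef.
Qed.

End Tensors.

(** * The graded polynomial coalgebra and its point evaluations *)

Section PolyCoalgebra.
Context (R : realType).
Implicit Types (d : seq nat).

Lemma poly_ext d i (p q : poly_gr R d i) :
  (forall y, mev (sub_val p) y = mev (sub_val q) y) -> p = q.
Proof. by move=> e; apply/val_inj/mev_inj. Qed.

Lemma poly_galg_bilin d : galg_bilin (poly_galg R d).
Proof.
move=> i j; split=> w a u v; apply: val_inj.
  by rewrite /= mulrDr scalerAr.
by rewrite /= mulrDl scalerAl.
Qed.

Lemma evp_subproof d i y : linear ((fun p => mev (sub_val p) y) : poly_gr R d i -> R^o).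
Proof. by move=> a p q; rewrite /mev /= mevalD mevalZ. Qed.

Definition evp d i (y : 'rV[R]_(sumn d)) : poly_co R d i := mkdual (evp_subproof y).

Lemma evpE d i y p : dapp (@evp d i y) p = mev (sub_val p) y.
Proof. by []. Qed.

(** Every weight is at least 1. Hence only finitely many monomials have a given weight. *)
Lemma leq_mdeg_wmdeg d (m : multinom (sumn d)) : (mdeg m <= wmdeg m)%N.
Proof. by rewrite mdegE; apply: leq_sum => k _; rewrite /wt mulnS leq_addr. Qed.

Lemma poly_interpolation d i : exists N (y : 'I_N -> 'rV[R]_(sumn d)) (l : 'I_N -> poly_gr R d i),
  (forall j k, dapp (evp i (y j)) (l k) = (j == k)%:R) /\
  forall p, p = \sum_j dapp (evp i (y j)) p *: l j.
Proof.
(* The bound is strict: these are the monomials of degree at most i, which include all those of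
   weight i. *)
pose B := bmultinom (sumn d) i.+1.
pose phi (p : poly_gr R d i) : 'rV[R]_#|{: B}| := \row_j mcoeff (enum_val j : B) (sub_val p).
apply: (@interpolation _ _ _ (@evp d i) _ phi) => [a p q|p p0|p p0].
- by apply/rowP => j; rewrite !mxE /= mcoeffD mcoeffZ.
- apply/val_inj/mpolyP => m; rewrite /= mcoeff0.
  have [mi|mi] := ltnP (mdeg m) i.+1.
    have /rowP/(_ (enum_rank (BMultinom mi : B))) := p0.
    by rewrite !mxE enum_rankK.
  apply: dhomog_nemf_coeff (sub_valP p) _; apply: contraTneq mi => /= <-.
  by rewrite -leqNgt leq_mdeg_wmdeg.
- by apply: poly_ext => y; rewrite -evpE p0 /mev meval0.
Qed.

Lemma fd_poly d i : fd (poly_gr R d i).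
Proof.
have [N [y [l [yl pE]]]] := poly_interpolation d i.
by exists N, (fun j => evp i (y j)), l.
Qed.

Lemma evp_span d i : exists N (y : 'I_N -> 'rV[R]_(sumn d)) (l : 'I_N -> poly_gr R d i),
  forall xi : poly_co R d i, xi = \sum_j dapp xi (l j) *: evp i (y j).
Proof.
have [N [y [l [_ pE]]]] := poly_interpolation d i; exists N, y, l => xi.
apply: dual_ext => p; rewrite {1}(pE p) dapp_sum dappl_sum.
by apply: eq_bigr => j _; rewrite dappZ dapplZ mulrC.
Qed.

Lemma evp_ext d i (W : lmodType R) (f g : poly_co R d i -> W) : linear f -> linear g ->
  (forall y, f (evp i y) = g (evp i y)) -> f =1 g.
Proof.
move=> lf lg fg xi; have [N [y [l xiE]]] := evp_span d i.
rewrite (xiE xi) (linear_sumE lf) (linear_sumE lg); apply: eq_bigr => j _.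
by rewrite (linear_ZE lf) (linear_ZE lg) fg.
Qed.

Lemma evp_wscale d i t y : evp i (wscale t y) = t ^+ i *: @evp d i y.
Proof. by apply: dual_ext => p; rewrite dapplZ !evpE (mev_wscale _ _ (sub_valP p)). Qed.

Lemma whomog_var d (k : 'I_(sumn d)) : is_whomog (wt k) (mpolyX R (mnm1 k) : mpoly (sumn d) R).
Proof. by rewrite /is_whomog /ishomog1 dhomogX; exact/eqP/wmdeg1. Qed.

Definition varp d (k : 'I_(sumn d)) : poly_gr R d (wt k) :=
  mksub (P := poly_sp R d (wt k)) (whomog_var k).

Lemma evp_var d (k : 'I_(sumn d)) (y : 'rV[R]_(sumn d)) : dapp (evp (wt k) y) (varp k) = y 0 k.
Proof. by rewrite evpE /mev mevalXU. Qed.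

Lemma evp_inj d y y' : (forall i, @evp d i y = evp i y') -> y = y'.
Proof. by move=> e; apply/rowP => k; rewrite -!evp_var e. Qed.

Lemma glike_evp d y : glike (poly_coalg R d) (fun i => evp i y).
Proof.
apply/glike_dualP; [exact: poly_galg_bilin|exact: fd_poly|split=> [i j v w|]].
  by rewrite !evpE /mev mevalM.
by rewrite evpE /mev meval1.
Qed.

(** A character of the polynomial algebra is determined by its values on the variables. For
    monomials this is an induction on the degree that splits off one variable; linearity does the
    rest. *)
Lemma glike_polyE d u : glike (poly_coalg R d) u ->
  forall i, u i = evp i (\row_k dapp (u (wt k)) (varp k)).
Proof.
move=> /(glike_dualP _ (@poly_galg_bilin d) (@fd_poly d))[uM u1] i; set y := \row_k _.
have uX n m j (q : poly_gr R d j) : mdeg m = n -> sub_val q = mpolyX R m ->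
    dapp (u j) q = mev (sub_val q) y.
  elim: n m j q => [|n IH] m j q.
    move=> /eqP; rewrite mdeg_eq0 => /eqP -> qE.
    have j0 : j = 0%N.
      have := sub_valP q; rewrite qE /= /is_whomog /ishomog1 dhomogX => /eqP <-.
      exact: wmdeg0.
    subst j; have -> : q = gone (poly_galg R d) by apply: val_inj; rewrite /= qE mpolyX0.
    by rewrite u1 /mev meval1.
  move=> mn qE; have [k mk] : exists k, m k != 0%N.
    apply: contrapT => /forallNP m0; move: mn; rewrite mdegE big1 // => k _.
    by apply/eqP; apply: contrapT => /negP; exact: m0.
  have mE : m = mnm_add (mnm_sub m (mnm1 k)) (mnm1 k).
    by rewrite submK //; apply/mnm_lepP => l; rewrite mnm1E; case: eqP => // <-; rewrite lt0n.
  set m' := mnm_sub _ _ in mE.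
  have hm' : is_whomog (wmdeg m') (mpolyX R m') by rewrite /is_whomog /ishomog1 dhomogX.
  (* Multiplicativity applies only to a component whose degree is literally a sum. This is why [uX]
     quantifies over j instead of fixing i. *)
  have jE : j = (wmdeg m' + wt k)%N.
    have := sub_valP q; rewrite qE /= /is_whomog /ishomog1 dhomogX => /eqP <-.
    by rewrite mE; etransitivity; [exact: wmdegD|rewrite wmdeg1].
  subst j; pose q' := mksub (P := poly_sp R d (wmdeg m')) hm'.
  have -> : q = gmul (poly_galg R d) q' (varp k).
    by apply: val_inj; rewrite /= qE mE mpolyXD.
  rewrite uM (IH m') //; last first.
    by move: mn; rewrite mE mdegD mdeg1 addn1 => -[].
  by rewrite /mev /= mevalM mevalXU mxE.
apply: dual_ext => p; rewrite evpE.
pose mon m : poly_gr R d i := insubd (0 : poly_gr R d i) (mpolyX R m).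
have monE m : m \in msupp (sub_val p) -> sub_val (mon m) = mpolyX R m.
  move=> mp; apply: insubdK; apply/asboolP; rewrite /= /is_whomog /ishomog1 dhomogX.
  by apply/eqP; have /dhomogP := sub_valP p; apply.
have lv : linear (@sub_val _ _ (poly_sp R d i)) by [].
have -> : p = \sum_(m <- msupp (sub_val p)) mcoeff m (sub_val p) *: mon m.
  apply: val_inj; rewrite [RHS](linear_sumE lv) [LHS]mpolyE; apply: eq_big_seq => m mp.
  by rewrite (linear_ZE lv) monE.
rewrite dapp_sum (linear_sumE lv) /mev raddf_sum; apply: eq_big_seq => m mp.
by rewrite dappZ (linear_ZE lv) /= mevalZ -/(mev _ _) (uX (mdeg m) m) // monE.
Qed.

Lemma evp_glike d u : glike (poly_coalg R d) u -> exists y, forall i, u i = evp i y.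
Proof. by move=> /glike_polyE uE; eexists; exact: uE. Qed.

(** Defined for any family of maps: linearity gives its homogeneity and, for smooth families, its
    smoothness. For a coalgebra morphism it also tracks evaluations, by [Theta_evp]. *)
Definition Theta d d' (s : forall i, poly_co R d i -> poly_co R d' i) (y : 'rV[R]_(sumn d)) :
  'rV[R]_(sumn d') := \row_k dapp (s (wt k) (evp (wt k) y)) (varp k).

Lemma Theta_evp d d' (s : forall i, poly_co R d i -> poly_co R d' i) i y :
  is_gcoalg_hom (poly_coalg R d) (poly_coalg R d') s ->
  s i (evp i y) = evp i (Theta s y).
Proof. by move=> hs; exact: (glike_polyE (glike_hom hs (glike_evp y)) i). Qed.

Lemma ThetaE d d' (s : forall i, poly_co R d i -> poly_co R d' i) y z :
  (forall i, s i (evp i y) = evp i z) -> Theta s y = z.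
Proof. by move=> e; apply/rowP => k; rewrite mxE e evp_var. Qed.

Lemma Theta_wscale d d' (s : forall i, poly_co R d i -> poly_co R d' i) t y :
  (forall i, linear (s i)) -> Theta s (wscale t y) = wscale t (Theta s y).
Proof.
by move=> ls; apply/rowP => k; rewrite !mxE evp_wscale (linear_ZE (ls _)) dapplZ.
Qed.

End PolyCoalgebra.

(** * Manifolds *)

Section SmoothMaps.
Context (R : realType).
Implicit Types M N P : mdata R.

(** Separated from [is_manifold] because [submfd] has this property before it is known to be a
    manifold. *)
Definition charts_inj M := forall c (x y : M), atlas c -> cdom c x -> cdom c y ->
  cmap c x = cmap c y -> x = y.

Lemma smooth_fun_pt M (U : set M) g :
  (forall x, U x -> exists2 V, V x & smooth_fun V g) -> smooth_fun U g.
Proof. by move=> Ug x c Ux; have [V Vx Vg] := Ug _ Ux; exact: Vg. Qed.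

Lemma smooth_fun_ext M (U : set M) f g : charts_inj M -> mopen U ->
  (forall x, U x -> f x = g x) -> smooth_fun U f -> smooth_fun U g.
Proof.
move=> iM oU fg sf x c Ux ac cx; have [ O [G [oO Ox CG GE]]] := sf _ _ Ux ac cx.
have oI : open (O `&` cmap c @` (cdom c `&` U)) by apply: openI => //; exact: oU.
exists (O `&` cmap c @` (cdom c `&` U)), G; split=> //.
- by split=> //; exists x.
- by apply: Cinf_sub CG => z [].
- move=> y cy [ Oy [y' [cy' Uy'] e]].
  by have yy := iM _ _ _ ac cy' cy e; subst y'; rewrite -fg // GE.
Qed.

Lemma smooth_map_pt M N (U : set M) (f : M -> N) :
  (forall x, U x -> exists2 V, V x & smooth_map V f) -> smooth_map U f.
Proof. by move=> Uf x c Ux; have [V Vx Vf] := Uf _ Ux; exact: Vf. Qed.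

Lemma smooth_map_sub M N (U V : set M) (f : M -> N) :
  V `<=` U -> smooth_map U f -> smooth_map V f.
Proof. by move=> VU sf x c /VU; exact: sf. Qed.

Lemma smooth_map_ext M N (U : set M) (f g : M -> N) : is_manifold M -> mopen U ->
  (forall x, U x -> f x = g x) -> smooth_map U f -> smooth_map U g.
Proof.
move=> mM oU fg sf x c Ux ac; rewrite -fg // => cx.
have [V [oV Vx Vc sV]] := sf _ _ Ux ac cx.
have oVU : mopen (V `&` U) by exact: mopenI.
exists (V `&` U); split=> // [y [Vy Uy]|j]; first by rewrite -fg //; exact: Vc.
apply: (smooth_fun_ext (f := fun y => cmap c (f y) 0 j)) => //.
- exact: mfd_inj.
- by move=> y [_ Uy]; rewrite fg.
- by apply: smooth_fun_sub (sV j) => y [].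
Qed.

(** [smooth_fun] yields a representative near each point, while [mfd_trans] asks for one on the
    whole overlap. Injectivity of the chart makes the transported function well defined, and it
    coincides locally with the given representatives. *)
Lemma smooth_fun_glue M (W : set M) g c : charts_inj M -> smooth_fun W g -> atlas c ->
  open (cmap c @` (cdom c `&` W)) ->
  exists2 G, Cinf (cmap c @` (cdom c `&` W)) G &
    forall y, cdom c y -> W y -> g y = G (cmap c y).
Proof.
move=> iM sg ac oO.
pose G z : R := xget 0 [set a | exists y, [/\ cdom c y, W y, cmap c y = z & g y = a]].
have GE y : cdom c y -> W y -> g y = G (cmap c y).
  move=> cy Wy; rewrite /G; case: xgetP => [a _ [y' [cy' _ e <-]]|/(_ (g y))].
    by rewrite (iM _ _ _ ac cy' cy e).
  by case; exists y.
exists G => // k; apply: Ck_local => _ [y [cy Wy] <-].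
have [ O [H [oO' Oy CH HE]]] := sg _ _ Wy ac cy.
have oI : open (O `&` cmap c @` (cdom c `&` W)) by exact: openI.
exists (O `&` cmap c @` (cdom c `&` W)); first by split=> //; exists y.
apply: (Ck_ext oI) (Ck_sub _ (CH k)) => z [] // Oz [y' [cy' Wy'] e].
by subst z; rewrite -HE // GE.
Qed.

Lemma mopen_bigI M n (V : 'I_n -> set M) : is_manifold M ->
  (forall j, mopen (V j)) -> mopen [set x | forall j, V j x].
Proof.
move=> mM; elim: n V => [|n IH] V oV.
  rewrite (_ : mkset _ = setT); first exact: mopenT.
  by apply/seteqP; split=> // x _ [].
rewrite (_ : mkset _ = V ord0 `&` [set x | forall j, V (lift ord0 j) x]).
  by apply: mopenI => //; exact: IH.
apply/seteqP; split=> [x Vx|x [V0 Vx] j]; first by split=> [|j]; exact: Vx.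
by case: (unliftP ord0 j) => [k|] ->.
Qed.

Lemma smooth_chart M c j : is_manifold M -> atlas c ->
  @smooth_fun R M (cdom c) (fun y => cmap c y 0 j).
Proof.
move=> mM ac y c' cy ac' c'y; have [oO /(_ j)[G CG GE]] := mfd_trans mM ac' ac.
exists (cmap c' @` (cdom c' `&` cdom c)), G; split=> //; first by exists y.
move=> z c'z [w [c'w cw] e].
by have ww := mfd_inj mM ac' c'w c'z e; subst w; exact: GE.
Qed.

Lemma smooth_funV M (U : set M) f : is_manifold M -> mopen U ->
  (forall x, U x -> f x != 0) -> smooth_fun U f -> smooth_fun U (fun x => (f x)^-1).
Proof.
move=> mM oU f0 sf x c Ux ac cx; have [ O [G [oO Ox CG GE]]] := sf _ _ Ux ac cx.
have oI : open (O `&` cmap c @` (cdom c `&` U)) by apply: openI => //; exact: oU.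
exists (O `&` cmap c @` (cdom c `&` U)), (fun z => (G z)^-1); split=> //.
- by split=> //; exists x.
- move=> k; apply: CkV => // [z [ Oz [y [cy Uy] e]]|]; first by subst z; rewrite -GE ?f0.
  by apply: Ck_sub (CG k) => z [].
- by move=> y cy [ Oy _]; rewrite GE.
Qed.

Lemma smooth_fun_prod M (U : set M) I (r : seq I) (f : I -> M -> R) :
  (forall i, smooth_fun U (f i)) -> smooth_fun U (fun x => \prod_(i <- r) f i x).
Proof.
move=> sf; elim: r => [|i r IH].
  by under eq_fun do rewrite big_nil; exact: smooth_fun_cst.
by under eq_fun do rewrite big_cons; exact: smooth_funM.
Qed.

Lemma smooth_fun_bigsum M (U : set M) I (r : seq I) (f : I -> M -> R) :
  (forall i, smooth_fun U (f i)) -> smooth_fun U (fun x => \sum_(i <- r) f i x).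
Proof.
move=> sf; elim: r => [|i r IH].
  by under eq_fun do rewrite big_nil; exact: smooth_fun_cst.
by under eq_fun do rewrite big_cons; exact: smooth_funD.
Qed.

Lemma smooth_fun_det M (U : set M) n (a : M -> 'M[R]_n) :
  (forall i j, smooth_fun U (fun x => a x i j)) -> smooth_fun U (fun x => \det (a x)).
Proof.
move=> sa; apply: smooth_fun_bigsum => s; apply: smooth_funM; first exact: smooth_fun_cst.
by apply: smooth_fun_prod => i; exact: sa.
Qed.

(** Cramer's rule expresses the entries by determinants and one division. *)
Lemma smooth_fun_invmx M (U : set M) n (a : M -> 'M[R]_n) i j : is_manifold M -> mopen U ->
  (forall i j, smooth_fun U (fun x => a x i j)) -> (forall x, U x -> a x \in unitmx) ->
  smooth_fun U (fun x => invmx (a x) i j).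
Proof.
move=> mM oU sa ua.
apply: (smooth_fun_ext (f := fun x => (\det (a x))^-1 * \adj (a x) i j)) => //.
- exact: mfd_inj.
- by move=> x Ux; rewrite /invmx ua // !mxE.
apply: smooth_funM.
  by apply: smooth_funV => // [x /ua|]; [rewrite unitmxE unitfE|exact: smooth_fun_det].
under eq_fun do rewrite mxE; apply: smooth_funM; first exact: smooth_fun_cst.
by apply: smooth_fun_det => k l; under eq_fun do rewrite !mxE; exact: sa.
Qed.

End SmoothMaps.

(** * Products of manifolds and Euclidean spaces *)

Section Products.
Context (R : realType).
Implicit Types M N P : mdata R.

Lemma Cinf_lsubmx m n (U : set 'rV[R]_(m + n)) j : Cinf U (fun z : 'rV[R]_(m + n) => lsubmx z 0 j).
Proof. by under eq_fun do rewrite mxE; exact: Cinf_coord. Qed.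

Lemma Cinf_rsubmx m n (U : set 'rV[R]_(m + n)) j : Cinf U (fun z : 'rV[R]_(m + n) => rsubmx z 0 j).
Proof. by under eq_fun do rewrite mxE; exact: Cinf_coord. Qed.

Lemma open_row_mx m n (O : set 'rV[R]_m) (O' : set 'rV[R]_n) : open O -> open O' ->
  open [set z : 'rV[R]_(m + n) | O (lsubmx z) /\ O' (rsubmx z)].
Proof.
move=> oO oO'; have := openI
  (Cinf_open_preimage openT (@Cinf_lsubmx m n setT) oO)
  (Cinf_open_preimage openT (@Cinf_rsubmx m n setT) oO').
by congr open; apply/seteqP; split=> z [] => [[_ ?] [_ ?]|].
Qed.

Lemma image_row_mx M N c c' (U : set M) (V : set N) :
  (fun p : M * N => row_mx (@cmap R M c p.1) (@cmap R N c' p.2)) @`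
    ((cdom c `*` cdom c') `&` (U `*` V)) =
  [set z | (cmap c @` (cdom c `&` U)) (lsubmx z) /\ (cmap c' @` (cdom c' `&` V)) (rsubmx z)].
Proof.
apply/seteqP; split=> [_ [[x y] /= [[cx cy] [Ux Vy]] <-]|z /= [[x [cx Ux] ex] [y [cy Vy] ey]]].
  by rewrite row_mxKl row_mxKr; split; [exists x|exists y].
by exists (x, y) => //=; rewrite ex ey hsubmxK.
Qed.

Lemma mopen_chart_preimage M c O : is_manifold M -> atlas c -> open O ->
  @mopen R M (cdom c `&` cmap c @^-1` O).
Proof.
move=> mM ac oO c' ac'; have [oO' tr] := mfd_trans mM ac' ac.
have /choice[G GP] j : exists G, Cinf (cmap c' @` (cdom c' `&` cdom c)) G /\
    forall x, cdom c' x -> cdom c x -> cmap c x 0 j = G (cmap c' x).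
  by have [G] := tr j; exists G.
pose H z : 'rV[R]_(cdim c) := \row_j G j z.
have HE x : cdom c' x -> cdom c x -> H (cmap c' x) = cmap c x.
  by move=> c'x cx; apply/rowP => j; rewrite mxE -(GP j).2.
have : open (cmap c' @` (cdom c' `&` cdom c) `&` H @^-1` O).
  apply: Cinf_open_preimage => // j; under eq_fun do rewrite mxE; exact: (GP j).1.
congr open; apply/seteqP; split=> [z [[x [c'x cx] <-]]|_ [x [c'x [cx Ox]] <-]].
  by rewrite /preimage /= HE // => Ox; exists x.
by split; [exists x|rewrite /preimage /= HE].
Qed.

Lemma mopenX M N (U : set M) (V : set N) : mopen U -> mopen V ->
  @mopen R (prodm M N) (U `*` V).
Proof.
move=> oU oV _ [c [c' [ac ac' ->]]] /=; rewrite image_row_mx.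
by apply: open_row_mx; [exact: oU|exact: oV].
Qed.

Lemma smooth_fun_fst M N (W : set M) g : smooth_fun W g ->
  @smooth_fun R (prodm M N) (W `*` setT) (fun p => g p.1).
Proof.
move=> sg [x y] _ /= [Wx _] [c [c' [ac ac' ->]]] [/= cx cy].
have [ O [G [oO Ox CG GE]]] := sg _ _ Wx ac cx.
exists [set z | O (lsubmx z) /\ setT (rsubmx z)], (fun z => G (lsubmx z)); split.
- exact: open_row_mx oO openT.
- by rewrite /= row_mxKl.
- apply: Cinf_comp CG; [exact: open_row_mx oO openT|exact: Cinf_lsubmx|].
  by move=> z [].
- by move=> [x' y'] /= [cx' _]; rewrite row_mxKl => -[+ _] => /GE ->.
Qed.

Lemma smooth_fun_snd M N (W : set N) g : smooth_fun W g ->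
  @smooth_fun R (prodm M N) (setT `*` W) (fun p => g p.2).
Proof.
move=> sg [x y] _ /= [_ Wy] [c [c' [ac ac' ->]]] [/= cx cy].
have [ O [G [oO Oy CG GE]]] := sg _ _ Wy ac' cy.
exists [set z | setT (lsubmx z) /\ O (rsubmx z)], (fun z => G (rsubmx z)); split.
- exact: open_row_mx openT oO.
- by rewrite /= row_mxKr.
- apply: Cinf_comp CG; [exact: open_row_mx openT oO|exact: Cinf_rsubmx|].
  by move=> z [].
- by move=> [x' y'] /= [_ cy']; rewrite row_mxKr => -[_] => /GE ->.
Qed.

Lemma smooth_map_fst M N : is_manifold M -> is_manifold N ->
  @smooth_map R (prodm M N) M setT fst.
Proof.
move=> mM mN p c _ ac cp; exists (cdom c `*` setT); split=> //.
- by apply: mopenX; [exact: mopen_cdom|exact: mopenT].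
- by move=> q [].
- by move=> j; apply: (smooth_fun_fst (g := fun y => cmap c y 0 j)); exact: smooth_chart.
Qed.

Lemma smooth_map_snd M N : is_manifold M -> is_manifold N ->
  @smooth_map R (prodm M N) N setT snd.
Proof.
move=> mM mN p c _ ac cp; exists (setT `*` cdom c); split=> //.
- by apply: mopenX; [exact: mopenT|exact: mopen_cdom].
- by move=> q [].
- by move=> j; apply: (smooth_fun_snd (g := fun y => cmap c y 0 j)); exact: smooth_chart.
Qed.

Lemma smooth_map_pair M N P (U : set P) (f : P -> M) (g : P -> N) : is_manifold P ->
  smooth_map U f -> smooth_map U g ->
  @smooth_map R P (prodm M N) U (fun x => (f x, g x)).
Proof.
move=> mP sf sg x _ Ux [c [c' [ac ac' ->]]] [/= cx cx'].
have [V [oV Vx Vc sV]] := sf _ _ Ux ac cx.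
have [V' [oV' Vx' Vc' sV']] := sg _ _ Ux ac' cx'.
exists (V `&` V'); split=> //; first exact: mopenI.
  by move=> y [Vy Vy']; split; [exact: Vc|exact: Vc'].
move=> j; rewrite -(fintype.splitK j); case: (fintype.split j) => k /=.
  under eq_fun do rewrite row_mxEl.
  by apply: smooth_fun_sub (sV k) => y [].
under eq_fun do rewrite row_mxEr.
by apply: smooth_fun_sub (sV' k) => y [].
Qed.

(** Balls of row vectors are taken entrywise, so a ball around a concatenated vector is the product
    of two balls of the same radius. *)
Lemma mopen_box M N (W : set (M * N)) x y : is_manifold M -> is_manifold N ->
  @mopen R (prodm M N) W -> W (x, y) ->
  exists V V', [/\ @mopen R M V, @mopen R N V', V x, V' y & V `*` V' `<=` W].
Proof.
move=> mM mN oW Wxy; have [c ac cx] := mfd_cover mM x; have [c' ac' cy] := mfd_cover mN y.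
have aP : @atlas R (prodm M N) (Chart (cdom c `*` cdom c')
  (fun p => row_mx (cmap c p.1) (cmap c' p.2))) by exists c, c'; split.
have /nbhs_ballP[e /= e0 eW] : nbhs (row_mx (cmap c x) (cmap c' y))
    ((fun p : M * N => row_mx (cmap c p.1) (cmap c' p.2)) @` ((cdom c `*` cdom c') `&` W)).
  by apply: open_nbhs_nbhs; split; [exact: oW aP|exists (x, y)].
exists (cdom c `&` cmap c @^-1` ball (cmap c x) e), (cdom c' `&` cmap c' @^-1` ball (cmap c' y) e).
split.
- exact: mopen_chart_preimage (ball_open (cmap c x) e).
- exact: mopen_chart_preimage (ball_open (cmap c' y) e).
- by split=> //; exact: ballxx.
- by split=> //; exact: ballxx.
move=> [x' y'] [/= [cx' bx'] [cy' by']].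
have [|[x2 y2] [[/= cx2 cy2] W2] /eq_row_mx[ex ey]] := eW (row_mx (cmap c x') (cmap c' y')).
  split=> // i j; rewrite -(fintype.splitK j); case: (fintype.split j) => h.
    by rewrite !row_mxEl; exact: bx'.2.
  by rewrite !row_mxEr; exact: by'.2.
by rewrite -(mfd_inj mM ac cx2 cx' ex) -(mfd_inj mN ac' cy2 cy' ey).
Qed.

Lemma prodm_manifold M N : is_manifold M -> is_manifold N -> is_manifold (prodm M N).
Proof.
move=> mM mN; split.
- have [[m dm] [n dn]] := (mfd_dim mM, mfd_dim mN); exists (m + n)%N.
  by move=> _ [x y] [c [c' [ac ac' ->]]] [/= cx cy]; rewrite (dm _ _ ac cx) (dn _ _ ac' cy).
- move=> [x y]; have [c ac cx] := mfd_cover mM x; have [c' ac' cy] := mfd_cover mN y.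
  eexists; first by exists c, c'; split.
  by [].
- move=> _ [x y] [x' y'] [c [c' [ac ac' ->]]] [/= cx cy] [/= cx' cy'] /eq_row_mx[ex ey].
  by rewrite (mfd_inj mM ac cx cx' ex) (mfd_inj mN ac' cy cy' ey).
- move=> _ _ [c [c' [ac ac' ->]]] [d [d' [ad ad' ->]]] /=; rewrite image_row_mx.
  have [oO tr] := mfd_trans mM ac ad; have [oO' tr'] := mfd_trans mN ac' ad'.
  have oZ := open_row_mx oO oO'; split=> // j.
  rewrite -(fintype.splitK j); case: (fintype.split j) => k /=.
    have [G CG GE] := tr k; exists (G \o lsubmx).
      by apply: Cinf_comp CG => //; [exact: Cinf_lsubmx|move=> z []].
    move=> [x y] /= [cx cy] [dx dy].
    by rewrite row_mxEl row_mxKl GE.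
  have [G CG GE] := tr' k; exists (G \o rsubmx).
    by apply: Cinf_comp CG => //; [exact: Cinf_rsubmx|move=> z []].
  move=> [x y] /= [cx cy] [dx dy].
  by rewrite row_mxEr row_mxKr GE.
- move=> [x y] [x' y'] xy; have [ex|nx] := pselect (x = x').
    have ny : y <> y' by move=> ey; apply: xy; rewrite ex ey.
    have [U [V [oU oV Uy Vy UV]]] := mfd_hausdorff mN ny.
    exists (setT `*` U), (setT `*` V); split=> //.
    - exact: mopenX (mopenT mM) oU.
    - exact: mopenX (mopenT mM) oV.
    - apply/seteqP; split=> // -[a b] [[_ Ub] [_ Vb]].
      by have : set0 b by rewrite -UV.
  have [U [V [oU oV Ux Vx UV]]] := mfd_hausdorff mM nx.
  exists (U `*` setT), (V `*` setT); split=> //.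
  - exact: mopenX oU (mopenT mN).
  - exact: mopenX oV (mopenT mN).
  - apply/seteqP; split=> // -[a b] [[Ua _] [Va _]].
    by have : set0 a by rewrite -UV.
- have [B [oB BP]] := mfd_countable mM; have [B' [oB' BP']] := mfd_countable mN.
  pose B2 k := if unpickle k is Some (i, j) then B i `*` B' j else set0.
  exists B2; split=> [k|W [x y] oW Wxy].
    rewrite /B2; case: unpickle => [[i j]|]; first exact: mopenX.
    by move=> c _; rewrite setI0 image_set0; exact: open0.
  have [V [V' [oV oV' Vx V'y VW]]] := mopen_box mM mN oW Wxy.
  have [k [Bx kV]] := BP _ x oV Vx; have [l [By lV]] := BP' _ y oV' V'y.
  exists (pickle (k, l)); rewrite /B2 pickleK; split=> // -[x' y'] [/= /kV Vx' /lV V'y'].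
  exact: VW.
Qed.

Lemma rV_countable_base n : exists B : nat -> set 'rV[R]_n, (forall k, open (B k)) /\
  forall W x, open W -> W x -> exists k, B k x /\ B k `<=` W.
Proof.
pose B k := if unpickle k is Some (q, j) then
  ball (map_mx ratr (q : 'rV[rat]_n) : 'rV[R]_n) (j.+1%:R^-1) else set0.
exists B; split=> [k|W x oW Wx].
  by rewrite /B; case: unpickle => [[q j]|]; [exact: ball_open|exact: open0].
have /nbhs_ballP[e /= e0 eW] : nbhs x W by exact: open_nbhs_nbhs.
have e20 : 0 < e / 2 by rewrite divr_gt0.
(* Chosen so that r = 1/(j+1) < e/2: a ball of radius r that contains x then lies in the ball of
   radius e around x. *)
pose j := Num.truncn (e / 2)^-1; pose r : R := j.+1%:R^-1.
have r0 : 0 < r by rewrite invr_gt0 ltr0n.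
have re : r < e / 2.
  rewrite -[ltRHS]invrK ltf_pV2 ?posrE ?invr_gt0 ?ltr0n //.
  by rewrite truncnS_gt.
have /choice[q qP] : forall k, exists q, `|ratr q - x 0 k| < r.
  move=> k; have [|q] := @rat_in_itvoo R (x 0 k - r) (x 0 k + r).
    by rewrite ltrBlDr -addrA ltrDl addr_gt0.
  rewrite in_itv /= => qk; exists q.
  by rewrite ltr_distl.
exists (pickle ((\row_k q k : 'rV[rat]_n), j)); rewrite /B pickleK.
have xq : ball (map_mx ratr (\row_k q k) : 'rV[R]_n) r x.
  by split=> // i k; rewrite !mxE (ord1 i); exact: qP.
split=> // y qy; apply: eW; rewrite (splitr e).
apply: (ball_triangle (y := (map_mx ratr (\row_k q k) : 'rV[R]_n))).
  by apply: ball_sym; exact: le_ball (ltW re) _ xq.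
exact: le_ball (ltW re) _ qy.
Qed.

Section GlobalChart.
Context (T : Type) (n : nat) (f : T -> 'rV[R]_n).
Hypothesis fI : injective f.
Hypothesis fO : open (range f).

Let M : mdata R := MData [set Chart setT f].

Let mopenE (W : set M) : mopen W <-> open (f @` W).
Proof. by split=> [/(_ _ erefl)|oW _ ->] /=; rewrite setTI. Qed.

Let preimageE (U : set 'rV[R]_n) : f @` (f @^-1` U) = range f `&` U.
Proof.
apply/seteqP; split=> [_ [x Ux <-]|_ [[x _ <-] Ux]]; last by exists x.
by split=> //; exists x.
Qed.

Let mopen_preim (U : set 'rV[R]_n) : open U -> @mopen R M (f @^-1` U).
Proof. by move=> oU; apply/mopenE; rewrite preimageE; exact: openI. Qed.

Lemma global_chart_manifold : is_manifold M.
Proof.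
split.
- by exists n => c x ->.
- by move=> x; exists (Chart setT f).
- by move=> c x y -> _ _ /= /fI.
- move=> c c' -> -> /=; rewrite setTI; split=> // j; exists (fun z => z 0 j) => //.
  exact: Cinf_coord.
- move=> x y xy; have fxy : f x != f y by apply/eqP => /fI.
  have := @norm_hausdorff R 'rV[R]_n; rewrite open_hausdorff => /(_ _ _ fxy).
  move=> [[U V] /= [/set_mem Ux /set_mem Vy] [oU oV UV]].
  exists (f @^-1` U), (f @^-1` V); split=> //; try exact: mopen_preim.
  by apply/seteqP; split=> // z [Uz Vz]; have : set0 (f z) by rewrite -(eqP UV).
- have [B [oB BP]] := rV_countable_base n.
  exists (fun k => f @^-1` B k); split=> [k|W x /mopenE oW Wx]; first exact: mopen_preim.
  have [|k [Bx BW]] := BP _ (f x) oW; first by exists x.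
  by exists k; split=> // y /BW[y' Wy' /fI <-].
Qed.

End GlobalChart.

Lemma euclid_manifold n : is_manifold (euclid R n).
Proof.
apply: global_chart_manifold => //.
by rewrite image_id; exact: openT.
Qed.

Lemma realm_manifold : is_manifold (realm R).
Proof.
apply: global_chart_manifold => [x y /rowP/(_ 0)|]; first by rewrite !mxE.
rewrite (_ : range _ = setT); first exact: openT.
apply/seteqP; split=> // v _; exists (v 0 0) => //.
by apply/rowP => j; rewrite mxE (ord1 j).
Qed.

Lemma mopen_euclid n (W : set 'rV[R]_n) : @mopen R (euclid R n) W <-> open W.
Proof. by split=> [/(_ _ erefl)|oW _ ->] /=; rewrite setTI image_id. Qed.

Lemma smooth_fun_euclid n (U : set 'rV[R]_n) g : open U ->
  @smooth_fun R (euclid R n) U g <-> Cinf U g.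
Proof.
move=> oU; split=> [sg k|Cg x _ Ux -> _]; last by exists U, g.
apply: Ck_local => x Ux; have [ O [G [oO Ox CG GE]]] := sg x _ Ux erefl I.
by exists O => //; apply: (Ck_ext oO) (CG k) => y Oy; rewrite GE.
Qed.

Lemma smooth_map_euclid M n (U : set M) (f : M -> 'rV[R]_n) : mopen U ->
  @smooth_map R M (euclid R n) U f <-> forall j, smooth_fun U (fun x => f x 0 j).
Proof.
move=> oU; split=> [sf j x|sf x _ Ux -> _]; last by exists U.
move=> c Ux ac cx; have [V [oV Vx _ sV]] := sf x _ Ux erefl I.
exact: sV.
Qed.

Lemma smooth_map_realm M (U : set M) (f : M -> R) : mopen U ->
  @smooth_map R M (realm R) U f <-> smooth_fun U f.
Proof.
move=> oU; split=> [sf x c Ux ac cx|sf x _ Ux -> _].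
  have [V [oV Vx _ sV]] := sf x _ Ux erefl I.
  by have := sV 0; under eq_fun do rewrite /= mxE; exact.
by exists U; split=> // j; under eq_fun do rewrite /= mxE.
Qed.

Lemma smooth_map_cst M N (U : set M) (y : N) : is_manifold M -> smooth_map U (fun=> y : N).
Proof.
move=> mM x c Ux ac cy; exists setT; split=> //; first exact: mopenT.
by move=> j; exact: smooth_fun_cst.
Qed.

End Products.

(** * Submanifolds: inverse charts and the induced topology *)

Section Submanifolds.
Context (R : realType).
Context (F : mdata R) (mF : is_manifold F) (S : set F).
Implicit Types (s : {x | S x}) (c : chart R {x | S x}).
Local Notation SF := (submfd S).

Lemma submfd_inj : charts_inj SF.
Proof. by move=> c s s' [_ _ cI _ _]; exact: cI. Qed.

(** The inverse of the chart [c], with default value [s0] off its image. *)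
Definition cinv c s0 (z : 'rV[R]_(cdim c)) : {x | S x} :=
  if pselect (exists s, cdom c s /\ cmap c s = z) is left ex then sval (boolp.cid ex) else s0.

Lemma cinvK c s0 s : @atlas R SF c -> cdom c s -> @cinv c s0 (cmap c s) = s.
Proof.
move=> ac cs; rewrite /cinv; case: pselect => [ex|[]]; last by exists s.
by case: (boolp.cid ex) => s' /= [cs' e]; exact: submfd_inj ac cs' cs e.
Qed.

(** This is the last clause of [submfd], smoothness of the inclusion for the one-chart atlas of [c],
    read on the chart image. *)
Lemma smooth_cinv c s0 : @atlas R SF c ->
  @smooth_map R (euclid R (cdim c)) F (cmap c @` cdom c) (fun z => sval (cinv s0 z)).
Proof.
move=> ac; have [_ _ _ _ sv] := ac.
move=> _ C [s cs <-] aC; rewrite cinvK // => Cs.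
have [V [oV Vs VC sV]] := sv s C cs aC Cs.
pose O := cmap c @` (cdom c `&` V); have oO : open O by exact: oV.
exists O; split=> [||_ [s' [cs' Vs'] <-]|j]; first exact/mopen_euclid.
- by exists s.
- by rewrite cinvK //; exact: VC.
- move=> _ _ [s' [cs' Vs'] <-] -> _.
  have [ O' [G [oO' Os CG GE]]] := sV j s' c Vs' erefl cs'.
  exists (O `&` O'), G; split=> //; first exact: openI.
  - by split=> //; exists s'.
  - by apply: Cinf_sub CG => z [].
  - by move=> y _ /= [[s'' [cs'' Vs''] <-] Os'']; rewrite cinvK // GE.
Qed.

Lemma mopen_sval (W : set F) : mopen W -> @mopen R SF [set s | W (sval s)].
Proof.
move=> oW c ac; rewrite openE => z0 [s [cs Ws] e]; subst z0.
have [_ oO _ _ _] := ac.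
have oOm : @mopen R (euclid R (cdim c)) (cmap c @` cdom c) by exact/mopen_euclid.
have /mopen_euclid oI := mopen_preimage (euclid_manifold R _) mF (@smooth_cinv c s ac) oOm oW.
apply: filterS (open_nbhs_nbhs (conj oI _)) => [_ [[s' cs' <-]]|].
  by rewrite /preimage /= cinvK //; exists s'.
by split; [exists s|rewrite /preimage /= cinvK].
Qed.

Lemma smooth_fun_sval (W : set F) g : smooth_fun W g ->
  @smooth_fun R SF [set s | W (sval s)] (fun s => g (sval s)).
Proof.
move=> sg s c Ws ac cs; have [_ oO _ _ _] := ac.
have oOm : @mopen R (euclid R (cdim c)) (cmap c @` cdom c) by exact/mopen_euclid.
have := smooth_fun_comp (euclid_manifold R _) mF (@smooth_cinv c s ac) oOm sg.
move=> /(_ (cmap c s) _ _ erefl I)[|O [G [oO' Os CG GE]]].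
  by split; [exists s|rewrite /preimage /= cinvK].
exists O, G; split=> // s' cs' Os'.
by have /= := GE (cmap c s') I Os'; rewrite cinvK.
Qed.

Lemma smooth_map_sval : @smooth_map R SF F setT sval.
Proof.
move=> s C _ aC Cs; exists [set s | cdom C (sval s)]; split=> //.
  by apply: mopen_sval; exact: mopen_cdom.
by move=> j; apply: (smooth_fun_sval (g := fun y => cmap C y 0 j)); exact: smooth_chart.
Qed.

Lemma smooth_subfun_fun D g : @smooth_subfun R F S D g -> @smooth_fun R SF D g.
Proof.
move=> sg; apply: smooth_fun_pt => s Ds; have [V [h [oV Vs sh gE]]] := sg s Ds.
exists [set s | V (sval s)] => //.
apply: (smooth_fun_ext submfd_inj (mopen_sval oV)) (smooth_fun_sval sh) => s' Vs'.
by rewrite gE.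
Qed.

(** Converse of [mopen_sval]: the chart topology is the subspace topology. Near [s] the coordinates
    of [c] extend to smooth functions on [F], and V is cut out by pulling the chart image of W back
    along them. *)
Lemma mopen_submfdE c s (W : set {x | S x}) : @atlas R SF c -> cdom c s ->
  @mopen R SF W -> W s ->
  exists V, [/\ mopen V, V (sval s) & forall s', V (sval s') -> W s'].
Proof.
move=> ac cs oW Ws; have [[Vc oVc cE] _ cI sc _] := ac.
have /choice[Vh VhP] j : exists Vh : set F * (F -> R), [/\ mopen Vh.1, Vh.1 (sval s),
    smooth_fun Vh.1 Vh.2 & forall s', Vh.1 (sval s') -> cmap c s' 0 j = Vh.2 (sval s')].
  by have [V [h P]] := sc j s cs; exists (V, h).
pose V1 := [set x | forall j, (Vh j).1 x].
have oV1 : mopen V1 by apply: mopen_bigI => // j; have [] := VhP j.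
pose h x : 'rV[R]_(cdim c) := \row_j (Vh j).2 x.
have sh : @smooth_map R F (euclid R (cdim c)) V1 h.
  apply/smooth_map_euclid => // j; under eq_fun do rewrite mxE.
  by have [_ _ + _] := VhP j; apply: smooth_fun_sub => x; exact.
have hE s' : V1 (sval s') -> h (sval s') = cmap c s'.
  by move=> V1s; apply/rowP => j; rewrite mxE; have [_ _ _ ->] := VhP j; rewrite ?V1s.
have V1s : V1 (sval s) by move=> j; have [] := VhP j.
have oO : @mopen R (euclid R (cdim c)) (cmap c @` (cdom c `&` W)).
  by apply/mopen_euclid; exact: oW.
have oI := mopen_preimage mF (euclid_manifold R _) sh oV1 oO.
exists (Vc `&` (V1 `&` h @^-1` (cmap c @` (cdom c `&` W)))); split.
- exact: mopenI.
- split; first by move: cs; rewrite cE.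
  by split=> //; rewrite /preimage /= hE //; exists s.
- move=> s' [Vs' [V1s' [s'' [cs'' Ws''] e]]]; rewrite hE // in e.
  have cs' : cdom c s' by rewrite cE.
  by rewrite -(cI _ _ cs'' cs' e).
Qed.

End Submanifolds.

(** * Invariance of dimension *)

Section Dimension.
Context (R : realType).

(** By the chain rule the Jacobians satisfy A B = 1 with 1 of size m, and such a factorisation
    through R^n forces m <= n. *)
Lemma Cinf_dim_leq m n (O : set 'rV[R]_m) (O' : set 'rV[R]_n)
    (h : 'rV[R]_m -> 'rV[R]_n) (k : 'rV[R]_n -> 'rV[R]_m) z : open O -> O z -> O' (h z) ->
  (forall j, Cinf O (fun x => h x 0 j)) -> (forall j, Cinf O' (fun x => k x 0 j)) ->
  (forall x, O x -> k (h x) = x) -> (m <= n)%N.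
Proof.
move=> oO Oz Oz' Ch Ck' kh.
pose A : 'M[R]_(m, n) := \matrix_(i, l) 'D_(delta_mx 0 i) (fun x => h x 0 l) z.
pose B : 'M[R]_(n, m) := \matrix_(l, j) 'D_(delta_mx 0 l) (fun x => k x 0 j) (h z).
apply: (@mulmx1_min _ m n A B); apply/matrixP => i j; rewrite !mxE.
under eq_bigr do rewrite !mxE.
rewrite -(derive_comp_rV (g := fun x => k x 0 j)); first last.
- exact: Cinf_differentiable (Ck' j) Oz'.
- by move=> l; exact: Cinf_differentiable (Ch l) Oz.
have e : {near z, (fun x => k x 0 j) \o h =1 (fun x : 'rV[R]_m => x 0 j)}.
  by apply: filterS (open_nbhs_nbhs (conj oO Oz)) => x Ox /=; rewrite kh.
by rewrite (near_eq_derive _ e) derive_coord mxE eqxx eq_sym.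
Qed.

End Dimension.

(** * Submanifolds as manifolds *)

Section SubmfdManifold.
Context (R : realType).
Context (F : mdata R) (mF : is_manifold F) (S : set F).
Local Notation SF := (submfd S).

Lemma submfd_trans c c' : @atlas R SF c -> @atlas R SF c' ->
  open (cmap c @` (cdom c `&` cdom c')) /\
  forall j, exists2 G, Cinf (cmap c @` (cdom c `&` cdom c')) G &
    forall x, cdom c x -> cdom c' x -> cmap c' x 0 j = G (cmap c x).
Proof.
move=> ac ac'; have [[V oV cE] _ _ sc _] := ac'.
have oO : open (cmap c @` (cdom c `&` cdom c')).
  by rewrite cE; exact: (mopen_sval mF oV) ac.
split=> // j; have sj := smooth_subfun_fun mF (sc j).
have [G CG GE] := smooth_fun_glue (@submfd_inj _ _ S) sj ac oO.
by exists G => // x cx c'x; exact: GE.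
Qed.

Lemma submfd_cdim_leq c c' s : @atlas R SF c -> @atlas R SF c' -> cdom c s -> cdom c' s ->
  (cdim c <= cdim c')%N.
Proof.
move=> ac ac' cs cs'; have [oO tr] := submfd_trans ac ac'.
have [oO' tr'] := submfd_trans ac' ac.
have /choice[h hP] j : exists G, Cinf (cmap c @` (cdom c `&` cdom c')) G /\
    forall x, cdom c x -> cdom c' x -> cmap c' x 0 j = G (cmap c x).
  by have [G] := tr j; exists G.
have /choice[k kP] j : exists G, Cinf (cmap c' @` (cdom c' `&` cdom c)) G /\
    forall x, cdom c' x -> cdom c x -> cmap c x 0 j = G (cmap c' x).
  by have [G] := tr' j; exists G.
have hE x : cdom c x -> cdom c' x -> \row_j h j (cmap c x) = cmap c' x.
  by move=> cx cx'; apply/rowP => j; rewrite mxE -(hP j).2.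
have kE x : cdom c x -> cdom c' x -> \row_j k j (cmap c' x) = cmap c x.
  by move=> cx cx'; apply/rowP => j; rewrite mxE -(kP j).2.
apply: (@Cinf_dim_leq _ _ _ _ (cmap c' @` (cdom c' `&` cdom c))
  (fun z => \row_j h j z) (fun z => \row_j k j z) (cmap c s) oO).
- by exists s.
- by rewrite hE //; exists s.
- by move=> j; under eq_fun do rewrite mxE; exact: (hP j).1.
- by move=> j; under eq_fun do rewrite mxE; exact: (kP j).1.
- by move=> _ [x [cx cx'] <-]; rewrite hE // kE.
Qed.

(** The atlas of [submfd] contains every admissible chart, of whatever dimension. One chart of
    dimension n around each point fixes the dimension of all the others, since the dimension is
    invariant. *)
Lemma submfd_manifold n :
  (forall s : SF, exists c, [/\ @atlas R SF c, cdom c s & cdim c = n]) ->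
  is_manifold SF.
Proof.
move=> Sc; split.
- exists n => c s ac cs; have [c' [ac' cs' <-]] := Sc s.
  by apply/eqP; rewrite eqn_leq !(@submfd_cdim_leq _ _ s).
- by move=> s; have [c [ac cs _]] := Sc s; exists c.
- exact: submfd_inj.
- exact: submfd_trans.
- move=> x y xy; have vxy : sval x <> sval y by move/sval_inj.
  have [U [V [oU oV Ux Vy UV]]] := mfd_hausdorff mF vxy.
  exists [set s | U (sval s)], [set s | V (sval s)]; split=> //; try exact: mopen_sval.
  by apply/seteqP; split=> // s [Us Vs]; have : set0 (sval s) by rewrite -UV.
- have [B [oB BP]] := mfd_countable mF.
  exists (fun k => [set s | B k (sval s)]); split=> [k|W s oW Ws]; first exact: mopen_sval.
  have [c [ac cs _]] := Sc s.
  have [V [oV Vs VW]] := mopen_submfdE mF ac cs oW Ws.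
  have [k [Bs BV]] := BP _ _ oV Vs.
  by exists k; split=> // s' /BV; exact: VW.
Qed.

End SubmfdManifold.

(** * The action and the projection of a graded bundle *)

Section GradedBundleMaps.
Context (R : realType) (F : gbdata R) (mF : is_manifold F).
Hypothesis sF : smooth_map [set: prodm (realm R) F]
  ((fun p => gact p.1 p.2) : prodm (realm R) F -> F).

Lemma smooth_act t : @smooth_map R F F setT (gact t).
Proof.
have sp : @smooth_map R F (prodm (realm R) F) setT (fun y => (t, y)).
  apply: smooth_map_pair => //; [exact: smooth_map_cst|exact: smooth_map_id].
have := smooth_map_comp mF (prodm_manifold (realm_manifold R) mF) (mopenT mF) sp sF.
by rewrite preimage_setT setIT.
Qed.

(** The coordinates of the base extend locally to smooth functions on [F], which are composed with
    the smooth map [gact 0]. The section assumes the smoothness of the action instead of [is_gb],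
    because the result enters the proof that the total space built at the end is a graded bundle. *)
Lemma smooth_gproj_act : smooth_map setT (@gproj R F).
Proof.
move=> y c _ ac cy; have [[Vc oVc cE] _ _ sc _] := ac.
have oP (W : set F) : mopen W -> mopen (@gact R F 0 @^-1` W).
  by move=> oW; have := mopen_preimage mF mF (@smooth_act 0) (mopenT mF) oW; rewrite setTI.
exists (gact 0 @^-1` Vc); split.
- exact: oP.
- by move: cy; rewrite cE.
- by move=> z Vz; rewrite cE.
move=> j; apply: smooth_fun_pt => z Vz.
have cz : cdom c (gproj z) by rewrite cE.
have [V [h [oV Vz' sh hE]]] := sc j (gproj z) cz.
exists (gact 0 @^-1` V) => //.
apply: (smooth_fun_ext (f := h \o gact 0) (mfd_inj mF)) => [|x Vx|]; first exact: oP.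
  by rewrite /= hE.
by have := smooth_fun_comp mF mF (@smooth_act 0) (mopenT mF) sh; rewrite setTI.
Qed.

End GradedBundleMaps.

Section GradedBundleProjection.
Context (R : realType) (F : gbdata R) (gF : is_gb F).

Lemma smooth_gproj : smooth_map setT (@gproj R F).
Proof. exact: smooth_gproj_act (gb_mfd gF) (gb_smooth gF). Qed.

Lemma gact0_gproj (y : F) : sval (gproj y) = gact 0 y :> F.
Proof. by []. Qed.

Lemma gproj_act t (y : F) : gproj (gact t y) = gproj y.
Proof. by apply: sval_inj; rewrite /= gb_act // mul0r. Qed.

Lemma gact0_base (x : gbase F) : gact 0 (sval x) = sval x.
Proof. by case: x => _ /= [y _ <-]; rewrite gb_act // mul0r. Qed.

Lemma gproj_sval (x : gbase F) : gproj (sval x) = x.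
Proof. by apply: sval_inj; exact: gact0_base. Qed.

End GradedBundleProjection.

(** * Smooth maps of vector bundles *)

Section VectorBundleMaps.
Context (R : realType).

Lemma linear_bij_inv (V W : lmodType R) (e : V -> W) : linear e -> bijective e ->
  exists g, [/\ linear g, cancel e g & cancel g e].
Proof.
move=> le [g eK gK]; exists g; split=> // a u v.
by apply: (can_inj eK); rewrite le !gK.
Qed.

Lemma smooth_vmor_comp (M N P : mdata R) (D : set M) (D' : set N)
    (b : M -> N) (b' : N -> P) V W X A B C f g :
  is_manifold M -> is_manifold N -> mopen D -> smooth_map D b ->
  (forall x, D x -> D' (b x)) -> (forall y, D' y -> exists2 psi, B psi & tdom psi y) ->
  (forall psi, B psi -> mopen (tdom psi)) ->
  @smooth_vmor R M N D b V W A B f -> @smooth_vmor R N P D' b' W X B C g ->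
  smooth_vmor D (b := b' \o b) A C (fun x v => g (b x) (f x v)).
Proof.
move=> mM mN oD sb DD' cB oB vf vg phi chi x0 Aphi Cchi Dx0 phix0 chix0.
have [psi Bpsi psix0] := cB _ (DD' _ Dx0).
have [U1 [a1 [oU1 U1x sa1 E1]]] := vf phi psi x0 Aphi Bpsi Dx0 phix0 psix0.
have [U2 [a2 [oU2 U2x sa2 E2]]] := vg psi chi _ Bpsi Cchi (DD' _ Dx0) psix0 chix0.
have oV : mopen (tdom psi `&` U2) by apply: mopenI => //; exact: oB.
exists (U1 `&` (D `&` b @^-1` (tdom psi `&` U2))), (fun x => a1 x *m a2 (b x)); split.
- by apply: mopenI => //; exact: mopen_preimage.
- by split.
- move=> k l; under eq_fun do rewrite mxE.
  apply: smooth_fun_sum => j; apply: smooth_funM.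
    by apply: smooth_fun_sub (sa1 k j) => x [].
  apply: smooth_fun_sub (smooth_fun_comp mM mN sb oD (sa2 j l)).
  by move=> x [_ [Dx [_ ?]]]; split.
- move=> x [U1x' [_ [psix U2x']]] Dx phix chix v.
  by rewrite E1 // E2 ?mulmxA //; exact: DD'.
Qed.

(** The sizes m and n come from two trivializations and are equal only because the matrix at the
    point [x0] is bijective; afterwards the inverse matrix is smooth. *)
Lemma smooth_inverse (M : mdata R) (U : set M) m n (a : M -> 'M[R]_(m, n)) x0 :
  is_manifold M -> mopen U -> U x0 -> (forall i j, smooth_fun U (fun x => a x i j)) ->
  (forall x, U x -> bijective (fun v : 'rV[R]_m => v *m a x)) ->
  exists a' : M -> 'M[R]_(n, m), (forall i j, smooth_fun U (fun x => a' x i j)) /\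
    forall x, U x -> a x *m a' x = 1%:M /\ a' x *m a x = 1%:M.
Proof.
move=> mM oU Ux0 sa ba.
have fa x : U x -> row_free (a x).
  move=> /ba[g gK _]; apply: inj_row_free => v va.
  by rewrite -(gK v) -(gK 0) va mul0mx.
have mn : m = n.
  have /eqP <- := fa _ Ux0; apply/eqP; rewrite -/(row_full (a x0)) -sub1mx.
  apply/row_subP => i; have [g _ gK] := ba _ Ux0.
  by rewrite -(gK (row i 1%:M)) submxMl.
subst n; exists (fun x => invmx (a x)); split=> [i j|x Ux].
  by apply: smooth_fun_invmx => // x /fa; rewrite row_free_unit.
by rewrite mulmxV ?mulVmx // -row_free_unit fa.
Qed.

(** Spares a second computation: smoothness of [loc_sigma] will follow from that of its inverse
    [loc_tau]. *)
Lemma smooth_vmor_inv (M : mdata R) (D : set M) (V W : M -> lmodType R)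
    (A : set (vtriv V)) (B : set (vtriv W))
    (f : forall x, V x -> W x) (g : forall x, W x -> V x) :
  is_manifold M -> mopen D ->
  (forall phi, A phi -> mopen (tdom phi)) -> (forall psi, B psi -> mopen (tdom psi)) ->
  (forall phi x, A phi -> tdom phi x -> linear (tmap phi x) /\ bijective (tmap phi x)) ->
  (forall psi x, B psi -> tdom psi x -> linear (tmap psi x) /\ bijective (tmap psi x)) ->
  (forall x, D x -> cancel (f x) (g x) /\ cancel (g x) (f x)) ->
  @smooth_vmor R M M D id V W A B f -> @smooth_vmor R M M D id W V B A g.
Proof.
move=> mM oD oA oB lA lB fgK vf psi phi x0 Bpsi Aphi Dx0 psix0 phix0.
have [U [a [oU Ux0 sa aE]]] := vf phi psi x0 Aphi Bpsi Dx0 phix0 psix0.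
pose U' := U `&` (D `&` (tdom phi `&` tdom psi)).
have oU' : mopen U'.
  by apply: mopenI => //; apply: mopenI => //; apply: mopenI; [|exact: oA|exact: oB].
have [||x [Ux [Dx [phix psix]]]|a' [sa' a'E]] := @smooth_inverse M U' _ _ a x0 mM oU'.
- by split.
- by move=> i j; apply: smooth_fun_sub (sa i j) => x [].
- have [_ [p pK Kp]] := lA _ _ Aphi phix; have [_ [q qK Kq]] := lB _ _ Bpsi psix.
  have [fK gK] := fgK _ Dx.
  have e v : v *m a x = q (f x (tmap phi x v)) by rewrite aE // qK.
  exists (fun w => p (g x (tmap psi x w))) => v; first by rewrite e Kq fK pK.
  by rewrite e Kp gK qK.
- exists U', a'; split=> // x U'x Dx psix phix w; have [Ux _] := U'x.
  have [fK _] := fgK _ Dx; have [_ aa] := a'E x U'x.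
  by rewrite -[in LHS](mulmx1 w) -aa mulmxA -aE // fK.
Qed.

End VectorBundleMaps.

(** * Maps between trivial coalgebra bundles *)

Section TrivialBundle.
Context (R : realType) (M N : mdata R).
Hypothesis mM : is_manifold M.

Lemma poly_co_basis d i : exists n (e : 'rV[R]_n -> poly_co R d i) (l : 'I_n -> poly_gr R d i),
  [/\ linear e, bijective e, forall v p, dapp (e v) p = \sum_j v 0 j * dapp (e (delta_mx 0 j)) p
    & forall xi, xi = e (\row_j dapp xi (l j))].
Proof.
have [n [y [l [yl pE]]]] := poly_interpolation R d i.
pose e (v : 'rV[R]_n) : poly_co R d i := \sum_j v 0 j *: evp i (y j).
have le : linear e.
  move=> a u v; rewrite /e scaler_sumr -big_split; apply: eq_bigr => j _.
  by rewrite !mxE scalerDl scalerA.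
have el v j : dapp (e v) (l j) = v 0 j.
  rewrite dappl_sum (bigD1 j) //= big1 => [|k kj]; rewrite dapplZ yl ?eqxx ?mulr1 ?addr0 //.
  by rewrite (negbTE kj) mulr0.
have eE xi : xi = e (\row_j dapp xi (l j)).
  apply: dual_ext => p; rewrite {1}(pE p) dapp_sum dappl_sum; apply: eq_bigr => j _.
  by rewrite dappZ dapplZ mxE mulrC.
exists n, e, l; split=> //.
  exists (fun xi => \row_j dapp xi (l j)) => [v|xi]; last by rewrite -eE.
  by apply/rowP => j; rewrite mxE el.
move=> v p; rewrite {1}(row_sum_delta v) (linear_sumE le) dappl_sum.
by apply: eq_bigr => j _; rewrite (linear_ZE le) dapplZ.
Qed.

(** The trivializations are constant in x, so matrix entries and scalar pairings are linear
    combinations of each other with constant coefficients. *)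
Lemma smooth_vmor_triv d d' i (D : set M) (b : M -> N)
    (f : forall x : M, poly_co R d i -> poly_co R d' i) :
  mopen D -> (forall x, D x -> linear (f x)) ->
  smooth_vmor D (b := b) (@vtrivs R (triv_bundle M (poly_co R d)) i)
    (@vtrivs R (triv_bundle N (poly_co R d')) i) f <->
  (forall xi p, smooth_fun D (fun x => dapp (f x xi) p)).
Proof.
move=> oD lf; split=> [vf xi p|sf phi psi x0].
  apply: smooth_fun_pt => x0 Dx0.
  have [n [e [l [le be eE xiE]]]] := poly_co_basis d i.
  have [n' [e' [l' [le' be' eE' xiE']]]] := poly_co_basis d' i.
  have [|||||U [a [oU Ux0 sa aE]]] := vf (VTriv setT (fun=> e)) (VTriv setT (fun=> e')) x0.
  - by exists n, e.
  - by exists n', e'.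
  - by [].
  - by [].
  - by [].
  have oUD : mopen (U `&` D) by exact: mopenI.
  exists (U `&` D) => //.
  have := xiE xi; set v := \row_j dapp xi (l j) => xiv.
  apply: (smooth_fun_ext (f := fun x => \sum_k (\sum_j v 0 j * a x j k) *
    dapp (e' (delta_mx 0 k)) p)) => //; first exact: mfd_inj.
    move=> x [Ux Dx]; rewrite xiv (aE x) //= eE'.
    by apply: eq_bigr => k _; rewrite mxE.
  apply: smooth_fun_sum => k; apply: smooth_funM; last exact: smooth_fun_cst.
  apply: smooth_fun_sum => j; apply: smooth_funM; first exact: smooth_fun_cst.
  by apply: smooth_fun_sub (sa j k) => x [].
move=> [n [e [le be ->]]] [n' [e' [le' be' ->]]] Dx0 _ _.
have [g [lg eK gK]] := linear_bij_inv le' be'.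
have [m [e0 [l [le0 be0 eE xiE]]]] := poly_co_basis d' i.
pose a x : 'M[R]_(n, n') := \matrix_k g (f x (e (delta_mx 0 k))).
exists D, a; split=> //= [k j|x Dx _ _ _ v].
  have -> : (fun x => a x k j) = fun x => \sum_h (dapp (f x (e (delta_mx 0 k))) (l h) *
      g (e0 (delta_mx 0 h)) 0 j).
    apply/funext => x; rewrite mxE; set eta := f x _.
    rewrite {1}(xiE eta) (row_sum_delta (\row_j _)) (linear_sumE le0) (linear_sumE lg) summxE.
    by apply: eq_bigr => h _; rewrite (linear_ZE le0) (linear_ZE lg) !mxE.
  by apply: smooth_fun_sum => h; apply: smooth_funM; [exact: sf|exact: smooth_fun_cst].
rewrite {1}(row_sum_delta v) (linear_sumE le) (linear_sumE (lf x Dx)) mulmx_sum_row.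
rewrite (linear_sumE le'); apply: eq_bigr => k _.
by rewrite (linear_ZE le) (linear_ZE (lf x Dx)) (linear_ZE le') rowK gK.
Qed.

End TrivialBundle.

(** * The coalgebra bundle of a graded bundle *)

Section GradedHom.
Context (R : realType) (F : gb R).
Let gF := gbP F.
Let mF := gb_mfd gF.
Let mB := gb_base gF.
Implicit Types (x : gbase F).

Lemma ghom_ext x i (a b : ghom x i) : (forall y, ghom_val a y = ghom_val b y) -> a = b.
Proof. by move=> ab; apply/val_inj/funext. Qed.

Lemma ghom_galg_bilin x : galg_bilin (ghom_alg x).
Proof.
move=> i j; split=> w a u v; apply: ghom_ext => y; rewrite /ghom_val /=.
  by rewrite !fctE mulrDr -scalerAr.
by rewrite !fctE mulrDl -scalerAl.
Qed.

Lemma ghom_coefE x i (a : ghom x i) y : ghom_val a y = (ghom_val a y)`_i *: 'X^i.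
Proof.
rewrite /ghom_val; have [_ _ /(_ y)[c ->]] := sub_valP a.
by rewrite coefZ coefXn eqxx mulr1.
Qed.

Lemma evg_subproof x i (y : gfib x) : linear ((fun a => (ghom_val a y)`_i) : ghom x i -> R^o).
Proof. by move=> c a b; rewrite /ghom_val /= coefD coefZ. Qed.

(** Evaluation at a point, read in the i-th coefficient, which determines a map valued in the line
    spanned by the i-th power of the variable. *)
Definition evg x i (y : gfib x) : dual (ghom x i) := mkdual (evg_subproof y).

Lemma evgE x i y a : dapp (@evg x i y) a = (ghom_val a y)`_i.
Proof. by []. Qed.

End GradedHom.

(** * The fibres Hom_G(F_x, A) and their duals in a local trivialization *)

Section LocalTriv.
Context (R : realType).

(** The clauses of [gb_triv] for one triple [U], [phi], [psi]: assumed in this section, and proved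
    for the total space in [tot_loc_triv]. *)
Definition loc_triv (F : gbdata R) d (U : set (gbase F)) (phi : F -> trivgb F d)
    (psi : trivgb F d -> F) : Prop :=
  [/\ mopen U,
      smooth_map [set y | U (gproj y)] phi,
      smooth_map [set p : trivgb F d | U p.1] psi &
      [/\ forall y, U (gproj y) -> psi (phi y) = y,
          forall p : trivgb F d, U p.1 -> phi (psi p) = p,
          forall y, U (gproj y) -> (phi y).1 = gproj y,
          forall p : trivgb F d, U p.1 -> gproj (psi p) = p.1 &
          forall t y, U (gproj y) -> (phi (gact t y)).2 = wscale t (phi y).2]].

Context (F : gb R) (d : seq nat).
Context (U : set (gbase F)) (phi : F -> trivgb F d) (psi : trivgb F d -> F).
Hypothesis lt : loc_triv U phi psi.
Let gF := gbP F.
Let mF := gb_mfd gF.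
Let mB := gb_base gF.
Let oU : mopen U. Proof. by case: lt. Qed.
Let sphi : smooth_map [set y | U (gproj y)] phi. Proof. by case: lt. Qed.
Let spsi : smooth_map [set p : trivgb F d | U p.1] psi. Proof. by case: lt. Qed.
Let phiK y : U (gproj y) -> psi (phi y) = y. Proof. by case: lt => _ _ _ []; auto. Qed.
Let psiK p : U p.1 -> phi (psi p) = p. Proof. by case: lt => _ _ _ []; auto. Qed.
Let phi1 y : U (gproj y) -> (phi y).1 = gproj y. Proof. by case: lt => _ _ _ []; auto. Qed.
Let gproj_psi p : U p.1 -> gproj (psi p) = p.1. Proof. by case: lt => _ _ _ []; auto. Qed.
Let phi_act t y : U (gproj y) -> (phi (gact t y)).2 = wscale t (phi y).2.
Proof. by case: lt => _ _ _ []; auto. Qed.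
Implicit Types (x : gbase F).

Lemma trivgb_manifold : is_manifold (trivgb F d).
Proof. exact: prodm_manifold mB (euclid_manifold R _). Qed.

Lemma mopen_gproj (W : set (gbase F)) : mopen W -> mopen [set y : F | W (gproj y)].
Proof.
move=> oW; have := mopen_preimage mF mB (smooth_gproj gF) (mopenT mF) oW.
by rewrite setTI.
Qed.

Lemma psi_act t x z : U x -> psi (x, wscale t z) = gact t (psi (x, z)).
Proof.
move=> Ux; have Up : U (gproj (psi (x, z))) by rewrite gproj_psi.
have Ug : U (gproj (gact t (psi (x, z)))) by rewrite (gproj_act gF).
rewrite -[RHS]phiK // [phi (gact _ _)]surjective_pairing phi1 // phi_act // psiK //.
by rewrite (gproj_act gF) gproj_psi.
Qed.

Lemma psi_fib x z : U x -> gact 0 (psi (x, z)) = sval x.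
Proof. by move=> Ux; rewrite -gact0_gproj gproj_psi. Qed.

Definition psif x (Ux : U x) z : gfib x := exist _ (psi (x, z)) (psi_fib z Ux).

Lemma gfib_gproj x (y : gfib x) : gproj (sval y) = x.
Proof. by apply: sval_inj; case: y. Qed.

Lemma psifK x (Ux : U x) (y : gfib x) : psif Ux (phi (sval y)).2 = y.
Proof.
apply: sval_inj => /=; have Uy : U (gproj (sval y)) by rewrite gfib_gproj.
rewrite -[RHS]phiK //; congr psi; rewrite [RHS]surjective_pairing phi1 //.
by rewrite gfib_gproj.
Qed.

Lemma smooth_psi_fib x : U x ->
  @smooth_map R (euclid R (sumn d)) F setT (fun z => psi (x, z)).
Proof.
move=> Ux; have mE := euclid_manifold R (sumn d).
have sp : @smooth_map R (euclid R (sumn d)) (trivgb F d) setT (fun z => (x, z)).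
  by apply: smooth_map_pair => //; [exact: smooth_map_cst|exact: smooth_map_id].
have := smooth_map_comp mE trivgb_manifold (mopenT mE) sp spsi.
by rewrite setTI; apply: smooth_map_sub.
Qed.

Lemma smooth_psi_base z : smooth_map U (fun x => psi (x, z)).
Proof.
have sp : @smooth_map R (gbase F) (trivgb F d) setT (fun x => (x, z)).
  by apply: smooth_map_pair => //; [exact: smooth_map_id|exact: smooth_map_cst].
have := smooth_map_comp mB trivgb_manifold (mopenT mB) sp spsi.
by rewrite setTI; apply: smooth_map_sub.
Qed.

Lemma smooth_mev_phi p : smooth_fun [set y : F | U (gproj y)] (fun y => mev p (phi y).2).
Proof.
have sp : @smooth_fun R (trivgb F d) (setT `*` setT) (fun q => mev p q.2).
  apply: (@smooth_fun_snd R (gbase F) (euclid R (sumn d)) setT (mev p)).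
  by apply/smooth_fun_euclid; [exact: openT|exact: Cinf_mev openT].
have := smooth_fun_comp mF trivgb_manifold sphi (mopen_gproj oU) sp.
by apply: smooth_fun_sub => y; split.
Qed.

Lemma loc_A_subproof x i (p : poly_gr R d i) : U x ->
  is_ghom i (fun y : gfib x => mev (sub_val p) (phi (sval y)).2 *: 'X^i).
Proof.
move=> Ux; split=> [k s _|t y y' yy'|y]; last by eexists.
  exists [set y : F | U (gproj y)], (fun y => mev (sub_val p) (phi y).2 * ('X^i : {poly R})`_k).
  split=> [|||s' _]; [exact: mopen_gproj|by rewrite /= gfib_gproj| |by rewrite coefZ].
  by apply: smooth_funM; [exact: smooth_mev_phi|exact: smooth_fun_cst].
rewrite yy' phi_act ?gfib_gproj // (mev_wscale _ _ (sub_valP p)).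
by rewrite comp_polyZ comp_Xn_poly exprZn scalerA mulrC.
Qed.

(* Junk (zero) for [x] outside [U] *)
Definition loc_A x i (p : poly_gr R d i) : ghom x i :=
  if pselect (is_ghom i (fun y : gfib x => mev (sub_val p) (phi (sval y)).2 *: 'X^i)) is left h
  then mksub (P := ghom_sp x i) h else 0.

Lemma loc_AE x i p y : U x -> ghom_val (@loc_A x i p) y = mev (sub_val p) (phi (sval y)).2 *: 'X^i.
Proof.
by rewrite /loc_A; case: pselect => // + Ux; have := loc_A_subproof p Ux.
Qed.

(** Read through [psi] on a single fibre, the i-th coefficient of [a] is a smooth function on all of
    R^d, homogeneous of weight i, hence a polynomial by [homogeneous_poly]. *)
Lemma ghom_poly x i (a : ghom x i) : U x -> exists p : poly_gr R d i, a = loc_A x p.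
Proof.
move=> Ux; have [sa ea da] := sub_valP a; have mE := euclid_manifold R (sumn d).
pose g z := (ghom_val a (psif Ux z))`_i.
have Cg : Cinf setT g.
  apply/smooth_fun_euclid; first exact: openT.
  (* Smoothness on the fibre only provides local extensions [h] to [F]; each is composed with the
     smooth map [psi (x, _)]. *)
  apply: smooth_fun_pt => z _; have [V [h [oV Vz sh hE]]] := sa i (psif Ux z) I.
  have oP := mopen_preimage mE mF (smooth_psi_fib Ux) (mopenT mE) oV.
  have shp := smooth_fun_comp mE mF (smooth_psi_fib Ux) (mopenT mE) sh.
  set W := _ `&` _ in oP shp; exists W; first by split.
  apply: (smooth_fun_ext (mfd_inj mE) oP _ shp) => w [_ Vw].
  by rewrite /g /ghom_val hE.
have [t z|p hp gp] := homogeneous_poly (i := i) Cg.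
  rewrite /g; have -> : ghom_val a (psif Ux (wscale t z)) = ghom_val a (psif Ux z) \Po (t *: 'X).
    by apply: ea; rewrite /= psi_act.
  rewrite ghom_coefE comp_polyZ comp_Xn_poly exprZn !coefZ coefXn eqxx mulr1 mulrC.
  by rewrite mulr1.
exists (mksub (P := poly_sp R d i) hp); apply: ghom_ext => y.
by rewrite loc_AE //= -gp /g psifK -ghom_coefE.
Qed.

Lemma phi_psif x (Ux : U x) z : (phi (sval (psif Ux z))).2 = z.
Proof. by rewrite /= psiK. Qed.

Lemma loc_A_inj x i : U x -> injective (@loc_A x i).
Proof.
move=> Ux p q pq; apply: poly_ext => z.
have := congr1 (fun a : ghom x i => (ghom_val a (psif Ux z))`_i) pq.
by rewrite !loc_AE // phi_psif !coefZ coefXn eqxx !mulr1.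
Qed.

Definition loc_P x i (a : ghom x i) : poly_gr R d i := xget 0 [set p | a = loc_A x p].

Lemma loc_PK x i (a : ghom x i) : U x -> loc_A x (loc_P a) = a.
Proof.
move=> Ux; rewrite /loc_P; case: xgetP => [p _ -> //|nP].
by have [p /nP] := ghom_poly a Ux.
Qed.

Lemma loc_AK x i (p : poly_gr R d i) : U x -> loc_P (loc_A x p) = p.
Proof. by move=> Ux; apply: (loc_A_inj Ux); rewrite loc_PK. Qed.

Lemma loc_A_linear x i : U x -> linear (@loc_A x i).
Proof.
move=> Ux c p q; apply: ghom_ext => y; rewrite loc_AE //.
rewrite [RHS]/ghom_val /= !fctE -!/(ghom_val _ _) !loc_AE // /mev mevalD mevalZ.
by rewrite scalerDl scalerA.
Qed.

Lemma loc_P_linear x i : U x -> linear (@loc_P x i).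
Proof. by move=> Ux c a b; apply: (loc_A_inj Ux); rewrite loc_A_linear // !loc_PK. Qed.

Lemma loc_AM x i j (p : poly_gr R d i) (q : poly_gr R d j) : U x ->
  loc_A x (gmul (poly_galg R d) p q) = gmul (ghom_alg x) (loc_A x p) (loc_A x q).
Proof.
move=> Ux; apply: ghom_ext => y; rewrite loc_AE // [RHS]/ghom_val /= -!/(ghom_val _ _).
by rewrite !loc_AE // /mev mevalM -scalerAl -scalerAr scalerA exprD.
Qed.

Lemma loc_A1 x : U x -> loc_A x (gone (poly_galg R d)) = gone (ghom_alg x).
Proof.
by move=> Ux; apply: ghom_ext => y; rewrite loc_AE // /mev meval1 scale1r expr0.
Qed.

Lemma fd_ghom x i : U x -> fd (ghom x i).
Proof.
move=> Ux; apply: (fd_iso (f := @loc_A x i) (g := @loc_P x i)) (fd_poly R d i).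
- exact: loc_A_linear.
- exact: loc_P_linear.
- by move=> p; exact: loc_AK.
- by move=> a; exact: loc_PK.
Qed.

Definition loc_sigma x i (xi : dual (ghom x i)) : poly_co R d i := dualmap (@loc_A x i) xi.
Definition loc_tau x i (xi : poly_co R d i) : dual (ghom x i) := dualmap (@loc_P x i) xi.

Lemma loc_sigmaE x i (xi : dual (ghom x i)) p : U x -> dapp (loc_sigma xi) p = dapp xi (loc_A x p).
Proof. by move=> Ux; rewrite dualmapE //; exact: loc_A_linear. Qed.

Lemma loc_tauE x i (xi : poly_co R d i) a : U x -> dapp (loc_tau x xi) a = dapp xi (loc_P a).
Proof. by move=> Ux; rewrite dualmapE //; exact: loc_P_linear. Qed.

Lemma loc_sigma_linear x i : linear (@loc_sigma x i).
Proof. exact: dualmap_linear. Qed.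

Lemma loc_tau_linear x i : linear (@loc_tau x i).
Proof. exact: dualmap_linear. Qed.

Lemma loc_tauK x i : U x -> cancel (@loc_tau x i) (@loc_sigma x i).
Proof. by move=> Ux xi; apply: dual_ext => p; rewrite loc_sigmaE // loc_tauE // loc_AK. Qed.

Lemma loc_sigmaK x i : U x -> cancel (@loc_sigma x i) (@loc_tau x i).
Proof. by move=> Ux xi; apply: dual_ext => a; rewrite loc_tauE // loc_sigmaE // loc_PK. Qed.

Lemma loc_sigma_hom x : U x ->
  is_gcoalg_hom (dual_coalg (ghom_alg x)) (poly_coalg R d) (@loc_sigma x).
Proof.
move=> Ux; apply: (dual_coalg_hom (g := @loc_A x)).
- exact: ghom_galg_bilin.
- exact: poly_galg_bilin.
- by move=> i; exact: fd_ghom.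
- exact: fd_poly.
- by move=> i; exact: loc_A_linear.
- by move=> i j p q; exact: loc_AM.
- exact: loc_A1.
- by move=> i xi p; exact: loc_sigmaE.
Qed.

Lemma loc_tau_hom x : U x ->
  is_gcoalg_hom (poly_coalg R d) (dual_coalg (ghom_alg x)) (@loc_tau x).
Proof.
move=> Ux; apply: (gcoalg_hom_inv (f := @loc_sigma x)) (loc_sigma_hom Ux) => i.
- exact: loc_sigmaK.
- exact: loc_tauK.
Qed.

Lemma loc_sigma_evg x i (y : gfib x) : U x -> loc_sigma (evg i y) = evp i (phi (sval y)).2.
Proof.
move=> Ux; apply: dual_ext => p; rewrite loc_sigmaE // evgE loc_AE //.
by rewrite coefZ coefXn eqxx mulr1.
Qed.

Lemma loc_tau_evp x i (Ux : U x) z : loc_tau x (evp i z) = evg i (psif Ux z).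
Proof. by rewrite -[RHS](loc_sigmaK Ux) loc_sigma_evg // phi_psif. Qed.

(* [gproj (sval y)] is only propositionally equal to [x]. *)
Lemma ghom_val_transport i (s : forall x, ghom x i) x (y : gfib x) :
  ghom_val (s x) y = ghom_val (s (gproj (sval y))) (exist _ (sval y) erefl).
Proof.
have e := gfib_gproj y; case: y e => y py /= e.
by case: x / e py => py; congr (ghom_val _ _); apply: sval_inj.
Qed.

(** A fixed functional on polynomials is a combination of evaluations at fixed points y_j, and
    [loc_tau] turns these into evaluations at [psi (x, y j)]. Pairing them with a smooth frame of
    Hom_G gives a smooth function on [F] along a smooth section. *)
Lemma smooth_loc_tau i : smooth_vmor U (b := id)
  (@vtrivs R (triv_bundle (gbase F) (poly_co R d)) i) (@vtrivs R (circ_obj F) i)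
  (fun x => @loc_tau x i).
Proof.
move=> _ chi x0 [n [e [le be ->]]] [phi0 [op lp sp] [g -> gE]] Ux0 _ /= x0d.
pose a x : 'M[R]_(n, trk phi0) :=
  \matrix_(k, l) dapp (loc_tau x (e (delta_mx 0 k))) (tmap phi0 x (delta_mx 0 l)).
have oV : mopen (U `&` tdom phi0) by exact: mopenI.
exists (U `&` tdom phi0), a; split=> //.
  move=> k l; have [N [y [m xiE]]] := evp_span R d i; set xi := e (delta_mx 0 k).
  (* The function on [F] given by the l-th frame section; it is smooth by the definition of
     [ghom_bundle]. *)
  pose G y : R := (ghom_val (tmap phi0 (gproj y) (delta_mx 0 l)) (exist _ y erefl))`_i.
  apply: (smooth_fun_ext (f := fun x => \sum_j dapp xi (m j) * G (psi (x, y j))) (mfd_inj mB) oV).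
    move=> x [Ux px]; rewrite mxE -/xi.
    have -> : loc_tau x xi = \sum_j dapp xi (m j) *: loc_tau x (evp i (y j)).
      rewrite {1}(xiE xi) (linear_sumE (@loc_tau_linear x i)); apply: eq_bigr => j _.
      by rewrite (linear_ZE (@loc_tau_linear x i)).
    rewrite dappl_sum; apply: eq_bigr => j _; rewrite dapplZ; congr (_ * _).
    rewrite (loc_tau_evp _ Ux) evgE.
    by rewrite (ghom_val_transport (fun x => tmap phi0 x (delta_mx 0 l))).
  apply: smooth_fun_sum => j; apply: smooth_funM; first exact: smooth_fun_cst.
  have := smooth_fun_comp mB mF (@smooth_psi_base (y j)) oU (sp (delta_mx 0 l)).
  apply: smooth_fun_sub => x [Ux px]; split=> //=.
  by rewrite /preimage /= gproj_psi.
move=> x [Ux px] _ _ _ v; have [lpx [q pq qp]] := lp x px.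
apply: dual_ext => b; rewrite -(qp b) gE //.
rewrite {1}(row_sum_delta v) (linear_sumE le) (linear_sumE (@loc_tau_linear x i)) dappl_sum.
rewrite {1}(row_sum_delta (q b)) (linear_sumE lpx).
under [RHS]eq_bigr do rewrite mxE mulr_suml.
rewrite exchange_big; apply: eq_bigr => k _.
rewrite (linear_ZE le) (linear_ZE (@loc_tau_linear x i)) dapplZ dapp_sum mulr_sumr.
by apply: eq_bigr => l _; rewrite (linear_ZE lpx) dappZ mxE -mulrA [_ * q b _ _]mulrC.
Qed.

End LocalTriv.

(** * Locality of smooth bundle maps, and dual frames *)

Section LocalVmor.
Context (R : realType).

Lemma smooth_vmor_sub (M N : mdata R) (D D' : set M) (b : M -> N) V W A B f :
  D' `<=` D -> @smooth_vmor R M N D b V W A B f -> smooth_vmor D' (b := b) A B f.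
Proof.
move=> DD vf phi psi x0 Aphi Bpsi D'x px qx.
have [U [a [oU Ux sa aE]]] := vf phi psi x0 Aphi Bpsi (DD _ D'x) px qx.
by exists U, a; split=> // x Ux' D'x'; exact: aE (DD _ D'x').
Qed.

Lemma smooth_vmor_pt (M N : mdata R) (D : set M) (b : M -> N) V W A B f :
  is_manifold M ->
  (forall x, D x -> exists D', [/\ mopen D', D' x & @smooth_vmor R M N D' b V W A B f]) ->
  smooth_vmor D (b := b) A B f.
Proof.
move=> mM Df phi psi x0 Aphi Bpsi Dx px qx; have [D' [oD' D'x vf]] := Df _ Dx.
have [U [a [oU Ux sa aE]]] := vf phi psi x0 Aphi Bpsi D'x px qx.
exists (U `&` D'), a; split=> //; first exact: mopenI.
  by move=> k l; apply: smooth_fun_sub (sa k l) => x [].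
by move=> x [Ux' D'x'] _; exact: aE.
Qed.

Lemma smooth_vmor_ext (M N : mdata R) (D : set M) (b : M -> N) V W A B f g :
  (forall x, D x -> f x =1 g x) ->
  @smooth_vmor R M N D b V W A B f -> smooth_vmor D (b := b) A B g.
Proof.
move=> fg vf phi psi x0 Aphi Bpsi Dx px qx.
have [U [a [oU Ux sa aE]]] := vf phi psi x0 Aphi Bpsi Dx px qx.
by exists U, a; split=> // x Ux' Dx' px' qx' v; rewrite -fg // aE.
Qed.

(** The pairing forces [g] to be the dual frame: the coordinates of a functional are its values on
    the frame [e]. *)
Lemma dual_frame (V : lmodType R) n (e : 'rV[R]_n -> V) (g : 'rV[R]_n -> dual V) :
  linear e -> bijective e -> (forall v w, dapp (g v) (e w) = \sum_k v 0 k * w 0 k) ->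
  linear g /\ bijective g.
Proof.
move=> le [h eK hK] gE.
have ge v k : dapp (g v) (e (delta_mx 0 k)) = v 0 k.
  rewrite gE (bigD1 k) //= big1 => [|l lk]; rewrite !mxE ?eqxx ?mulr1 ?addr0 //.
  by rewrite (negbTE lk) mulr0.
have ext xi eta : (forall k, dapp xi (e (delta_mx 0 k)) = dapp eta (e (delta_mx 0 k))) -> xi = eta.
  move=> H; apply: dual_ext => v; rewrite -(hK v) (row_sum_delta (h v)) (linear_sumE le).
  by rewrite !dapp_sum; apply: eq_bigr => k _; rewrite (linear_ZE le) !dappZ H.
split=> [a u v|]; first by apply: ext => k; rewrite dapplD dapplZ !ge !mxE.
exists (fun xi => \row_k dapp xi (e (delta_mx 0 k))) => [v|xi].
  by apply/rowP => k; rewrite mxE ge.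
by apply: ext => k; rewrite ge mxE.
Qed.

Lemma triv_bundle_lin (M : mdata R) d i phi x :
  @vtrivs R (triv_bundle M (poly_co R d)) i phi -> tdom phi x ->
  linear (tmap phi x) /\ bijective (tmap phi x).
Proof. by move=> [n [e [le be ->]]]. Qed.

Lemma triv_bundle_open (M : mdata R) d i phi : is_manifold M ->
  @vtrivs R (triv_bundle M (poly_co R d)) i phi -> mopen (tdom phi).
Proof. by move=> mM [n [e [le be ->]]]; exact: mopenT. Qed.

Lemma triv_bundle_cover (M : mdata R) d i x :
  exists2 phi, @vtrivs R (triv_bundle M (poly_co R d)) i phi & tdom phi x.
Proof.
have [n [e [l [le be _ _]]]] := poly_co_basis R d i.
by exists (VTriv setT (fun=> e)) => //; exists n, e.
Qed.

End LocalVmor.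

(** * The coalgebra bundle [circ_obj F] *)

Section CircObject.
Context (R : realType) (F : gb R).
Let gF := gbP F.
Let mF := gb_mfd gF.
Let mB := gb_base gF.

Lemma gb_loc_triv : exists d, forall x : gbase F, exists U phi psi,
  U x /\ @loc_triv R F d U phi psi.
Proof.
have [d dP] := gb_triv gF; exists d => x; have [U [phi [psi [oU Ux sphi spsi H]]]] := dP x.
by exists U, phi, psi; split.
Qed.

Lemma circ_open i chi : @vtrivs R (circ_obj F) i chi -> mopen (tdom chi).
Proof. by move=> [phi0 [op lp sp] [g -> gE]]. Qed.

Lemma circ_lin i chi x : @vtrivs R (circ_obj F) i chi -> tdom chi x ->
  linear (tmap chi x) /\ bijective (tmap chi x).
Proof.
move=> [phi0 [op lp sp] [g -> gE]] /= px; have [le be] := lp x px.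
by apply: (dual_frame le be) => v w; exact: gE.
Qed.

(** Interpolation supplies polynomials [l j] biorthogonal to evaluations at points [y j]. The
    polynomials give a frame of Hom_G over [U], and the evaluations give its contragredient. *)
Lemma circ_cover i x : exists2 chi, @vtrivs R (circ_obj F) i chi & tdom chi x.
Proof.
have [d dP] := gb_loc_triv; have [U [phi [psi [Ux lt]]]] := dP x.
have [n [y [l [yl pE]]]] := poly_interpolation R d i.
pose e (v : 'rV[R]_n) : poly_gr R d i := \sum_j v 0 j *: l j.
have le : linear e.
  move=> a u v; rewrite /e scaler_sumr -big_split; apply: eq_bigr => j _.
  by rewrite !mxE scalerDl scalerA.
have eE v j : dapp (evp i (y j)) (e v) = v 0 j.
  rewrite dapp_sum (bigD1 j) //= big1 => [|k kj]; rewrite dappZ yl ?eqxx ?mulr1 ?addr0 //.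
  by rewrite eq_sym (negbTE kj) mulr0.
have [oU _ _ _] := lt.
pose phi0 : vtriv (fun x => ghom x i) := VTriv U (fun x v => @loc_A R F d phi x i (e v)).
pose g x (v : 'rV[R]_n) : dual (ghom x i) := @loc_tau R F d phi x i (\sum_j v 0 j *: evp i (y j)).
exists (VTriv U g) => //; exists phi0.
  split=> //= [x' Ux'|v].
    split=> [a u v|]; first by rewrite le (loc_A_linear lt).
    exists (fun a => \row_j dapp (evp i (y j)) (@loc_P R F d phi x' i a)) => [v|a].
      by apply/rowP => j; rewrite mxE (loc_AK lt) // eE.
    rewrite -[RHS](loc_PK lt) //; congr loc_A; rewrite [RHS]pE /e.
    by apply: eq_bigr => j _; rewrite mxE.
  apply: (smooth_fun_ext (f := fun y => mev (sub_val (e v)) (phi y).2) (mfd_inj mF)).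
  - exact: mopen_gproj.
  - by move=> y' Uy'; rewrite (loc_AE lt) //= coefZ coefXn eqxx mulr1.
  - exact: (smooth_mev_phi lt).
exists g => //= x' v w Ux'.
rewrite (loc_tauE lt) // (loc_AK lt) // dappl_sum; apply: eq_bigr => k _.
by rewrite dapplZ eE.
Qed.

Lemma smooth_loc_sigma d U phi psi i : @loc_triv R F d U phi psi ->
  smooth_vmor U (b := id) (@vtrivs R (circ_obj F) i)
    (@vtrivs R (triv_bundle (gbase F) (poly_co R d)) i)
    (fun x => @loc_sigma R F d phi x i).
Proof.
move=> lt; have [oU _ _ _] := lt.
refine (smooth_vmor_inv mB oU _ _ _ _ _ (smooth_loc_tau lt (i := i))).
- by move=> ?; exact: triv_bundle_open.
- by move=> ?; exact: circ_open.
- by move=> ? ?; exact: triv_bundle_lin.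
- by move=> ? ?; exact: circ_lin.
- by move=> x Ux; split; [exact: (loc_tauK lt)|exact: (loc_sigmaK lt)].
Qed.

(** Over [U] the identity is [loc_sigma] followed by [loc_tau], so any two trivializations are
    compared through the trivial polynomial bundle. *)
Lemma circ_gvb : is_gvb (circ_obj F).
Proof.
split=> //; [exact: circ_open|exact: circ_lin|exact: circ_cover|move=> i].
apply: smooth_vmor_pt => // x _; have [d dP] := gb_loc_triv.
have [U [phi [psi [Ux lt]]]] := dP x; have [oU _ _ _] := lt; exists U; split=> //.
have sid : smooth_map U (@id (gbase F)).
  by apply: smooth_map_sub (smooth_map_id mB).
have := smooth_vmor_comp mB mB oU sid (fun x Ux => Ux) (fun y _ => @triv_bundle_cover R _ d i y)
  (fun psi => @triv_bundle_open R _ d i psi mB)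
  (smooth_loc_sigma (i := i) lt) (smooth_loc_tau lt (i := i)).
by apply: smooth_vmor_ext => x' Ux' v; exact: (loc_sigmaK lt).
Qed.

Lemma circ_gpcb : is_gpcb (circ_obj F).
Proof.
split; first exact: circ_gvb.
have [d dP] := gb_loc_triv; exists d => x; have [U [phi [psi [Ux lt]]]] := dP x.
have [oU _ _ _] := lt.
exists U, (@loc_tau R F d phi), (@loc_sigma R F d phi); split=> //.
- move=> x' Ux'; split=> [||i|i].
  + exact: (loc_tau_hom lt).
  + exact: (loc_sigma_hom lt).
  + exact: (loc_tauK lt).
  + exact: (loc_sigmaK lt).
- by move=> i; exact: (smooth_loc_tau lt).
- by move=> i; exact: (smooth_loc_sigma lt).
Qed.

End CircObject.

(** * The bundle morphism [circ_mor f] *)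

Section CircMorphism.
Context (R : realType) (F E : gb R).
Let gF := gbP F.
Let mF := gb_mfd gF.
Let mB := gb_base gF.
Let gE := gbP E.
Let mE := gb_mfd gE.
Let mBE := gb_base gE.

Lemma fd_ghom_gb (x : gbase F) i : fd (ghom x i).
Proof.
have [d dP] := gb_loc_triv F; have [U [phi [psi [Ux lt]]]] := dP x.
exact: (fd_ghom lt).
Qed.

(** The base map is the inclusion of the base, followed by [f] and the projection. *)
Lemma smooth_gbase_map (f : F -> E) (fh : is_gbhom f) : smooth_map setT (gbase_map fh).
Proof.
have s1 := smooth_map_comp mB mF (mopenT mB) (@smooth_map_sval _ _ mF _) fh.1.
rewrite setTI preimage_setT in s1.
have s2 := smooth_map_comp mB mE (mopenT mB) s1 (smooth_gproj gE).
rewrite setTI preimage_setT in s2.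
apply: (smooth_map_ext mB (mopenT mB) _ s2) => x _; apply: sval_inj => /=.
by rewrite -fh.2 (gact0_base gF).
Qed.

Lemma ghom_push_evg (f : F -> E) (fh : is_gbhom f) b bE x i (y : gfib x) :
  @ghom_push R F E f fh b bE x i (evg i y) = evg i (gfib_map fh bE y).
Proof. exact: dual_ext. Qed.

Lemma ghom_push_hom (f : F -> E) (fh : is_gbhom f) b bE x : (forall i, fd (ghom (b x) i)) ->
  is_gcoalg_hom (dual_coalg (ghom_alg x)) (dual_coalg (ghom_alg (b x)))
    (@ghom_push R F E f fh b bE x).
Proof.
move=> fdE; apply: (dual_coalg_hom (g := @ghom_pull R F E f fh b bE x)) => //.
- exact: ghom_galg_bilin.
- exact: ghom_galg_bilin.
- exact: fd_ghom_gb.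
- by move=> i c u v; apply: ghom_ext.
- by move=> i j u v; apply: ghom_ext.
- by apply: ghom_ext.
Qed.

End CircMorphism.

Section CircMorphismSmooth.
Context (R : realType) (F E : gb R) (f : gbhom F E).
Let gF := gbP F.
Let mF := gb_mfd gF.
Let mB := gb_base gF.
Let gE := gbP E.
Let mE := gb_mfd gE.
Let mBE := gb_base gE.
Let fh := svalP f.
Let b := gbase_map fh.

Lemma circ_mor_evg x i (y : gfib x) :
  @mfib _ _ _ (circ_mor f) x i (evg i y) = evg i (gfib_map fh (b := b) (fun=> erefl) y).
Proof. exact: ghom_push_evg. Qed.

(** In coordinates the evaluation at y_j is sent to the evaluation at the second component of
    [phi' (f (psi (x, y j)))], which is smooth in x. *)
Lemma smooth_push_local d d' U U' phi phi' psi psi' i :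
  @loc_triv R F d U phi psi -> @loc_triv R E d' U' phi' psi' ->
  smooth_vmor (U `&` b @^-1` U') (b := b)
    (@vtrivs R (triv_bundle (gbase F) (poly_co R d)) i)
    (@vtrivs R (triv_bundle (gbase E) (poly_co R d')) i)
    (fun x xi => @loc_sigma R E d' phi' (b x) i
       (@mfib _ _ _ (circ_mor f) x i (@loc_tau R F d phi x i xi))).
Proof.
move=> lt lt'; have [oU _ _ _] := lt; have [oU' sphi' _ _] := lt'.
have sb : smooth_map setT b := @smooth_gbase_map R F E _ fh.
have oD : mopen (U `&` b @^-1` U').
  by apply: mopenI => //; have := mopen_preimage mB mBE sb (mopenT mB) oU'; rewrite setTI.
have ls x : linear (fun xi => @loc_sigma R E d' phi' (b x) i
       (@mfib _ _ _ (circ_mor f) x i (@loc_tau R F d phi x i xi))).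
  move=> a u v; have [lp _ _] := @ghom_push_hom R F E (sval f) fh b (fun=> erefl) x
    (fun i => fd_ghom_gb (b x) i).
  have lm : linear (@mfib _ _ _ (circ_mor f) x i) := lp i.
  by rewrite loc_tau_linear lm loc_sigma_linear.
apply/smooth_vmor_triv => // xi p.
have [n [y [l xiE]]] := evp_span R d i.
apply: (smooth_fun_ext (f := fun x => \sum_j dapp xi (l j) *
  mev (sub_val p) (phi' (sval f (psi (x, y j)))).2) (mfd_inj mB) oD).
  move=> x [Ux U'x]; rewrite [in RHS](xiE xi) (linear_sumE (ls x)) dappl_sum.
  apply: eq_bigr => j _; rewrite (linear_ZE (ls x)) dapplZ; congr (_ * _).
  by rewrite (loc_tau_evp lt _ Ux) circ_mor_evg (loc_sigma_evg lt').
apply: smooth_fun_sum => j; apply: smooth_funM; first exact: smooth_fun_cst.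
have s1 := smooth_map_comp mB mF oU (@smooth_psi_base R F d U phi psi lt (y j)) fh.1.
rewrite preimage_setT setIT in s1.
have := smooth_fun_comp mB mE s1 oU (smooth_mev_phi lt' (sub_val p)).
apply: smooth_fun_sub => x [Ux U'x]; split=> //; rewrite /preimage /=.
have [_ _ _ [_ _ _ gp _]] := lt.
suff -> : gproj (sval f (psi (x, y j))) = b x by [].
by apply: sval_inj; rewrite /= -fh.2 (psi_fib lt).
Qed.

Lemma circ_mor_gpcb : is_gpcb_mor (circ_mor f).
Proof.
have sb : smooth_map setT b := @smooth_gbase_map R F E _ fh.
have [d dP] := gb_loc_triv F; have [d' dP'] := gb_loc_triv E.
split=> [||i] //.
  by move=> x; apply: ghom_push_hom => i; exact: fd_ghom_gb.
apply: smooth_vmor_pt => // x _.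
have [U [phi [psi [Ux lt]]]] := dP x; have [U' [phi' [psi' [U'x lt']]]] := dP' (b x).
have [oU _ _ _] := lt; have [oU' _ _ _] := lt'.
have oD : mopen (U `&` b @^-1` U').
  by apply: mopenI => //; have := mopen_preimage mB mBE sb (mopenT mB) oU'; rewrite setTI.
exists (U `&` b @^-1` U'); split=> //.
have sD : smooth_map (U `&` b @^-1` U') (@id (gbase F)).
  by apply: smooth_map_sub (smooth_map_id mB).
have sbD : smooth_map (U `&` b @^-1` U') b by apply: smooth_map_sub sb.
have DU : U `&` b @^-1` U' `<=` U by move=> z [].
have sig := smooth_vmor_sub DU (smooth_loc_sigma (i := i) lt).
have c1 := smooth_vmor_comp mB mB oD sD (fun x Dx => Dx)
  (fun y _ => @triv_bundle_cover R _ d i y)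
  (fun psi => @triv_bundle_open R _ d i psi mB) sig (smooth_push_local (i := i) lt lt').
have c2 := smooth_vmor_comp mB mBE oD sbD (fun x (Dx : (U `&` b @^-1` U') x) => proj2 Dx)
  (fun y _ => @triv_bundle_cover R _ d' i y)
  (fun psi => @triv_bundle_open R _ d' i psi mBE) c1 (smooth_loc_tau (i := i) lt').
apply: smooth_vmor_ext c2 => z [Uz U'z] v /=.
by rewrite (loc_sigmaK lt Uz) (loc_sigmaK lt' U'z).
Qed.

End CircMorphismSmooth.

(** * The functor is faithful and full *)

Section Totals.
Context (R : realType).

Lemma existT_inj2 T (P : T -> Type) x (a b : P x) : existT P x a = existT P x b -> a = b.
Proof. by move=> e; have := projT2_eq e; rewrite (Prop_irrelevance (projT1_eq e) erefl). Qed.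

(** When the base maps are only propositionally equal, the fibre maps have different types. The
    hypothesis therefore compares base point and vector as one dependent pair. *)
Lemma gcmor_ext (E E' : gcbundle R) (f g : gcmor E E') :
  (forall x i (v : vfib x i), existT (fun y => vfib y i) (mbase f x) (mfib f v) =
                              existT (fun y => vfib y i) (mbase g x) (mfib g v)) -> f = g.
Proof.
move=> fg; have bE : mbase f = mbase g.
  (* Every fibre contains 0, so the base maps can be read off from the pairs. *)
  by apply/funext => x; have := congr1 (@projT1 _ _) (fg x 0%N 0).
case: f g bE fg => [b m] [b' m'] /= bE; subst b' => fg; congr GCMor.
apply/functional_extensionality_dep => x; apply/functional_extensionality_dep => i.
by apply/funext => v; exact: existT_inj2 (fg x i v).
Qed.

End Totals.

(** * Points of a graded bundle as group-like families *)

Section Points.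
Context (R : realType) (F : gb R).
Implicit Types x : gbase F.

Lemma evg_inj x x' (y : gfib x) (y' : gfib x') :
  (forall i, existT (fun x => dual (ghom x i)) x (evg i y) = existT _ x' (evg i y')) ->
  sval y = sval y'.
Proof.
move=> e; have xx := congr1 (@projT1 _ _) (e 0%N); rewrite /= in xx; subst x'.
have [d dP] := gb_loc_triv F; have [U [phi [psi [Ux lt]]]] := dP x.
congr sval; rewrite -(psifK lt Ux y) -(psifK lt Ux y'); congr psif.
by apply: evp_inj => i; rewrite -!(loc_sigma_evg lt) // (existT_inj2 (e i)).
Qed.

Lemma evg_eq x x' i (y : gfib x) (y' : gfib x') : x = x' -> sval y = sval y' ->
  existT (fun x => dual (ghom x i)) x (evg i y) = existT _ x' (evg i y').
Proof. by move=> xx; subst x' => yy; congr existT; congr evg; exact: sval_inj. Qed.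

Lemma evg_ext x i (W : lmodType R) (f g : dual (ghom x i) -> W) : linear f -> linear g ->
  (forall y, f (evg i y) = g (evg i y)) -> f =1 g.
Proof.
move=> lf lg fg xi.
have [d dP] := gb_loc_triv F; have [U [phi [psi [Ux lt]]]] := dP x.
rewrite -(loc_sigmaK lt Ux xi).
apply: (evp_ext (f := f \o @loc_tau R F d phi x i) (g := g \o @loc_tau R F d phi x i)).
- by move=> a u v /=; rewrite loc_tau_linear lf.
- by move=> a u v /=; rewrite loc_tau_linear lg.
- by move=> z /=; rewrite (loc_tau_evp lt _ Ux) fg.
Qed.

Lemma glike_evg x (y : gfib x) : glike (dual_coalg (ghom_alg x)) (fun i => evg i y).
Proof.
apply/glike_dualP; [exact: ghom_galg_bilin|exact: fd_ghom_gb|split=> [i j v w|]].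
  rewrite !evgE [ghom_val (gmul _ _ _) y]/ghom_val /= (ghom_coefE v) (ghom_coefE w).
  by rewrite -scalerAl -scalerAr -exprD scalerA !coefZ !coefXn !eqxx !mulr1.
by rewrite evgE [ghom_val _ y]/ghom_val /= coef1.
Qed.

Lemma glike_evgP x u : glike (dual_coalg (ghom_alg x)) u ->
  exists y : gfib x, forall i, u i = evg i y.
Proof.
move=> gu; have [d dP] := gb_loc_triv F; have [U [phi [psi [Ux lt]]]] := dP x.
have [z zP] := evp_glike (glike_hom (loc_sigma_hom lt Ux) gu).
by exists (psif lt Ux z) => i; rewrite -(loc_tau_evp lt) -zP (loc_sigmaK lt).
Qed.

Lemma gact_fib t x (y : gfib x) : gact 0 (gact t (sval y)) = sval x.
Proof. by rewrite (gb_act (gbP F)) mul0r (svalP y). Qed.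

(** Translates the action into scalars, so that equivariance of an induced map of points becomes
    linearity in each degree. *)
Lemma evg_act t x i (y : gfib x) :
  evg i (exist _ (gact t (sval y)) (gact_fib t y) : gfib x) = t ^+ i *: evg i y.
Proof.
apply: dual_ext => a; rewrite dapplZ !evgE.
have [_ ea _] := sub_valP a.
rewrite [ghom_val a _]/ghom_val (ea t y) // -/(ghom_val a y) ghom_coefE.
by rewrite comp_polyZ comp_Xn_poly exprZn !coefZ coefXn eqxx !mulr1 mulrC.
Qed.

End Points.

(** * Faithfulness *)

Section Faithful.
Context (R : realType) (F E : gb R).

(** [circ_mor f] sends the evaluation at y to the evaluation at [f y], and evaluations determine
    points. *)
Lemma circ_faithful (f g : gbhom F E) : circ_mor f = circ_mor g -> f = g.
Proof.
move=> fg; apply: sval_inj; apply/funext => y.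
pose yf : gfib (gproj y) := exist _ y erefl.
have := @evg_inj R E _ _ (gfib_map (svalP f) (b := gbase_map (svalP f)) (fun=> erefl) yf)
  (gfib_map (svalP g) (b := gbase_map (svalP g)) (fun=> erefl) yf).
apply=> i; have := congr1 (fun m : gcmor (circ_obj F) (circ_obj E) =>
  existT (fun x : gbase E => dual (ghom x i)) (mbase m (gproj y)) (mfib m (evg i yf))) fg.
by rewrite -!circ_mor_evg.
Qed.

End Faithful.

(** * Joint smoothness of the induced polynomial maps *)

Section SmoothTheta.
Context (R : realType) (M : mdata R) (d d' : seq nat).

(** Interpolation separates the variables: evaluation at z is the sum of the l_j(z) times
    evaluations at fixed points y_j. So each coordinate is a sum of products of a polynomial in z
    and a smooth function of x. *)
Lemma smooth_Theta (D : set M) (s : forall x : M, forall i, poly_co R d i -> poly_co R d' i) k :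
  is_manifold M -> mopen D -> (forall x i, D x -> linear (s x i)) ->
  (forall i xi p, smooth_fun D (fun x => dapp (s x i xi) p)) ->
  @smooth_fun R (prodm M (euclid R (sumn d))) (D `*` setT) (fun p => Theta (s p.1) p.2 0 k).
Proof.
move=> mM oD ls ss; have [n [y [l xiE]]] := evp_span R d (wt k).
have mE := euclid_manifold R (sumn d).
refine (@smooth_fun_ext R (prodm M (euclid R (sumn d))) (D `*` setT) (fun p =>
  \sum_j mev (sub_val (l j)) p.2 * dapp (s p.1 (wt k) (evp (wt k) (y j))) (varp R k)) _
  (mfd_inj (prodm_manifold mM mE)) _ _ _).
- by apply: mopenX => //; exact: mopenT.
- move=> [x z] [/= Dx _]; rewrite mxE [in RHS](xiE (evp (wt k) z)).
  rewrite (linear_sumE (ls x _ Dx)) dappl_sum; apply: eq_bigr => j _.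
  by rewrite (linear_ZE (ls x _ Dx)) dapplZ evpE.
apply: smooth_fun_sum => j; apply: smooth_funM.
  have sl : @smooth_fun R (euclid R (sumn d)) setT (mev (sub_val (l j))).
    by apply/smooth_fun_euclid; [exact: openT|exact: Cinf_mev openT].
  by apply: smooth_fun_sub (@smooth_fun_snd R M (euclid R (sumn d)) setT _ sl) => p.
exact: (@smooth_fun_fst R M (euclid R (sumn d)) D _ (ss (wt k) (evp (wt k) (y j)) (varp R k))).
Qed.

End SmoothTheta.

(** * Fullness *)

Section Full.
Context (R : realType) (F E : gb R) (m : gcmor (circ_obj F) (circ_obj E)).
Hypothesis hm : is_gpcb_mor m.
Let gF := gbP F.
Let mF := gb_mfd gF.
Let mB := gb_base gF.
Let gE := gbP E.
Let mE := gb_mfd gE.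
Let mBE := gb_base gE.
Let b : gbase F -> gbase E := mbase m.
Let mf x i : dual (ghom x i) -> dual (ghom (b x) i) := @mfib _ _ _ m x i.

Lemma full_point x (y : gfib x) : exists y' : gfib (b x), forall i, mf (evg i y) = evg i y'.
Proof. by have [_ hx _] := hm; exact: (glike_evgP (glike_hom (hx x) (glike_evg y))). Qed.

(** The proof [q] that the image lies over [b x] is part of the statement because [evg] takes a
    point of the fibre. *)
Lemma full_fun : exists f : F -> E, forall x (y : gfib x),
  exists q : gact 0 (f (sval y)) = sval (b x),
    forall i, mf (evg i y) = evg i (exist _ _ q : gfib (b x)).
Proof.
have /choice[f fP] : forall y : F, exists y' : E, exists q : gact 0 y' = sval (b (gproj y)),
    forall i, mf (evg i (exist _ y erefl : gfib (gproj y))) =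
      evg i (exist _ _ q : gfib (b (gproj y))).
  by move=> y; have [[y' q] yq] := full_point (exist _ y erefl : gfib (gproj y)); exists y', q.
(* [f] was chosen with y in the fibre over [gproj y], which equals x only propositionally;
   eliminating that equality reduces to this case. *)
exists f => x y; have e := gfib_gproj y; case: y e => y py /= e.
case: x / e py => py; rewrite (Prop_irrelevance py erefl); exact: fP.
Qed.

Lemma mf_linear x i : linear (@mf x i).
Proof. by have [_ hx _] := hm; have [lx _ _] := hx x; exact: lx. Qed.

Lemma circ_full : exists f : gbhom F E, circ_mor f = m.
Proof.
have [f fP] := full_fun; have [sb hx vm] := hm.
have f_act t y : f (gact t y) = gact t (f y).
  pose yf : gfib (gproj y) := exist _ y erefl.
  pose yt : gfib (gproj y) := exist _ _ (gact_fib t yf).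
  have [q qE] := fP _ yf; have [q' q'E] := fP _ yt.
  pose yf' : gfib (b (gproj y)) := exist _ _ q.
  have := @evg_inj R E _ _ (exist _ _ q' : gfib (b (gproj y)))
    (exist _ _ (gact_fib t yf') : gfib (b (gproj y))); apply=> i; congr existT.
  rewrite -q'E /yt evg_act (linear_ZE (@mf_linear _ i)) qE.
  by rewrite -(evg_act t i yf').
have fib_f y : gproj (f y) = b (gproj y).
  have [q _] := fP _ (exist _ y erefl : gfib (gproj y)).
  by apply: sval_inj; exact: q.
have sf : smooth_map setT f.
  apply: smooth_map_pt => y _; have [d dP] := gb_loc_triv F; have [d' dP'] := gb_loc_triv E.
  have [U [phi [psi [Ux lt]]]] := dP (gproj y).
  have [U' [phi' [psi' [U'x lt']]]] := dP' (b (gproj y)).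
  have [oU sphi _ [phiK _ phi1 _ _]] := lt; have [oU' _ spsi' [phiK' psiK' phi1' _ _]] := lt'.
  pose D := U `&` b @^-1` U'.
  have oD : mopen D.
    by apply: mopenI => //; have := mopen_preimage mB mBE sb (mopenT mB) oU'; rewrite setTI.
  pose s x i (xi : poly_co R d i) : poly_co R d' i :=
    @loc_sigma R E d' phi' (b x) i (@mf x i (@loc_tau R F d phi x i xi)).
  have ls x i : linear (@s x i).
    move=> a u v; rewrite /s loc_tau_linear mf_linear.
    by rewrite loc_sigma_linear.
  have ss i xi p : smooth_fun D (fun x => dapp (@s x i xi) p).
    have sD : smooth_map D (@id (gbase F)) by apply: smooth_map_sub (smooth_map_id mB).
    have sbD : smooth_map D b by apply: smooth_map_sub sb.
    have tau := smooth_vmor_sub (fun z (Dz : D z) => proj1 Dz) (smooth_loc_tau (i := i) lt).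
    have c1 := smooth_vmor_comp mB mB oD sD (fun x _ => I) (fun y _ => @circ_cover R F i y)
      (fun psi => @circ_open R F i psi) tau (vm i).
    have c2 := smooth_vmor_comp mB mBE oD sbD (fun x (Dx : D x) => proj2 Dx)
      (fun y _ => @circ_cover R E i y) (fun psi => @circ_open R E i psi) c1
      (smooth_loc_sigma (i := i) lt').
    have [K _] := @smooth_vmor_triv R (gbase F) (gbase E) mB d d' i D b (fun x => @s x i) oD
      (fun x _ => ls x i).
    exact: K c2 xi p.
  (* The coordinate expression of [f]. It is smooth by [smooth_Theta], and [f] will be identified
     with [psi'] after [h] after [phi] by comparing evaluations. *)
  pose h (p : trivgb F d) : trivgb E d' := (b p.1, Theta (@s p.1) p.2).
  have mT := trivgb_manifold F d; have mT' := trivgb_manifold E d'.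
  have oDT : @mopen R (trivgb F d) (D `*` setT).
    exact: (mopenX oD (mopenT (euclid_manifold R _))).
  have sh : @smooth_map R (trivgb F d) (trivgb E d') (D `*` setT) h.
    apply: smooth_map_pair => //.
      have := smooth_map_comp mT mB (mopenT mT) (smooth_map_fst mB (euclid_manifold R (sumn d))) sb.
      by apply: smooth_map_sub => p.
    apply/smooth_map_euclid => // k.
    by apply: smooth_Theta => // x i _; exact: ls.
  have oDF : mopen [set z : F | D (gproj z)] by exact: mopen_gproj.
  have sphiD : smooth_map [set z | D (gproj z)] phi by apply: smooth_map_sub sphi => z [].
  have s1 := smooth_map_comp mF mT oDF sphiD sh.
  have oD1 : mopen ([set z | D (gproj z)] `&` phi @^-1` (D `*` setT)).
    exact: (mopen_preimage mF mT sphiD oDF oDT).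
  have s2 := smooth_map_comp mF mT' oD1 s1 spsi'.
  exists [set z : F | D (gproj z)] => //.
  have D1E z : D (gproj z) -> D (phi z).1 by move=> Dz; rewrite phi1 //; case: Dz.
  apply: (smooth_map_ext mF oDF _ (smooth_map_sub _ s2)) => z Dz /=; last first.
    split; first by split=> //; split=> //; exact: D1E.
    by rewrite /preimage /= phi1; case: Dz.
  have [Uz U'z] := Dz; pose zf : gfib (gproj z) := exist _ z erefl.
  have [q qE] := fP _ zf; rewrite -(phiK' (f z)); last by rewrite fib_f.
  congr psi'; rewrite [RHS]surjective_pairing /h phi1 // phi1' ?fib_f //; congr pair.
  apply: ThetaE => i; rewrite /s -(loc_sigma_evg lt i zf) // (loc_sigmaK lt) // qE.
  by rewrite (loc_sigma_evg lt').
have fh : is_gbhom f by split.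
pose f0 : gbhom F E := exist _ f fh; exists f0; apply: gcmor_ext => x i.
have bE : gbase_map (svalP f0) x = b x.
  by rewrite -(gproj_sval gE (gbase_map (svalP f0) x)) /= fib_f (gproj_sval gF).
have key (y : gfib x) : existT (fun x => dual (ghom x i)) (gbase_map (svalP f0) x)
    (@mfib _ _ _ (circ_mor f0) x i (evg i y)) =
  existT _ (b x) (mf (evg i y)).
  have [q ->] := fP x y; rewrite circ_mor_evg.
  exact: evg_eq.
have [lg _ _] := @ghom_push_hom R F E f (svalP f0) (gbase_map (svalP f0)) (fun=> erefl) x
  (fun i => fd_ghom_gb _ i).
move=> v; pose g : dual (ghom x i) -> dual (ghom (gbase_map (svalP f0) x) i) :=
  @mfib _ _ _ (circ_mor f0) x i.
have gl : linear g := lg i.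
change (existT (fun x => dual (ghom x i)) (gbase_map (svalP f0) x) (g v) = existT _ (b x) (mf v)).
(* Once its body is forgotten, [g] can follow the rewriting of its target fibre along [bE]; then
   both maps have the same type and evaluations decide. *)
move: key; rewrite -/g; clearbody g; move: g gl; rewrite bE => g gl key; congr existT.
by apply: (evg_ext gl (@mf_linear x i)) => y; exact: existT_inj2 (key y).
Qed.

End Full.

(** * The functor is essentially surjective *)

Section TotalSpace.
Context (R : realType) (E : gcbundle R) (hE : is_gvb E) (d : seq nat).
Let M := vbase E.
Let D := sumn d.
Context (U : M -> set M).
Context (tau : M -> forall x i, poly_co R d i -> @vfib R E x i).
Context (sigma : M -> forall x i, @vfib R E x i -> poly_co R d i).
Hypothesis oU : forall a, mopen (U a).
Hypothesis Uaa : forall a, U a a.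
Hypothesis tauH : forall a x, U a x -> is_gcoalg_hom (poly_coalg R d) (gcb_coalg x) (@tau a x).
Hypothesis sigmaH : forall a x, U a x -> is_gcoalg_hom (gcb_coalg x) (poly_coalg R d) (@sigma a x).
Hypothesis tauK : forall a x, U a x -> forall i, cancel (@tau a x i) (@sigma a x i).
Hypothesis sigmaK : forall a x, U a x -> forall i, cancel (@sigma a x i) (@tau a x i).
Hypothesis tauS : forall a i, smooth_vmor (U a) (b := id)
  (@vtrivs R (triv_bundle M (poly_co R d)) i) (@vtrivs R E i) (fun x => @tau a x i).
Hypothesis sigmaS : forall a i, smooth_vmor (U a) (b := id)
  (@vtrivs R E i) (@vtrivs R (triv_bundle M (poly_co R d)) i) (fun x => @sigma a x i).
Let mM : is_manifold M := gvb_base hE.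
Let mR := euclid_manifold R D.
Let P := prodm M (euclid R D).
Let mP : is_manifold P := prodm_manifold mM mR.

(* The change of fibre coordinates at [x] from the trivialization [a] to [b] *)
Definition tr (a b x : M) (y : 'rV[R]_D) : 'rV[R]_D :=
  Theta (fun i xi => @sigma b x i (@tau a x i xi)) y.

Lemma tr_hom a b x : U a x -> U b x ->
  is_gcoalg_hom (poly_coalg R d) (poly_coalg R d) (fun i xi => @sigma b x i (@tau a x i xi)).
Proof. by move=> Uax Ubx; exact: (gcoalg_hom_comp (tauH Uax) (sigmaH Ubx)). Qed.

Lemma evp_tr a b x i y : U a x -> U b x ->
  @evp R d i (tr a b x y) = @sigma b x i (@tau a x i (evp i y)).
Proof. by move=> Uax Ubx; rewrite -(Theta_evp i y (tr_hom Uax Ubx)). Qed.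

(** The cocycle relation. Evaluations determine points, and on them the two changes compose with
    [sigma] and [tau] of [b] cancelling in the middle. *)
Lemma tr_comp a b c x y : U a x -> U b x -> U c x -> tr b c x (tr a b x y) = tr a c x y.
Proof.
by move=> Uax Ubx Ucx; apply: evp_inj => i; rewrite !evp_tr // sigmaK.
Qed.

Lemma tr_id a x y : U a x -> tr a a x y = y.
Proof. by move=> Uax; apply: evp_inj => i; rewrite evp_tr // tauK. Qed.

Lemma trK a b x : U a x -> U b x -> cancel (tr a b x) (tr b a x).
Proof. by move=> Uax Ubx y; rewrite tr_comp // tr_id. Qed.

Lemma tr_wscale a b x t y : U a x -> U b x -> tr a b x (wscale t y) = wscale t (tr a b x y).
Proof. by move=> Uax Ubx; apply: Theta_wscale => i; have [] := tr_hom Uax Ubx. Qed.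

Lemma tr0 a b x : U a x -> U b x -> tr a b x 0 = 0.
Proof. by move=> Uax Ubx; rewrite -(wscale0 (0 : 'rV[R]_D)) tr_wscale // !wscale0. Qed.

Lemma mopenUU a b : mopen (U a `&` U b). Proof. exact: mopenI. Qed.

Lemma smooth_tr a b : @smooth_map R P (euclid R D) ((U a `&` U b) `*` setT)
  (fun q => tr a b q.1 q.2).
Proof.
have oX := mopenX (@mopenUU a b) (mopenT mR).
apply/smooth_map_euclid => // k.
refine (@smooth_Theta R M d d (U a `&` U b) (fun x i xi => @sigma b x i (@tau a x i xi)) k
  mM (@mopenUU a b) _ _).
  by move=> x i [Uax Ubx]; have [] := tr_hom Uax Ubx.
have sid : smooth_map (U a `&` U b) (@id M) by apply: smooth_map_sub (smooth_map_id mM).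
move=> i xi p.
have ta := smooth_vmor_sub (fun x (H : (U a `&` U b) x) => proj1 H) (@tauS a i).
have sb := smooth_vmor_sub (fun x (H : (U a `&` U b) x) => proj2 H) (@sigmaS b i).
have c := smooth_vmor_comp mM mM (@mopenUU a b) sid (fun x H => H) (fun y _ => gvb_cover hE i y)
  (fun psi => gvb_open hE (phi := psi)) ta sb.
have [K _] := @smooth_vmor_triv R M M mM d d i (U a `&` U b) id
  (fun x xi => @sigma b x i (@tau a x i xi)) (@mopenUU a b)
  (fun x H => (let: And3 l _ _ := tr_hom (proj1 H) (proj2 H) in l) i).
exact: K c xi p.
Qed.

Definition tot_chart (a : M) (c : chart R M) : chart R (M * 'rV[R]_D)%type :=
  Chart [set p | cdom c p.1 /\ U a p.1] (fun p => row_mx (cmap c p.1) (tr p.1 a p.1 p.2)).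

(* The fibre over [x] is identified with R^d through the trivialization
   chosen at [x] itself, so the charts are twisted by [tr x a x]. *)
Definition tot : mdata R := @MData R (M * 'rV[R]_D)%type
  [set c | exists a c0, atlas c0 /\ c = tot_chart a c0].

Definition tphi a (p : tot) : P := (p.1, tr p.1 a p.1 p.2).
Definition tpsi a (q : P) : tot := (q.1, tr a q.1 q.1 q.2).

Lemma tphiK a p : U a p.1 -> tpsi a (tphi a p) = p.
Proof. by case: p => x y /= Uax; rewrite /tpsi /= trK. Qed.

Lemma tpsiK a q : U a q.1 -> tphi a (tpsi a q) = q.
Proof. by case: q => x y /= Uax; rewrite /tphi /= trK. Qed.

Definition prod_chart (c : chart R M) : chart R P :=
  Chart (cdom c `*` setT) (fun q : P => row_mx (cmap c q.1) (q.2 : 'rV[R]_D)).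

Lemma prod_chartP c : atlas c -> atlas (prod_chart c).
Proof. by move=> ac; exists c, (Chart setT id); split. Qed.

Lemma prod_chartI c : atlas c -> exists2 c0, @atlas R M c0 & c = prod_chart c0.
Proof. by move=> [c0 [c' [ac -> ->]]]; exists c0. Qed.

(** [tot_chart a c] is [prod_chart c] after [tphi a]. This moves every question about charts of the
    total space to the product manifold. *)
Lemma tot_image a c (W : set tot) :
  cmap (tot_chart a c) @` (cdom (tot_chart a c) `&` W) =
  cmap (prod_chart c) @` (cdom (prod_chart c) `&` [set q | U a q.1 /\ W (tpsi a q)]).
Proof.
apply/seteqP; split=> [_ [p [[cp Uap] Wp] <-]|_ [q [[cq _] [Uaq Wq]] <-]].
  by exists (tphi a p) => //; split=> //; split=> //; rewrite tphiK.
by exists (tpsi a q) => //=; rewrite trK.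
Qed.

Lemma mopen_tot (W : set tot) :
  mopen W <-> forall a, @mopen R P [set q | U a q.1 /\ W (tpsi a q)].
Proof.
split=> [oW a _ /prod_chartI[c ac ->]|oW _ [a [c [ac ->]]]].
  rewrite -tot_image; exact: (oW (tot_chart a c) (ex_intro _ a (ex_intro _ c (conj ac erefl)))).
by rewrite tot_image; exact: oW (prod_chartP ac).
Qed.

Lemma mopen_tot_base (V : set M) : mopen V -> @mopen R tot [set p | V p.1].
Proof.
move=> oV; apply/mopen_tot => a; rewrite (_ : mkset _ = (U a `&` V) `*` setT).
  by apply: mopenX; [exact: mopenI|exact: mopenT].
by apply/seteqP; split=> [[x y] [/= Ux Vx]|[x y] [/= [Ux Vx] _]].
Qed.

Lemma mopen_tot_box a (V : set M) (O : set 'rV[R]_D) : mopen V -> V `<=` U a -> open O ->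
  @mopen R tot [set p | V p.1 /\ O (tphi a p).2].
Proof.
move=> oV VU oO; apply/mopen_tot => b.
have oX : @mopen R P ((U b `&` V) `*` setT).
  by apply: mopenX; [exact: mopenI|exact: mopenT].
have st : @smooth_map R P (euclid R D) ((U b `&` V) `*` setT) (fun q => tr b a q.1 q.2).
  by apply: smooth_map_sub (@smooth_tr b a) => -[x y] [/= [Ux Vx] _]; do 2! split=> //;
    exact: VU.
have oOm : @mopen R (euclid R D) O by exact/mopen_euclid.
have := mopen_preimage mP mR st oX oOm; congr mopen.
apply/seteqP; split=> [[x y] [[/= [Ux Vx] _] Oxy]|[x y] [/= Ux [Vx Oxy]]].
  by split=> //; split=> //=; rewrite /tphi /= tr_comp //; exact: VU.
by split=> //; move: Oxy; rewrite /tphi /preimage /= tr_comp //; exact: VU.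
Qed.

Lemma tot_inj : charts_inj tot.
Proof.
move=> _ [x y] [x' y'] [a [c [ac ->]]] [/= cx Ux] [/= cx' Ux'] /eq_row_mx[ex].
rewrite -(mfd_inj mM ac cx cx' ex) => /(congr1 (tr a x x)).
by rewrite !trK // => ->.
Qed.

Lemma smooth_tot_coord a b c j : atlas c ->
  @smooth_fun R P (((U a `&` U b) `&` cdom c) `*` setT)
    (fun q => row_mx (cmap c q.1) (tr a b q.1 q.2) 0 j).
Proof.
move=> ac; rewrite -(fintype.splitK j); case: (fintype.split j) => k /=.
  under eq_fun do rewrite row_mxEl.
  have := @smooth_fun_fst R M (euclid R D) (cdom c) _ (smooth_chart k mM ac).
  by apply: smooth_fun_sub => -[x y] [[_ cx] _].
under eq_fun do rewrite row_mxEr.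
have oX := mopenX (@mopenUU a b) (mopenT mR).
have := (smooth_map_euclid _ oX).1 (@smooth_tr a b) k.
by apply: smooth_fun_sub => -[x y] [[Ux cx] _].
Qed.

Lemma tot_trans (c c' : chart R tot) : atlas c -> atlas c' ->
  open (cmap c @` (cdom c `&` cdom c')) /\
  forall j, exists2 G, Cinf (cmap c @` (cdom c `&` cdom c')) G &
    forall x, cdom c x -> cdom c' x -> cmap c' x 0 j = G (cmap c x).
Proof.
move=> [a [c1 [ac1 ->]]] [b [c2 [ac2 ->]]].
have oC : mopen (cdom c2 `&` U b) by apply: mopenI => //; exact: mopen_cdom.
have oW : mopen (cdom (tot_chart b c2) : set tot) by exact: (mopen_tot_base oC).
have aT : @atlas R tot (tot_chart a c1) by exists a, c1.
split=> [|j]; first exact: oW aT.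
have Wab : [set q : P | U a q.1 /\ cdom (tot_chart b c2) (tpsi a q)] =
    ((U a `&` U b) `&` cdom c2) `*` setT.
  by apply/seteqP; split=> [[x y] [/= Ux [cx Ubx]]|[x y] [/= [[Ux Ubx] cx] _]].
have oV : mopen ((U a `&` U b) `&` cdom c2).
  by apply: (mopenI mM); [exact: mopenUU|exact: mopen_cdom].
have oVT : @mopen R P (((U a `&` U b) `&` cdom c2) `*` setT).
  by apply: mopenX => //; exact: mopenT.
have sg := @smooth_tot_coord a b c2 j ac2.
have [G CG GE] := smooth_fun_glue (mfd_inj mP) sg (prod_chartP ac1) (oVT _ (prod_chartP ac1)).
exists G; first by rewrite tot_image Wab.
move=> [x y] [/= cx Uax] [c2x Ubx].
have := GE (tphi a (x, y)) (conj cx I) (conj (conj (conj Uax Ubx) c2x) I).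
by rewrite /tphi /= tr_comp // => ->.
Qed.

Lemma tot_hausdorff (p p' : tot) : p <> p' ->
  exists W W' : set tot, [/\ mopen W, mopen W', W p, W' p' & W `&` W' = set0].
Proof.
case: p p' => [x y] [x' y'] pp; have [xx|xx] := pselect (x = x'); last first.
  have [V [V' [oV oV' Vx Vx' VV]]] := mfd_hausdorff mM xx.
  exists [set p | V p.1], [set p | V' p.1]; split=> //; try exact: mopen_tot_base.
  by apply/seteqP; split=> // -[z w] [/= Vz V'z]; have : set0 z by rewrite -VV.
have yy : y <> y' by move=> yy; apply: pp; rewrite xx yy.
subst x'; have [V [V' [oV oV' Vy Vy' VV]]] := mfd_hausdorff mR yy.
move/mopen_euclid in oV; move/mopen_euclid in oV'.
exists [set p | U x p.1 /\ V (tphi x p).2], [set p | U x p.1 /\ V' (tphi x p).2].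
split; try (exact: mopen_tot_box); try by split=> //=; rewrite /tphi /= tr_id.
apply/seteqP; split=> // p [[_ /= Vz] [_ V'z]].
by have : set0 (tphi x p).2 by rewrite -VV.
Qed.

(** The trivializations are indexed by all points of [M], so countably many must be selected: for
    each basic set [B k0] lying in some [U a], one such [a] is fixed. The basis of [tot] is then
    indexed by triples: k0 for the trivialization, k for the base and l for the fibre. *)
Lemma tot_countable : exists B : nat -> set tot, (forall k, mopen (B k)) /\
  forall W p, mopen W -> W p -> exists k, B k p /\ B k `<=` W.
Proof.
have [B [oB BP]] := mfd_countable mM; have [Q [oQ QP]] := rV_countable_base R D.
have /choice[a aP] : forall k, exists a : option M,
    if a is Some a then B k `<=` U a else forall a, ~ (B k `<=` U a).
  by move=> k; have [[a aU]|/forallNP na] := pselect (exists a, B k `<=` U a);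
    [exists (Some a)|exists None].
pose B' n : set tot := if unpickle n is Some (k0, k, l) then
  if a k0 is Some a then [set p | (B k0 `&` B k) p.1 /\ Q l (tphi a p).2] else set0 else set0.
exists B'; split=> [n|W [x y] oW Wxy].
  have o0 : @mopen R tot set0 by move=> c _; rewrite setI0 image_set0; exact: open0.
  rewrite /B'; case: unpickle => // -[[k0 k] l]; case aE: (a k0) => [b|//].
  apply: mopen_tot_box => //; first exact: mopenI.
  by move=> z [Bz _]; have := aP k0; rewrite aE; exact.
have [k0 [Bx BU]] := BP _ x (@oU x) (Uaa x).
(* The value None is impossible here, because [B k0] lies in [U x]. *)
have := aP k0; case aE: (a k0) => [b|] Bb; last by case: (Bb x).
have Ubx : U b x by exact: Bb.
have oWb := (mopen_tot W).1 oW b.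
have Wb : [set q : P | U b q.1 /\ W (tpsi b q)] (x, tr x b x y).
  by split=> //=; rewrite /tpsi /= trK.
have [V [V' [oV oV' Vx V'y VW]]] := mopen_box mM mR oWb Wb.
have [k [Bkx BV]] := BP _ x oV Vx.
have [l [Qy QV]] := QP _ _ ((mopen_euclid _).1 oV') V'y.
exists (pickle (k0, k, l)); rewrite /B' pickleK aE; split=> // -[x' y'] [/= [B0 Bk] Ql].
have [/= Ubx' Wxy'] := VW (x', tr x' b x' y') (conj (BV _ Bk) (QV _ Ql)).
by move: Wxy'; rewrite /tpsi /= trK.
Qed.

Lemma tot_manifold : is_manifold tot.
Proof.
split; [| |exact: tot_inj|exact: tot_trans|exact: tot_hausdorff|exact: tot_countable].
- have [n nP] := mfd_dim mM; exists (n + D)%N => _ p [a [c [ac ->]]] [/= cp _].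
  by rewrite (nP _ _ ac cp).
- move=> [x y]; have [c ac cx] := mfd_cover mM x.
  by exists (tot_chart x c) => //; exists x, c.
Qed.

Lemma smooth_tphi a : @smooth_map R tot P [set p | U a p.1] (tphi a).
Proof.
move=> p _ /= Uap /prod_chartI[c ac ->] [/= cp _].
have aT : @atlas R tot (tot_chart a c) by exists a, c.
exists (cdom (tot_chart a c)); split=> //; first exact: mopen_cdom tot_manifold aT.
  by move=> q [].
by move=> j; exact: (@smooth_chart R tot (tot_chart a c) j tot_manifold aT).
Qed.

Lemma smooth_tpsi a : @smooth_map R P tot [set q | U a q.1] (tpsi a).
Proof.
move=> q _ /= Uaq [b [c [ac ->]]] [/= cq Ubq].
have oV : @mopen R P (((U a `&` U b) `&` cdom c) `*` setT).
  apply: mopenX; last exact: mopenT.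
  by apply: (mopenI mM); [exact: mopenUU|exact: mopen_cdom].
exists (((U a `&` U b) `&` cdom c) `*` setT); split=> //.
  by move=> r [[[_ Ubr] cr] _].
move=> j; apply: (smooth_fun_ext (mfd_inj mP) oV _ (@smooth_tot_coord a b c j ac)).
by move=> [x y] [[[/= Uax Ubx] cx] _]; rewrite /= tr_comp.
Qed.

Lemma mopen_totU a : @mopen R tot [set p | U a p.1].
Proof. exact: mopen_tot_base. Qed.

Lemma smooth_tot_fst : @smooth_map R tot M setT fst.
Proof.
apply: smooth_map_pt => p _; exists [set q | U p.1 q.1] => //=.
have := smooth_map_comp tot_manifold mP (@mopen_totU p.1) (@smooth_tphi p.1)
  (smooth_map_fst mM mR).
by apply: smooth_map_sub => q Uq.
Qed.

Lemma smooth_tot_zero : @smooth_map R M tot setT (fun x => (x, 0)).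
Proof.
apply: smooth_map_pt => a _; exists (U a) => //.
have sp : @smooth_map R M P setT (fun x => (x, 0)).
  by apply: smooth_map_pair => //; [exact: smooth_map_id|exact: smooth_map_cst].
have := smooth_map_comp mM mP (mopenT mM) sp (@smooth_tpsi a).
move=> /(smooth_map_sub (V := U a) (fun x Ux => conj I Ux)).
by apply: smooth_map_ext => // x Ux; rewrite /tpsi /= tr0.
Qed.

Definition tot_gb : gbdata R := @GBData R tot (fun t p => (p.1, wscale t p.2)).

Lemma smooth_funX (N : mdata R) (V : set N) g n : smooth_fun V g ->
  smooth_fun V (fun x => g x ^+ n).
Proof.
move=> sg; elim: n => [|n IH]; first by under eq_fun do rewrite expr0; exact: smooth_fun_cst.
by under eq_fun do rewrite exprS; exact: smooth_funM.
Qed.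

Lemma tot_smooth_act : smooth_map [set: prodm (realm R) tot_gb]
  ((fun p => gact p.1 p.2) : prodm (realm R) tot_gb -> tot_gb).
Proof.
have mT : is_manifold tot_gb := tot_manifold; have mL := realm_manifold R.
have mLT := prodm_manifold mL mT.
apply: smooth_map_pt => -[t p] _; set a := p.1.
pose V : set (prodm (realm R) tot_gb) := setT `*` [set q | U a q.1].
have oV : mopen V by apply: mopenX; [exact: mopenT|exact: mopen_totU].
exists V; first by split=> //; exact: Uaa.
have sphi := smooth_map_comp mT mP (@mopen_totU a) (@smooth_tphi a) (smooth_map_snd mM mR).
have sl : @smooth_fun R (realm R) setT id.
  by apply/smooth_map_realm; [exact: mopenT|exact: smooth_map_id].
pose h (r : prodm (realm R) tot_gb) : P := (r.2.1, wscale r.1 (tphi a r.2).2).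
have sh : smooth_map V h.
  apply: smooth_map_pair => //.
    have := smooth_map_comp mLT mT (mopenT mLT) (smooth_map_snd mL mT) smooth_tot_fst.
    by apply: smooth_map_sub => r.
  apply/smooth_map_euclid => // k; under eq_fun do rewrite mxE.
  apply: smooth_funM.
    by apply: smooth_funX; apply: smooth_fun_sub (@smooth_fun_fst R _ tot_gb _ _ sl) => r.
  have := (smooth_map_euclid _ (@mopen_totU a)).1 (smooth_map_sub _ sphi) k.
  move=> /(_ _)H; have H' := H (fun q Uq => conj Uq I).
  by have := @smooth_fun_snd R (realm R) tot_gb _ _ H'.
have := smooth_map_comp mLT mP oV sh (@smooth_tpsi a).
move=> /(smooth_map_sub (V := V) (fun r Vr => conj Vr (proj2 Vr))).
apply: smooth_map_ext => // -[s [x y]] [_ /= Uax].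
by rewrite /tpsi /h /= tr_wscale // trK.
Qed.

Lemma tot_base0 (s : gbase tot_gb) : sval s = ((sval s).1, 0).
Proof. by case: s => _ /= [p _ <-] /=; rewrite wscale0. Qed.

Definition tot_zero (x : M) : gbase tot_gb :=
  exist _ (x, 0) (ex_intro2 _ _ (x, 0) I (congr1 (pair x) (wscale0 0))).

Lemma tot_zeroK (s : gbase tot_gb) : tot_zero (sval s).1 = s.
Proof. by apply: sval_inj; rewrite [RHS]tot_base0. Qed.

Definition base_chart (c : chart R M) : chart R (gbase tot_gb) :=
  @Chart R (gbase tot_gb) (cdim c) [set s | cdom c (sval s).1] (fun s => cmap c (sval s).1).

(** The base of [tot_gb] is the zero section, and the charts of [M] are checked against all the
    clauses of [submfd]. *)
Lemma base_chartP c : atlas c -> @atlas R (gbase tot_gb) (base_chart c).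
Proof.
move=> ac; have mT : is_manifold tot_gb := tot_manifold.
have image V : cmap (base_chart c) @` (cdom (base_chart c) `&` [set s | V (sval s).1]) =
    cmap c @` (cdom c `&` V).
  apply/seteqP; split=> [_ [s [cs Vs] <-]|_ [x [cx Vx] <-]]; first by exists (sval s).1.
  by exists (tot_zero x).
split.
- by exists [set p | cdom c p.1] => //; apply: mopen_tot_base; exact: mopen_cdom.
- have := image setT; rewrite (_ : [set s | _] = setT) ?setIT => [->|]; last exact/seteqP.
  by have := mopenT mM ac; rewrite setIT.
- move=> s s' cs cs' /(mfd_inj mM ac cs cs') e.
  by rewrite -(tot_zeroK s) -(tot_zeroK s') e.
- move=> j s cs; exists [set p | cdom c p.1], (fun p => cmap c p.1 0 j); split=> //.
    by apply: mopen_tot_base; exact: mopen_cdom.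
  have := smooth_fun_comp mT mM smooth_tot_fst (mopenT mT) (smooth_chart j mM ac).
  by apply: smooth_fun_sub => p cp; split.
- move=> s _ cs [a [c' [ac' ->]]] [/= c's Uas].
  pose V : set (gbase tot_gb) := [set s' | (cdom c' `&` U a) (sval s').1].
  have oc' : mopen (cdom c' `&` U a) by apply: mopenI => //; exact: mopen_cdom.
  exists V; split=> //; first by move=> _ ->; rewrite image; exact: oc'.
  move=> j s' _ [c's' Uas'] -> cs' /=.
  rewrite -(fintype.splitK j); case: (fintype.split j) => k /=.
    have [oO /(_ k)[G CG GE]] := mfd_trans mM ac ac'.
    exists (cmap c @` (cdom c `&` cdom c')), G; split=> //; first by exists (sval s').1.
    move=> r cr [z [cz c'z] e]; have rz := mfd_inj mM ac cz cr e.
    by rewrite row_mxEl GE // -rz.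
  (* The fibre coordinates vanish identically on the zero section, since the changes of coordinates
     fix 0. *)
  have [oO _] := mfd_trans mM ac ac'.
  have oI : open (cmap c @` (cdom c `&` U a)) by exact: oU.
  exists (cmap c @` (cdom c `&` U a)), (fun=> 0); split=> //.
  - by exists (sval s').1.
  - by move=> n; exact: Ck_cst.
  - move=> r cr [z [cz Uz] e]; have rz := mfd_inj mM ac cz cr e; subst z.
    by rewrite row_mxEr tot_base0 /= tr0 // mxE.
Qed.

Lemma tot_base_manifold : is_manifold (gbase tot_gb).
Proof.
have [n nP] := mfd_dim mM; apply: (submfd_manifold (n := n) tot_manifold) => s.
have [c ac cs] := mfd_cover mM (sval s).1.
by exists (base_chart c); split=> //; [exact: base_chartP|exact: nP ac cs].
Qed.

Lemma smooth_tot_base : @smooth_map R (gbase tot_gb) M setT (fun s => (sval s).1).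
Proof.
have mB := tot_base_manifold; have mT : is_manifold tot_gb := tot_manifold.
have := smooth_map_comp mB mT (mopenT mB) (@smooth_map_sval R tot_gb mT _) smooth_tot_fst.
by apply: smooth_map_sub.
Qed.

Lemma smooth_tot_zero_base : @smooth_map R M (gbase tot_gb) setT tot_zero.
Proof.
have mT : is_manifold tot_gb := tot_manifold.
have := smooth_map_comp mM mT (mopenT mM) smooth_tot_zero (smooth_gproj_act mT tot_smooth_act).
rewrite setTI preimage_setT; apply: smooth_map_ext => //; first exact: mopenT.
by move=> x _; apply: sval_inj; rewrite /= wscale0.
Qed.

Definition tot_U a : set (gbase tot_gb) := [set s | U a (sval s).1].
Definition tot_phi a (p : tot_gb) : trivgb tot_gb d := (gproj p, (tphi a p).2).
Definition tot_psi a (q : trivgb tot_gb d) : tot_gb := tpsi a ((sval q.1).1, q.2).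

Lemma tot_loc_triv a : loc_triv (tot_U a) (tot_phi a) (tot_psi a).
Proof.
have mT : is_manifold tot_gb := tot_manifold; have mB := tot_base_manifold.
have mBR := prodm_manifold mB mR.
split; [exact: (mopen_sval mT (@mopen_totU a))| | |split].
- apply: smooth_map_pair => //.
    by apply: smooth_map_sub (smooth_gproj_act mT tot_smooth_act).
  have := smooth_map_comp mT mP (@mopen_totU a) (@smooth_tphi a) (smooth_map_snd mM mR).
  by apply: smooth_map_sub => p Up.
- have sq : @smooth_map R (trivgb tot_gb d) P setT (fun q => ((sval q.1).1, q.2)).
    apply: smooth_map_pair => //; last exact: smooth_map_snd.
    have := smooth_map_comp mBR mB (mopenT mBR) (smooth_map_fst mB mR) smooth_tot_base.
    by apply: smooth_map_sub.
  have := smooth_map_comp mBR mP (mopenT mBR) sq (@smooth_tpsi a).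
  by apply: smooth_map_sub => q Uq.
- by move=> p Up; exact: tphiK.
- move=> [s z] Us; rewrite /tot_phi /tot_psi tpsiK //=; congr pair.
  by rewrite -[RHS]tot_zeroK; apply: sval_inj; rewrite /= wscale0.
- by [].
- by move=> [s z] Us; rewrite -[RHS]tot_zeroK; apply: sval_inj; rewrite /= wscale0.
- by move=> t [x y] Ux; rewrite /tot_phi /tphi /= tr_wscale.
Qed.

Lemma tot_is_gb : is_gb tot_gb.
Proof.
split.
- exact: tot_manifold.
- exact: tot_smooth_act.
- by move=> t s [x y]; rewrite /= wscaleA.
- by move=> [x y]; rewrite /= wscale1.
- exact: tot_base_manifold.
- exists d => X; exists (tot_U (sval X).1), (tot_phi (sval X).1), (tot_psi (sval X).1).
  by have [oUX sphi spsi H] := tot_loc_triv (sval X).1; split=> //; exact: Uaa.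
Qed.

Let F : gb R := GB tot_is_gb.
Let mB : is_manifold (gbase F) := tot_base_manifold.

Lemma tot_lt a : @loc_triv R F d (tot_U a) (tot_phi a) (tot_psi a).
Proof. exact: tot_loc_triv. Qed.

Lemma tau_linear a x i : U a x -> linear (@tau a x i).
Proof. by move=> /tauH[l _ _]; exact: l. Qed.

Definition eta_fib a (X : gbase F) i (xi : dual (ghom X i)) : @vfib R E (sval X).1 i :=
  @tau a (sval X).1 i (@loc_sigma R F d (tot_phi a) X i xi).

(** By linearity it is enough to treat evaluations, and there every admissible index gives [tau x0]
    of the evaluation at the stored fibre coordinate. So [eta], which uses at each X the
    trivialization chosen at X itself, agrees near a point with a fixed trivialization, as
    smoothness requires. *)
Lemma eta_fib_indep a b (X : gbase F) i (xi : dual (ghom X i)) :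
  U a (sval X).1 -> U b (sval X).1 -> eta_fib a xi = eta_fib b xi.
Proof.
move=> Ua Ub; set x0 := (sval X).1 in Ua Ub *.
have le c : U c x0 -> linear (@eta_fib c X i).
  by move=> Uc k u v; rewrite /eta_fib loc_sigma_linear tau_linear.
apply: (evg_ext (le a Ua) (le b Ub)) => p.
have pE : (sval p).1 = x0 by have /(congr1 fst) := svalP p.
have key c : U c x0 -> eta_fib c (evg i p) = @tau x0 x0 i (evp i (sval p).2).
  move=> Uc; rewrite /eta_fib (loc_sigma_evg (tot_lt c) i p Uc) /tot_phi /tphi /=.
  by rewrite pE evp_tr // sigmaK.
by rewrite !key.
Qed.

Definition eta : gcmor (circ_obj F) E :=
  @GCMor R (circ_obj F) E (fun X => (sval X).1) (fun X i xi => eta_fib (sval X).1 xi).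

Definition zeta : gcmor E (circ_obj F) :=
  @GCMor R E (circ_obj F) tot_zero
    (fun x i v => @loc_tau R F d (tot_phi x) (tot_zero x) i (@sigma x x i v)).

Lemma mopen_tot_U a : @mopen R (gbase F) (tot_U a).
Proof. by have [] := tot_lt a. Qed.

Lemma eta_gpcb : is_gpcb_mor eta.
Proof.
split=> [|X|i].
- exact: smooth_tot_base.
- exact: (gcoalg_hom_comp (loc_sigma_hom (tot_lt (sval X).1) (@Uaa _)) (tauH (@Uaa _))).
apply: (smooth_vmor_pt mB) => X _; set a := (sval X).1.
exists (tot_U a); split; [exact: mopen_tot_U|exact: Uaa|].
have sid : smooth_map (tot_U a) (@id (gbase F)).
  by apply: smooth_map_sub (smooth_map_id mB).
have sbase : smooth_map (tot_U a) (fun s : gbase F => (sval s).1 : M).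
  by apply: smooth_map_sub smooth_tot_base.
(* [eta] changes the base from the zero section to [M]. The change is made between trivial bundles,
   by the identity over the base map, after [loc_sigma] and before [tau a]. *)
have [_ bc] := @smooth_vmor_triv R (gbase F) M mB d d i (tot_U a) (fun s => (sval s).1)
  (fun _ xi => xi) (@mopen_tot_U a) (fun _ _ _ _ _ => erefl).
have c1 := smooth_vmor_comp mB mM (@mopen_tot_U a) sbase (fun s Us => Us)
  (fun y _ => @triv_bundle_cover R _ d i y)
  (fun psi => @triv_bundle_open R _ d i psi mM)
  (bc (fun xi p => @smooth_fun_cst R (gbase F) _ _)) (@tauS a i).
have c2 := smooth_vmor_comp mB mB (@mopen_tot_U a) sid (fun s Us => Us)
  (fun y _ => @triv_bundle_cover R _ d i y)
  (fun psi => @triv_bundle_open R _ d i psi mB)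
  (smooth_loc_sigma (i := i) (tot_lt a)) c1.
by apply: smooth_vmor_ext c2 => Y UY xi; exact: eta_fib_indep.
Qed.

Lemma eta_zeta_fib a x i (v : @vfib R E x i) : U a x ->
  @loc_tau R F d (tot_phi a) (tot_zero x) i (@sigma a x i v) = @mfib _ _ _ zeta x i v.
Proof.
move=> Uax.
have Ul c : U c x -> tot_U c (tot_zero x) by [].
have e : eta_fib a (@mfib _ _ _ zeta x i v) = v.
  rewrite (eta_fib_indep (b := x)) //.
  by rewrite /eta_fib /= (loc_tauK (tot_lt x)) ?sigmaK //; exact: Uaa.
by rewrite -{1}e /eta_fib /= tauK // (loc_sigmaK (tot_lt a)).
Qed.

Lemma zeta_gpcb : is_gpcb_mor zeta.
Proof.
split=> [|x|i].
- exact: smooth_tot_zero_base.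
- exact: (gcoalg_hom_comp (sigmaH (@Uaa _)) (loc_tau_hom (tot_lt x) (x := tot_zero x) (@Uaa _))).
apply: (smooth_vmor_pt mM) => a _; exists (U a); split; [exact: oU|exact: Uaa|].
have sid : smooth_map (U a) (@id M) by apply: smooth_map_sub (smooth_map_id mM).
have sz : smooth_map (U a) tot_zero by apply: smooth_map_sub smooth_tot_zero_base.
have [_ bc] := @smooth_vmor_triv R M (gbase F) mM d d i (U a) tot_zero
  (fun _ xi => xi) (@oU a) (fun _ _ _ _ _ => erefl).
have c1 := smooth_vmor_comp mM mM (@oU a) sid (fun s Us => Us)
  (fun y _ => @triv_bundle_cover R _ d i y)
  (fun psi => @triv_bundle_open R _ d i psi mM)
  (@sigmaS a i) (bc (fun xi p => @smooth_fun_cst R M _ _)).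
have c2 := smooth_vmor_comp mM mB (@oU a) sz (fun s (Us : U a s) => Us : tot_U a (tot_zero s))
  (fun y _ => @triv_bundle_cover R _ d i y)
  (fun psi => @triv_bundle_open R _ d i psi mB)
  c1 (smooth_loc_tau (i := i) (tot_lt a)).
by apply: smooth_vmor_ext c2 => x Ux v; exact: eta_zeta_fib.
Qed.

Lemma eta_zeta : gcmor_comp eta zeta = gcmor_id E.
Proof.
apply: gcmor_ext => x i v /=; congr existT.
by rewrite /eta_fib /= (loc_tauK (tot_lt x)) ?sigmaK //; exact: Uaa.
Qed.

Lemma zeta_eta : gcmor_comp zeta eta = gcmor_id (circ_obj F).
Proof.
apply: gcmor_ext => X i; rewrite -(tot_zeroK X) => xi /=; congr existT.
by rewrite /eta_fib /= tauK ?(loc_sigmaK (tot_lt (sval X).1)) //; exact: Uaa.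
Qed.

End TotalSpace.

Section EssentiallySurjective.
Context (R : realType).

Lemma circ_ess_surj (E : gcbundle R) : is_gpcb E -> exists (F : gb R)
  (u : gcmor (circ_obj F) E) (v : gcmor E (circ_obj F)),
  [/\ is_gpcb_mor u, is_gpcb_mor v, gcmor_comp u v = gcmor_id E &
      gcmor_comp v u = gcmor_id (circ_obj F)].
Proof.
move=> [hE [d dP]].
have /choice[U UP] := dP; have /choice[tau tauP] := UP; have /choice[sigma sP] := tauP.
have oU a : mopen (U a) by have [] := sP a.
have Uaa a : U a a by have [] := sP a.
have h a x : U a x -> [/\ is_gcoalg_hom (poly_coalg R d) (gcb_coalg x) (@tau a x),
    is_gcoalg_hom (gcb_coalg x) (poly_coalg R d) (@sigma a x),
    forall i, cancel (@tau a x i) (@sigma a x i) &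
    forall i, cancel (@sigma a x i) (@tau a x i)] by have [_ _ + _ _] := sP a; apply.
have h1 a x Ux := let: And4 p _ _ _ := h a x Ux in p.
have h2 a x Ux := let: And4 _ p _ _ := h a x Ux in p.
have h3 a x Ux := let: And4 _ _ p _ := h a x Ux in p.
have h4 a x Ux := let: And4 _ _ _ p := h a x Ux in p.
have ts a := let: And5 _ _ _ p _ := sP a in p.
have ss a := let: And5 _ _ _ _ p := sP a in p.
exists (GB (tot_is_gb hE oU Uaa h1 h2 h3 h4 ts ss)).
exists (eta hE oU Uaa h1 h2 h3 h4 ts ss), (zeta hE oU Uaa h1 h2 h3 h4 ts ss); split.
- exact: eta_gpcb.
- exact: zeta_gpcb.
- exact: eta_zeta.
- exact: zeta_eta.
Qed.

End EssentiallySurjective.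

(** * Equivalence *)

Section Equivalence.

(** The quasi-inverse sends h to the lift of h conjugated by the chosen isomorphisms [u] and [v];
    functoriality and naturality are checked after applying F, by faithfulness. *)
Lemma equivalence_of_full_faithful_ess_surj (C D : category) (F : functor C D) :
  (forall a b (g : chom (F a) (F b)), exists f : chom a b, fhom F f = g) ->
  (forall a b (f f' : chom a b), fhom F f = fhom F f' -> f = f') ->
  (forall d : D, exists (a : C) (u : chom (F a) d) (v : chom d (F a)),
    ccomp u v = cid d /\ ccomp v u = cid (F a)) ->
  is_equivalence F.
Proof.
move=> full faithful surj.
pose lift a b (g : chom (F a) (F b)) : chom a b := sval (boolp.cid (full a b g)).
have liftK a b (g : chom (F a) (F b)) : fhom F (lift a b g) = g := svalP (boolp.cid (full a b g)).
pose sob d := boolp.cid (surj d); pose ob d := sval (sob d).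
pose su d := boolp.cid (svalP (sob d)); pose u d : chom (F (ob d)) d := sval (su d).
pose sv d := boolp.cid (svalP (su d)); pose v d : chom d (F (ob d)) := sval (sv d).
have uvP d : ccomp (u d) (v d) = cid d /\ ccomp (v d) (u d) = cid (F (ob d)) := svalP (sv d).
have uv d : ccomp (u d) (v d) = cid d by case: (uvP d).
have vu d : ccomp (v d) (u d) = cid (F (ob d)) by case: (uvP d).
pose Gh a b (h : chom a b) : chom (ob a) (ob b) := lift _ _ (ccomp (v b) (ccomp h (u a))).
have GhK a b (h : chom a b) : fhom F (Gh a b h) = ccomp (v b) (ccomp h (u a)) by exact: liftK.
have G1 a : Gh a a (cid a) = cid (ob a).
  by apply: faithful; rewrite GhK ccomp1m vu fhom_id.
have GM a b c (g : chom b c) (f : chom a b) : Gh a c (ccomp g f) = ccomp (Gh b c g) (Gh a b f).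
  apply: faithful; rewrite fhom_comp !GhK -!ccompA; congr ccomp; congr ccomp.
  by rewrite [ccomp (u b) _]ccompA uv ccomp1m.
exists (Functor G1 GM); split.
  exists (fun a => lift _ _ (u (F a))), (fun a => lift _ _ (v (F a))); split=> [a b f|a|a] /=.
  - by apply: faithful; rewrite !fhom_comp !liftK ccompA uv ccomp1m.
  - by apply: faithful; rewrite fhom_comp fhom_id !liftK vu.
  - by apply: faithful; rewrite fhom_comp fhom_id !liftK uv.
exists u, v; split=> [a b f|a|a] //=.
by rewrite GhK ccompA uv ccomp1m.
Qed.

End Equivalence.

Theorem theorem4p10 (R : realType) :
  exists (circ_ob : forall F : gb R, is_gpcb (circ_obj F))
         (circ_hom : forall (F E : gb R) (f : gbhom F E), is_gpcb_mor (circ_mor f)),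
    is_equivalence (circ_functor circ_ob circ_hom).
Proof.
exists (@circ_gpcb R), (@circ_mor_gpcb R).
apply: equivalence_of_full_faithful_ess_surj => [F E [m hm]|F E f g /(congr1 sval)|[E hE]] /=.
- by have [f fm] := circ_full hm; exists f; exact: sval_inj.
- exact: circ_faithful.
- have [F [u [v [hu hv uv vu]]]] := circ_ess_surj hE.
  by exists F, (exist _ u hu), (exist _ v hv); split; exact: sval_inj.
Qed.
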